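(* Let $n\ge 1$, let $m_1,\dots,m_n$ be nonnegative integers, $|m|=m_1+\dots+m_n$, and let $a,b,c,d,e,f,g,z_1,\dots,z_n$ be nonzero complex numbers with $a^3q^{2+|m|}=bcdefg$. Put $\lambda=a^2q/bce$. Then $$\sum_{y_1=0}^{m_1}\cdots\sum_{y_n=0}^{m_n} \Bigg(\frac{\Delta(zq^y)}{\Delta(z)}\prod_{k=1}^n\frac{\theta(az_kq^{y_k+|y|})} {\theta(az_k)}\cdot\frac{(b,c,d)_{|y|}}{(aq/e,aq/f,aq/g)_{|y|}} \prod_{j=1}^n\frac{(az_j)_{|y|}}{(aq^{1+m_j}z_j)_{|y|}}\,q^{|y|}$$ $$\times\prod_{k=1}^n\frac{(ez_k,fz_k,gz_k)_{y_k}} {(aqz_k/b,aqz_k/c,aqz_k/d)_{y_k}} \prod_{j,k=1}^n\frac{(q^{-m_j}z_k/z_j)_{y_k}}{(qz_k/z_j)_{y_k}}\Bigg)$$ $$=\left(\frac a \lambda\right)^{|m|} \frac{(\lambda q/f,\lambda q/g)_{|m|}}{(aq/f,aq/g)_{|m|}} \prod_{k=1}^n\frac{(aqz_k,\lambda qz_k/d)_{m_k}}{(\lambda qz_k,aqz_k/d)_{m_k}}$$ $$\times\sum_{y_1=0}^{m_1}\cdots\sum_{y_n=0}^{m_n} \Bigg(\frac{\Delta(zq^y)}{\Delta(z)}\prod_{k=1}^n\frac{\theta(\lambda z_k q^{y_k+|y|})} {\theta(\lambda z_k)}\cdot \frac{(\lambda b/a,\lambda c/a,d)_{|y|}} {(aq/e,\lambda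 q/f,\lambda q/g)_{|y|}} \prod_{j=1}^n\frac{(\lambda z_j)_{|y|}}{(\lambda q^{1+m_j}z_j)_{|y|}} \,q^{|y|}$$ $$\times \prod_{k=1}^n\frac{(\lambda ez_k/a,fz_k,gz_k)_{y_k}} {(aqz_k/b,aqz_k/c,\lambda qz_k/d)_{y_k}} \prod_{j,k=1}^n\frac{(q^{-m_j}z_k/z_j)_{y_k}}{(qz_k/z_j)_{y_k}}\Bigg).$$
   Context: Fix $p\in\mathbb C$ with $|p|<1$ and $q\in\mathbb C\setminus\{0\}$. For $x\neq 0$ put $\theta(x)=\prod_{j=0}^\infty(1-p^jx)(1-p^{j+1}/x)$ (so $\theta(x)=1-x$ when $p=0$). The elliptic Pochhammer symbol is $(a)_k=\theta(a)\theta(aq)\cdots\theta(aq^{k-1})$ for integers $k\ge 0$, with $(a)_0=1$, and $(a_1,\dots,a_r)_k=(a_1)_k\cdots(a_r)_k$. Everything after a slash is in the denominator, e.g. $a^2q/bce$ means $a^2q/(bce)$. For $z=(z_1,\dots,z_n)$, the elliptic Vandermonde determinant is $\Delta(z)=\prod_{1\le j<k\le n}z_j\,\theta(z_k/z_j)$, and $zq^y=(z_1q^{y_1},\dots,z_nq^{y_n})$, $|y|=y_1+\dots+y_n$. Standing assumption: all expressions are well-defined, i.e. the parameters are such that no denominator occurring on either side vanishes. *)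

(* Defs.v *)
From HB Require Import structures.
From mathcomp Require Import all_boot all_order all_algebra.
From mathcomp Require Import complex.
From mathcomp Require Import all_classical all_reals all_analysis.

Set Implicit Arguments.
Unset Strict Implicit.
Unset Printing Implicit Defensive.

Import Order.TTheory GRing.Theory Num.Theory numFieldNormedType.Exports.

Local Open Scope ring_scope.
Local Open Scope complex_scope.

(* The partial products converge whenever `|p| < 1 and x != 0. The annotation
   R[i]^o is what gives the complex numbers their normed topology. Since
   0 ^+ 0 = 1, p = 0 yields 1 - x. *)
Definition theta (R : realType) (p x : R[i]) : R[i] :=
  limn (fun N : nat =>
    (\prod_(j < N) ((1 - p ^+ j * x) * (1 - p ^+ j.+1 / x)) : R[i]^o)).

Definition epoch1 (R : realType) (p q a : R[i]) (k : nat) : R[i] :=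
  \prod_(i < k) theta p (a * q ^+ i).

(* (a_1, ..., a_r)_k *)
Definition epoch (R : realType) (p q : R[i]) (s : seq R[i]) (k : nat) : R[i] :=
  \prod_(a <- s) epoch1 p q a k.

Definition vandermonde (R : realType) (p : R[i]) (n : nat) (z : 'I_n -> R[i]) :
    R[i] :=
  \prod_(j < n) \prod_(k < n | (j < k)%N) (z j * theta p (z k / z j)).

(* Multi-indices y with 0 <= y k <= m k for every k. *)
Notation multi m := {dffun forall k, 'I_(m k).+1}.

Definition weight (n : nat) (m : 'I_n -> nat) (y : multi m) : nat :=
  (\sum_(k < n) y k)%N.

(* Main.v *)
Require Import Defs.
From HB Require Import structures.
From mathcomp Require Import all_boot all_order all_algebra.
From mathcomp Require Import complex.
From mathcomp Require Import all_classical all_reals all_analysis.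
From mathcomp Require Import ring lra zify.

Set Implicit Arguments.
Unset Strict Implicit.
Unset Printing Implicit Defensive.

Import Order.TTheory GRing.Theory Num.Theory numFieldNormedType.Exports.

Local Open Scope ring_scope.
Local Open Scope complex_scope.

(* Replace all parameters by square roots and theta by the odd function
   sigma x = x^-1 theta (x^2); the monomials then disappear from the identity,
   and all that is used of sigma is sigma (x^-1) = - sigma x together with the
   three-term (Plücker) relation for sigma (x y) sigma (x / y). That relation
   holds because, by Jacobi's triple product, theta (x y) theta (x / y) is up to
   a monomial of the form A(x) B(y) - B(x) A(y).

   The sum that can be evaluated in closed form (the multivariable Jackson sum)
   is proved by induction on |m|: for a fixed product b c, both sides are
   combinations of products of |m| factors sigma (x u) sigma (x / u) in a single
   variable u, so it suffices to compare them at |m| + 1 points, where the sum is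
   either trivial or reduces to a smaller one. Interpolation requires generic
   parameters; the other ones are reached by continuity.

   The transformation follows as for Bailey's: expand a part of the summand as a
   Jackson sum with base lambda, exchange the two summations, and evaluate the
   inner sum, again by Jackson. *)

(** * Boxes of multi-indices *)

(** Denominators are the main obstacle. The values of b used for the interpolation, and the limits
    in the parameters, can make them vanish, so the Jackson sum is stated with all of them
    multiplied out, except those in [Uf], which depend only on q and the z_k and are controlled by
    [nodes_sep]. They are restored in the Bailey step, under the hypotheses of the theorem, by
    dividing by a common factor. Square roots need care too: they can be chosen independently for
    all parameters but one. The last root is then defined by the balancing condition, which would
    otherwise hold only up to a sign. No theory of analytic functions is used. The zeros of theta
    are located by their moduli alone, which are powers of |p|; this is enough to find generic
    points on a ray. The functions A and B arise from a double series over pairs (m, k), split by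
    the parity of m + k. Square truncations of this series give the product of two thetas,
    diamond-shaped ones give A(x) B(y) - B(x) A(y), and the two have the same limit. *)

Section Boxes.
Variable I : finType.
Implicit Types m x y w : {ffun I -> nat}.

(** Boxes of all sizes share the type of natural-valued functions, so that indices from different
    boxes can be added and subtracted. *)
Definition box m : seq {ffun I -> nat} :=
  [seq [ffun k => y k : nat] | y : {dffun forall k, 'I_(m k).+1}].

Definition wt y : nat := (\sum_k y k)%N.
Definition mle x y := [forall k, x k <= y k]%N.
Definition madd x y : {ffun I -> nat} := [ffun k => x k + y k]%N.
Definition msub x y : {ffun I -> nat} := [ffun k => x k - y k]%N.

Lemma box_inj m : injective (fun y : {dffun forall k, 'I_(m k).+1} =>
  [ffun k => y k : nat]).
Proof.
move=> y y' /ffunP e; apply/ffunP => k; apply/val_inj.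
by have := e k; rewrite !ffunE.
Qed.

Lemma mem_box m y : (y \in box m) = mle y m.
Proof.
apply/fintype.imageP/forallP => [[u _ ->] k|h].
  by rewrite ffunE -ltnS ltn_ord.
exists [ffun k => inord (y k) : 'I_(m k).+1] => //.
by apply/ffunP => k; rewrite !ffunE inordK // ltnS.
Qed.

Lemma box_uniq m : uniq (box m).
Proof. by rewrite map_inj_uniq ?enum_uniq //; apply: box_inj. Qed.

Lemma mleP x y : reflect (forall k, x k <= y k)%N (mle x y).
Proof. exact: forallP. Qed.

Lemma wt_add x y : wt (madd x y) = (wt x + wt y)%N.
Proof. by rewrite /wt -big_split; apply: eq_bigr => k _; rewrite ffunE. Qed.

Lemma wt_eq0 y : (wt y == 0)%N = [forall k, y k == 0]%N.
Proof. by rewrite /wt sum_nat_eq0. Qed.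

Lemma wt_le x y : mle x y -> (wt x <= wt y)%N.
Proof. by move/mleP => h; apply: leq_sum. Qed.

Lemma maddK x y : mle x y -> madd x (msub y x) = y.
Proof.
by move=> /mleP h; apply/ffunP => k; rewrite !ffunE subnKC.
Qed.

Lemma wt_sub x y : mle x y -> wt (msub y x) = (wt y - wt x)%N.
Proof. by move=> h; rewrite -{2}(maddK h) wt_add addKn. Qed.

Variable K : nmodType.

Lemma box_shift m x (f : {ffun I -> nat} -> K) : mle x m ->
  (forall y, y \in box m -> ~~ mle x y -> f y = 0) ->
  \sum_(y <- box m) f y = \sum_(w <- box (msub m x)) f (madd x w).
Proof.
move=> xm f0; rewrite (bigID (mle x)) /=.
have -> : \sum_(y <- box m | ~~ mle x y) f y = 0.
  by rewrite big_seq_cond big1 // => y /andP[]; apply: f0.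
rewrite addr0 -(big_map (madd x) xpredT f) -big_filter; apply: perm_big.
apply: uniq_perm.
- by rewrite filter_uniq ?box_uniq.
- rewrite map_inj_uniq ?box_uniq // => u v /ffunP e; apply/ffunP => k.
  by have := e k; rewrite !ffunE => /addnI.
move=> y; rewrite mem_filter mem_box; apply/andP/mapP => [[xy ym]|[w]].
  exists (msub y x); last by rewrite maddK.
  rewrite mem_box; apply/mleP => k; rewrite !ffunE.
  by apply: leq_sub2r; move/mleP: ym.
rewrite mem_box => /mleP wm ->; split; apply/mleP => k; rewrite ?ffunE ?leq_addr //.
by have := wm k; move/mleP: xm => /(_ k); rewrite !ffunE; lia.
Qed.

Lemma box_sub m y (f : {ffun I -> nat} -> K) : mle y m ->
  \sum_(x <- box y) f x = \sum_(x <- box m | mle x y) f x.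
Proof.
move=> ym; rewrite -[RHS]big_filter; apply: perm_big; apply: uniq_perm.
- exact: box_uniq.
- by rewrite filter_uniq ?box_uniq.
move=> x; rewrite mem_filter !mem_box; case: (boolP (mle x y)) => //= /mleP xy.
by symmetry; apply/mleP => k; apply: leq_trans (xy k) _; move/mleP: ym.
Qed.

Lemma box_exchange m (f : {ffun I -> nat} -> {ffun I -> nat} -> K) :
  \sum_(y <- box m) \sum_(x <- box y) f x y =
  \sum_(x <- box m) \sum_(w <- box (msub m x)) f x (madd x w).
Proof.
transitivity (\sum_(y <- box m) \sum_(x <- box m) (if mle x y then f x y else 0)).
  rewrite big_seq [RHS]big_seq; apply: eq_bigr => y; rewrite mem_box => ym.
  by rewrite (box_sub _ ym) -big_mkcond.
rewrite exchange_big /= big_seq [RHS]big_seq; apply: eq_bigr => x.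
rewrite mem_box => xm; rewrite (box_shift xm) => [|y _ /negbTE-> //].
apply: eq_bigr => w _; case: ifP => // /negP[]; apply/mleP => k.
by rewrite ffunE leq_addr.
Qed.

End Boxes.

(** * The Jackson sum and the Bailey transformation for odd functions *)

Section OddFunction.
Variables (K : fieldType) (sg : K -> K).

Definition sg2 x y := sg (x * y) * sg (x / y).

Hypothesis sgV : forall x : K, sg x^-1 = - sg x.
Hypothesis sg_eq1 : sg 1 = 0.
Hypothesis sg2_plucker : forall x y u v : K, x != 0 -> y != 0 -> u != 0 -> v != 0 ->
  sg2 x y * sg2 u v - sg2 x u * sg2 y v + sg2 x v * sg2 y u = 0.
(** An algebraic substitute for the discreteness of the zeros of [sg]; it supplies the auxiliary
    point of the interpolation. *)
Hypothesis sg_generic : forall s : seq K, all (fun c : K => c != 0) s ->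
  exists2 u : K, u != 0 & all (fun c => sg (c * u) != 0) s.

Lemma sg2C x y : sg2 y x = - sg2 x y.
Proof. by rewrite /sg2 -(invf_div x y) sgV mulrN [y * x]mulrC. Qed.

(* Pick w generic. By the Plücker relation sg2 X u is, up to the factor sg2 u w,
   affine in sg2 v u / sg2 u w, so the sum becomes a polynomial of degree at
   most d in this ratio, which takes more than d values and vanishes at u = v. *)
Lemma sg2_interpolation (A : eqType) (s : seq A) (d : nat) (c : A -> K)
    (X : A -> seq K) (T : finType) (pt : T -> K) (v : K) :
  (forall i, i \in s -> size (X i) = d) ->
  (forall i x, i \in s -> x \in X i -> x != 0) ->
  (forall t, pt t != 0) -> v != 0 ->
  (d < #|T|)%N -> (forall t t', t != t' -> sg2 (pt t) (pt t') != 0) ->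
  (forall t, \sum_(i <- s) c i * \prod_(x <- X i) sg2 x (pt t) = 0) ->
  \sum_(i <- s) c i * \prod_(x <- X i) sg2 x v = 0.
Proof.
move=> sX X0 pt0 v0 dT ptn van.
have [w w0 /allP gw] : exists2 w : K, w != 0 & all (fun c => sg (c * w) != 0)
    (v :: v^-1 :: [seq pt t | t : T] ++ [seq (pt t)^-1 | t : T]).
  apply: sg_generic; apply/allP => x; rewrite !inE mem_cat.
  case/or4P => [/eqP->|/eqP->|/fintype.imageP[t _ ->]|/fintype.imageP[t _ ->]];
    by rewrite ?invr_eq0 ?v0 ?pt0.
have sg2w u : sg (u * w) != 0 -> sg (u^-1 * w) != 0 -> sg2 u w != 0.
  move=> h h'; rewrite /sg2 mulf_neq0 // -[u / w]invf_div sgV oppr_eq0.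
  by rewrite mulrC.
have vw : sg2 v w != 0 by apply: sg2w; apply: gw; rewrite !inE eqxx ?orbT.
have ptw t : sg2 (pt t) w != 0.
  apply: sg2w; apply: gw; rewrite !inE mem_cat.
    by rewrite fintype.image_f ?orbT.
  by rewrite (fintype.image_f (fun t => (pt t)^-1)) ?orbT.
pose tau u := sg2 v u / sg2 u w.
have expand x u : x != 0 -> u != 0 -> sg2 u w != 0 ->
    sg2 x u * sg2 v w = sg2 u w * (sg2 x v + sg2 x w * tau u).
  move=> x0 u0 uw.
  have := sg2_plucker x0 u0 v0 w0; rewrite (sg2C v u) => e.
  apply/eqP; rewrite -subr_eq0 -e /tau; apply/eqP; field; exact: uw.
pose P (l : seq K) := \prod_(x <- l) ((sg2 x v)%:P + sg2 x w *: 'X).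
have expandP l u : all (fun x => x != 0) l -> u != 0 -> sg2 u w != 0 ->
    (\prod_(x <- l) sg2 x u) * sg2 v w ^+ size l = sg2 u w ^+ size l * (P l).[tau u].
  move=> + u0 uw; rewrite /P; elim: l => [|x l IH] /=; first by rewrite !big_nil !hornerE.
  case/andP => x0 l0; rewrite !big_cons hornerM !exprS mulrACA expand // IH //.
  by rewrite hornerD hornerC hornerZ hornerX; ring.
pose p := \sum_(i <- s) c i *: P (X i).
have pE u : u != 0 -> sg2 u w != 0 ->
    (\sum_(i <- s) c i * \prod_(x <- X i) sg2 x u) * sg2 v w ^+ d =
    sg2 u w ^+ d * p.[tau u].
  move=> u0 uw; rewrite /p horner_sum big_distrl big_distrr /= big_seq [RHS]big_seq.
  apply: eq_bigr => i si; rewrite hornerZ mulrCA -mulrA; congr (_ * _).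
  by rewrite -(sX _ si) expandP //; apply/allP => x; apply: X0.
have sP l : (size (P l) <= (size l).+1)%N.
  rewrite /P; elim: l => [|x l IH]; first by rewrite big_nil size_poly1.
  rewrite big_cons; apply: leq_trans (size_polyMleq _ _) _.
  have : (size ((sg2 x v)%:P + sg2 x w *: 'X)%R <= 2)%N.
    apply: leq_trans (size_polyD _ _) _; rewrite geq_max.
    rewrite (leq_trans (size_polyC_leq1 _)) //.
    by rewrite (leq_trans (size_scale_leq _ _)) // size_polyX.
  by move: IH => /=; lia.
have sp : (size p <= d.+1)%N.
  rewrite /p big_seq; apply: (big_ind (fun f : {poly K} => (size f <= d.+1)%N)).
  - by rewrite size_poly0.
  - by move=> f g hf hg; apply: leq_trans (size_polyD _ _) _; rewrite geq_max hf.
  move=> i si; apply: leq_trans (size_scale_leq _ _) _.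
  by rewrite -(sX _ si).
have p0 : p = 0.
  apply: (@roots_geq_poly_eq0 _ p [seq tau (pt t) | t : T]).
  - apply/allP => x /fintype.imageP[t _ ->]; apply/rootP.
    have := pE _ (pt0 t) (ptw t); rewrite van mul0r => /esym/eqP.
    by rewrite mulf_eq0 expf_eq0 (negbTE (ptw t)) andbF => /eqP.
  (* If two of the ratios agree, the Plücker relation for v, [pt t], [pt t'], w reduces to sg2 v w *
     sg2 (pt t) (pt t') = 0. *)
  - rewrite map_inj_uniq ?enum_uniq // => t t' /eqP.
    rewrite /tau eqr_div ?ptw // -subr_eq0 => /eqP e.
    apply/eqP; apply: contraT => /ptn; apply: contraNT => _.
    have := sg2_plucker v0 (pt0 t) (pt0 t') w0; rewrite e add0r => /eqP.
    by rewrite mulf_eq0 (negbTE vw).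
  - by rewrite size_map -cardE (leq_trans sp).
have := pE _ v0 vw; rewrite p0 horner0 mulr0 => /eqP.
by rewrite mulf_eq0 expf_eq0 (negbTE vw) andbF orbF => /eqP.
Qed.

Variable q : K.
Hypothesis q0 : q != 0.

Definition poch x k := \prod_(i < k) sg (x * q ^+ i).

Lemma poch0 x : poch x 0 = 1.
Proof. by rewrite /poch big_ord0. Qed.

Lemma poch1 x : poch x 1 = sg x.
Proof. by rewrite /poch big_ord1 mulr1. Qed.

Lemma pochD x i j : poch x (i + j) = poch x i * poch (x * q ^+ i) j.
Proof.
rewrite /poch big_split_ord /=; congr (_ * _); apply: eq_bigr => k _.
by rewrite exprD mulrA.
Qed.

Lemma poch_neq0P x k : reflect (forall i, (i < k)%N -> sg (x * q ^+ i) != 0)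
  (poch x k != 0).
Proof.
apply: (iffP idP) => [/prodf_neq0 h i ik|h]; first exact: (h (Ordinal ik)).
by apply/prodf_neq0 => i _; apply: h.
Qed.

Lemma poch_eq0 x k i : (i < k)%N -> x * q ^+ i = 1 -> poch x k = 0.
Proof.
by move=> ik e; rewrite /poch (bigD1 (Ordinal ik)) //= e sg_eq1 mul0r.
Qed.

(** The factor of index k - 1 - i on the left and that of index i on the right have inverse
    arguments, so oddness gives one sign per factor. *)
Lemma poch_rev x y k : x * y * q ^+ k = q -> poch x k = (-1) ^+ k * poch y k.
Proof.
move=> e; rewrite /poch.
have -> : (-1) ^+ k = \prod_(i < k) (-1 : K) by rewrite prodr_const card_ord.
rewrite -big_split [LHS](reindex_inj rev_ord_inj) /=.
apply: eq_bigr => i _; rewrite mulN1r -sgV; congr sg.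
have xy : x * y != 0 by apply/eqP => xy; move: q0; rewrite -e xy mul0r eqxx.
have [x0 y0] : x != 0 /\ y != 0 by move: xy; rewrite mulf_eq0 negb_or => /andP[].
apply: (mulIf (x := y * q ^+ i)); first by rewrite mulf_neq0 ?expf_neq0.
rewrite mulVf ?mulf_neq0 ?expf_neq0 //.
apply: (mulIf q0); rewrite mul1r -[RHS]e.
have -> : q ^+ k = q ^+ (k - i.+1) * q ^+ i * q.
  by rewrite -exprD -exprSr; congr (_ ^+ _); have := ltn_ord i; lia.
ring.
Qed.

(** * The multivariable Jackson sum *)

Variable I : finType.
Implicit Types (m x y w : {ffun I -> nat}) (z : I -> K).

Definition zsh z x : I -> K := fun k => z k * q ^+ x k.

(* The points z_k q^i with i <= m_k are pairwise inequivalent. *)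
Definition nodes_sep m z := forall (j k : I) (i l : nat),
  (i <= m k)%N -> (l <= m j)%N -> (k, i) != (j, l) ->
  sg (z k * q ^+ i / (z j * q ^+ l)) != 0.

(** A multivariable binomial coefficient: for a single variable it is the elliptic binomial of m
    over y. Up to the sign (-1)^|y| it also contains the Vandermonde quotient of the summand, by
    [vandermonde_poch]. *)
Definition Uf m z y := \prod_j \prod_k
  (poch (z k / (z j * q ^+ m j)) (y k) / poch (z k / (z j * q ^+ y j)) (y k)).

(** The factors compare the nodes (k, i), i < n, with (j, N); for j = k the condition n <= N keeps
    them distinct. *)
Lemma nodes_sep_poch m z j k N n : nodes_sep m z -> (N <= m j)%N ->
  (n <= m k)%N -> (j = k -> n <= N)%N -> poch (z k / (z j * q ^+ N)) n != 0.
Proof.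
move=> sep Nm nm jk; apply/poch_neq0P => i i_n.
rewrite mulrAC; apply: sep => //; first by rewrite (leq_trans (ltnW i_n)).
apply/negP => /eqP[kj iN]; have := jk (esym kj); lia.
Qed.

(** The analogue of binom(m, y) binom(y, x) = binom(m, x) binom(m - x, y - x) with y = x + w. After
    splitting all products at x_k, the first x_k factors in the denominator of the first [Uf] cancel
    the numerator of the second. *)
Lemma Uf_split m z x w : nodes_sep m z -> (forall k, z k != 0) ->
  mle (madd x w) m ->
  Uf m z (madd x w) * Uf (madd x w) z x =
  Uf m z x * Uf (msub m x) (zsh z x) w.
Proof.
move=> sep z0 /mleP le; rewrite /Uf -!big_split /=; apply: eq_bigr => j _.
rewrite -!big_split /=; apply: eq_bigr => k _; rewrite !ffunE /zsh.
have lj := le j; have lk := le k; rewrite !ffunE in lj lk.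
have nz : poch (z k / (z j * q ^+ (x j + w j))) (x k) != 0.
  by apply: (nodes_sep_poch sep) => //; [lia|move=> jk; subst k; lia].
rewrite !pochD.
have -> : z j * q ^+ x j * q ^+ (m j - x j) = z j * q ^+ m j.
  by rewrite -mulrA -exprD subnKC //; lia.
have qj := expf_neq0 (m j) q0; have qk := expf_neq0 (x j) q0.
have qw := expf_neq0 (w j) q0; have zj := z0 j.
have -> : z k * q ^+ x k / (z j * q ^+ x j * q ^+ w j) =
  z k / (z j * q ^+ (x j + w j)) * q ^+ x k.
  by rewrite exprD; field; rewrite qk qw zj.
have -> : z k * q ^+ x k / (z j * q ^+ m j) = z k / (z j * q ^+ m j) * q ^+ x k.
  by rewrite mulrAC.
set A := poch _ (x k); set B := poch _ (w k).
set C := poch _ (x k) in nz *; set D := poch _ (w k); set E := poch _ (x k).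
rewrite !invfM; transitivity (A * B / D / E * (C / C)); first by ring.
by rewrite divff //; ring.
Qed.

(** The summand with every denominator outside [Uf] cleared: a denominator (x)_s becomes the
    complementary product completing it to full length. The parameter e is eliminated by the
    balancing condition. The factor [poch h (M - s)] stands for 1 / (a q / e)_s, read backwards; the
    sign of this reversal cancels the (-1)^s that accompanies [Uf]. *)
Definition jterm a b c d m z y :=
  let M := wt m in let s := wt y in
  let h := a * q / (b * c * d) in let e := a * h * q ^+ M in
  Uf m z y *
  (\prod_k (sg (a * z k * q ^+ (y k + s)) * poch (a * z k) s *
            poch (a * z k * q ^+ (1 + m k + s)) (M - s))) *
  (poch b s * poch c s * poch h (M - s) * poch (a * q ^+ (1 + s) / d) (M - s)) *
  (\prod_k poch (d * z k) (y k) * \prod_k poch (e * z k) (y k)) *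
  \prod_k poch (a * q ^+ (1 + y k) * z k / b) (m k - y k) *
  \prod_k poch (a * q ^+ (1 + y k) * z k / c) (m k - y k).

Definition jsum a b c d m z :=
  let M := wt m in
  poch (a * q / (b * d)) M * poch (a * q / (c * d)) M *
  \prod_k poch (a * z k) (1 + m k + M) *
  \prod_k poch (a * q * z k / (b * c)) (m k).

Definition jackson_at a b c d m z :=
  \sum_(y <- box m) jterm a b c d m z y = jsum a b c d m z.

Lemma Uf0 m z y : (forall k, y k = 0%N) -> Uf m z y = 1.
Proof.
move=> y0; rewrite /Uf big1 // => j _; rewrite big1 // => k _.
by rewrite y0 !poch0 divr1.
Qed.

(** Only y = 0 contributes: for |y| > 0 the product [poch 1 s] contains sg 1 = 0. *)
Lemma jackson_b1 a c d m z : a != 0 -> c != 0 -> d != 0 ->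
  (forall k, z k != 0) -> jackson_at a 1 c d m z.
Proof.
move=> a0 c0 d0 z0; rewrite /jackson_at.
pose o : {ffun I -> nat} := [ffun=> 0%N].
have o_in : o \in box m by rewrite mem_box; apply/mleP => k; rewrite ffunE.
rewrite (bigD1_seq o) ?box_uniq //= big1 ?addr0 => [|y ny]; last first.
  have : (0 < wt y)%N.
    apply: contraNltn ny; rewrite leqn0 wt_eq0 => /forallP y0.
    by apply/eqP/ffunP => k; rewrite ffunE; apply/eqP/y0.
  by move=> s0; rewrite /jterm /= (@poch_eq0 1 _ 0) ?expr0 ?mulr1 // !mul0r mulr0 !mul0r.
rewrite /jterm /jsum Uf0 => [|k]; last by rewrite ffunE.
have -> : wt o = 0%N by apply/eqP; rewrite wt_eq0; apply/forallP => k; rewrite ffunE.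
rewrite mul1r !poch0 !mul1r !subn0 addn0 expr1.
have o1 D : \prod_k poch (D * z k) (o k) = 1.
  by rewrite big1 // => k _; rewrite ffunE poch0.
rewrite !o1 !mulr1; set H := poch (_ / (c * d)) _; set D := poch (_ / d) _.
set P := \prod_k _; set B := \prod_k _; set G := \prod_k _.
set P' := \prod_k _; set B' := \prod_k _.
suff e : P * B * G = P' * B'.
  by transitivity (D * H * (P * B * G)); [ring|rewrite e; ring].
rewrite /P /B /G /P' /B' -!big_split /=; apply: eq_bigr => k _.
rewrite !ffunE ?poch0 ?subn0 ?addn0 expr0 expr1 !mulr1 divr1.
by rewrite pochD (pochD _ 1) poch1 expr1 !(mulrAC a q); ring.
Qed.

(* At b = a z_{k0} q^r the terms with y_{k0} < r vanish, and the others are,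
   up to a constant, those of a smaller sum. *)
Lemma jackson_reduce (k0 : I) r a c d m z (x := [ffun k => (k == k0) * r]%N) :
  a != 0 -> c != 0 -> d != 0 -> (forall k, z k != 0) -> nodes_sep m z ->
  (r <= m k0)%N ->
  jackson_at (a * q ^+ r) (a * z k0 * q ^+ r) (c * q ^+ r) d (msub m x) (zsh z x) ->
  jackson_at a (a * z k0 * q ^+ r) c d m z.
Proof.
move=> a0 c0 d0 z0 sep rm; set b := a * z k0 * q ^+ r.
have b0 : b != 0 by rewrite !mulf_neq0 ?expf_neq0.
have qn n : q ^+ n != 0 by exact: expf_neq0.
have xm : mle x m.
  by apply/mleP => k; rewrite ffunE; case: eqP => [->|_]; rewrite ?mul1n.
have xk : x k0 = r by rewrite ffunE eqxx mul1n.
have prodx (f : I -> K) : \prod_k poch (f k) (x k) = poch (f k0) r.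
  rewrite (bigD1 k0) //= xk big1 ?mulr1 // => k /negbTE nk.
  by rewrite ffunE nk mul0n poch0.
have wx : wt x = r.
  rewrite /wt (bigD1 k0) //= xk big1 ?addn0 // => k /negbTE nk.
  by rewrite ffunE nk.
set M := wt m; have wmx : wt (msub m x) = (M - r)%N by rewrite wt_sub // wx.
have rM : (r <= M)%N by rewrite -wx wt_le.
pose h := a * q / (b * c * d); pose e := a * h * q ^+ M.
have h' : a * q ^+ r * q / (b * (c * q ^+ r) * d) = h.
  by rewrite /h; field; rewrite b0 c0 d0 qn.
have e' : a * q ^+ r * h * q ^+ (M - r) = e.
  by rewrite /e -{2}(subnKC rM) exprD; ring.
pose C := \prod_k poch (a * z k) r * poch b r * poch c r *
  (poch (d * z k0) r * poch (e * z k0) r).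
suff [termE sumE] : (forall w, w \in box (msub m x) ->
    jterm a b c d m z (madd x w) =
    C * jterm (a * q ^+ r) b (c * q ^+ r) d (msub m x) (zsh z x) w) /\
    jsum a b c d m z =
    C * jsum (a * q ^+ r) b (c * q ^+ r) d (msub m x) (zsh z x).
  rewrite /jackson_at => IH; rewrite (box_shift xm); last first.
    move=> y ym; rewrite negb_forall => /existsP[k]; rewrite -ltnNge ffunE => yk.
    have {yk} : (y k0 < r)%N.
      by move: yk; case: eqP => [->|_]; rewrite ?mul1n ?mul0n ?ltn0.
    move=> yr; rewrite /jterm /= [X in _ * X * _](bigD1 k0) //=.
    (* As b = a z_{k0} q^r, the factor of index r - 1 - y_{k0} has argument 1; it is present because
       r <= m_{k0}. *)
    rewrite (@poch_eq0 (a * q ^+ (1 + y k0) * z k0 / b) _ (r - (1 + y k0))); last 2 first.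
    - by move: rm yr; clear; lia.
    - have -> : q ^+ (1 + y k0) = q ^+ r / q ^+ (r - (1 + y k0)).
        apply: (canRL (mulfK (qn _))); rewrite -exprD subnKC //.
      by rewrite /b; field; rewrite !qn a0 z0.
    by rewrite mul0r mulr0 mul0r.
  rewrite sumE -IH big_distrr /= big_seq [RHS]big_seq; exact: eq_bigr.
split => [w|].
  rewrite mem_box => /mleP wm.
  have wm' k : (x k + w k <= m k)%N.
    by move: (wm k) (mleP _ _ xm k); rewrite !ffunE; clear; lia.
  set y := madd x w; set s := wt w; set m' := msub m x; set z' := zsh z x.
  have ym : mle y m by apply/mleP => k; rewrite ffunE.
  have wy : wt y = (r + s)%N by rewrite wt_add wx.
  have yE k : y k = (x k + w k)%N by rewrite ffunE.
  have mE k : m' k = (m k - x k)%N by rewrite ffunE.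
  have PA : (\prod_k (sg (a * z k * q ^+ (y k + (r + s))) * poch (a * z k) (r + s) *
        poch (a * z k * q ^+ (1 + m k + (r + s))) (M - r - s))) * poch b (r + s) =
      (\prod_k poch (a * z k) r * poch b r) *
      ((\prod_k (sg (a * q ^+ r * z' k * q ^+ (w k + s)) * poch (a * q ^+ r * z' k) s *
        poch (a * q ^+ r * z' k * q ^+ (1 + m' k + s)) (M - r - s))) * poch b s).
    rewrite !big_split /=.
    under [\prod_k sg (a * z k * _)]eq_bigr => k _.
      have -> : a * z k * q ^+ (y k + (r + s)) = a * q ^+ r * z' k * q ^+ (w k + s).
        by rewrite /z' /zsh yE !exprD; ring.
      over.
    under [\prod_k poch (a * z k * _) _]eq_bigr => k _.
      have -> : a * z k * q ^+ (1 + m k + (r + s)) = a * q ^+ r * z' k * q ^+ (1 + m' k + s).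
        by rewrite mE /z' /zsh -{1}(subnKC (mleP _ _ xm k)) !exprD; ring.
      over.
    under [\prod_k poch (a * z k) (r + s)]eq_bigr => k _ do rewrite pochD.
    rewrite big_split /= [in LHS](addnC r s) (pochD b s r).
    (* Only k = k0 matters: there a z_k q^r is b, and both sides contribute [poch b (r + s)]. *)
    have swap : \prod_k poch (a * z k * q ^+ r) s * poch (b * q ^+ s) r =
        poch b r * \prod_k poch (a * q ^+ r * z' k) s.
      rewrite -(prodx (fun k => a * z k * q ^+ r)) /b.
      rewrite -(prodx (fun k => a * z k * q ^+ r * q ^+ s)) -!big_split /=.
      apply: eq_bigr => k _; rewrite -pochD addnC pochD; congr (_ * poch _ _).
      by rewrite /z' /zsh; ring.
    set A1 := \prod_k sg _; set A2 := \prod_k poch _ r; set A3 := \prod_k poch _ s in swap *.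
    set A4 := \prod_k poch _ (M - r - s); set A5 := \prod_k poch _ s in swap *.
    transitivity (A1 * A2 * A4 * poch b s * (A3 * poch (b * q ^+ s) r)); first by ring.
    by rewrite swap; ring.
  (* [Uf_split] leaves the quotient Uf m z x / Uf y z x. After reversal its j-th factor is exactly
     what the j-th product with denominator b gains or loses under the shift by r. *)
  have PB : Uf m z y * \prod_k poch (a * q ^+ (1 + y k) * z k / b) (m k - y k) =
      Uf m' z' w * \prod_k poch (a * q ^+ r * q ^+ (1 + w k) * z' k / b) (m' k - w k).
    have us := Uf_split sep z0 ym; rewrite -/y -/m' -/z' in us.
    have ux m1 : Uf m1 z x = \prod_j (poch (z k0 / (z j * q ^+ m1 j)) r /
        poch (z k0 / (z j * q ^+ x j)) r).
      rewrite /Uf; apply: eq_bigr => j _; rewrite (bigD1 k0) //= xk big1 ?mulr1 // => k.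
      by move/negbTE => nk; rewrite ffunE nk mul0n !poch0 divr1.
    have uy0 : Uf y z x != 0.
      rewrite ux; apply/prodf_neq0 => j _; rewrite mulf_neq0 ?invr_eq0 //.
        apply: (nodes_sep_poch sep); rewrite ?yE //.
        by move=> ->; rewrite xk leq_addr.
      apply: (nodes_sep_poch sep); rewrite ?(mleP _ _ xm) // => ->.
      by rewrite xk.
    apply: (mulIf uy0); rewrite mulrAC us (mulrC (Uf m z x)) -!mulrA; congr (_ * _).
    rewrite !ux -!big_split /=; apply: eq_bigr => j _.
    have rev N : poch (z k0 / (z j * q ^+ N)) r =
        (-1) ^+ r * poch (z j * q ^+ (1 + N) / (z k0 * q ^+ r)) r.
      by apply: poch_rev; rewrite exprD expr1; field; rewrite !qn !z0.
    rewrite !rev; pose X := z j * q ^+ (1 + y j) / (z k0 * q ^+ r).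
    rewrite -/X; set D := poch (z j * q ^+ (1 + x j) / _) r.
    have -> : a * q ^+ (1 + y j) * z j / b = X.
      by rewrite /X /b; field; rewrite a0 !z0 qn.
    have -> : a * q ^+ r * q ^+ (1 + w j) * z' j / b = X * q ^+ r.
      by rewrite /X /b /z' /zsh yE !exprD; field; rewrite a0 !z0 qn.
    have -> : z j * q ^+ (1 + m j) / (z k0 * q ^+ r) = X * q ^+ (m j - y j).
      by rewrite /X -{1}(subnKC (mleP _ _ ym j)) addnA (exprD q (1 + y j)); ring.
    have -> : (m' j - w j = m j - y j)%N by rewrite mE yE subnDA.
    set n := (m j - y j)%N; set E := (-1) ^+ r.
    transitivity (E / (E * D) * (poch X n * poch (X * q ^+ n) r)); first by ring.
    by rewrite -pochD addnC pochD; ring.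
  have PD D : \prod_k poch (D * z k) (y k) =
      poch (D * z k0) r * \prod_k poch (D * z' k) (w k).
    rewrite -(prodx (fun k => D * z k)) -big_split /=; apply: eq_bigr => k _.
    by rewrite yE pochD mulrA.
  have PC : \prod_k poch (a * q ^+ (1 + y k) * z k / c) (m k - y k) =
      \prod_k poch (a * q ^+ r * q ^+ (1 + w k) * z' k / (c * q ^+ r)) (m' k - w k).
    apply: eq_bigr => k _; rewrite yE mE subnDA; congr poch.
    by rewrite /z' /zsh !exprD; field; rewrite c0 qn.
  rewrite /jterm wy wmx -/M h' -/h -/e e' -/s /C !PD PC (pochD c) !subnDA.
  have -> : a * q ^+ (1 + (r + s)) / d = a * q ^+ r * q ^+ (1 + s) / d.
    by rewrite !exprD; ring.
  set Pa := \prod_k (_ * _ * _) in PA *; set Pa' := \prod_k (_ * _ * _) in PA *.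
  set Pb := \prod_k poch (_ / b) _ in PB *; set Pb' := \prod_k poch (_ / b) _ in PB *.
  move: PA PB; set u := Uf m z y; set u' := Uf m' z' w => PA PB.
  set t := poch (a * q ^+ r * _ / d) _; set t1 := poch h _.
  set P1 := \prod_k _; set P2 := \prod_k _; set P3 := \prod_k _.
  transitivity ((Pa * poch b (r + s)) * (u * Pb) *
    (poch c r * poch (c * q ^+ r) s * t1 * t * poch (d * z k0) r * P1 *
     poch (e * z k0) r * P2 * P3)); first by ring.
  by rewrite PA PB; ring.
rewrite /jsum wmx -/M.
have SA : \prod_k poch (a * z k) (1 + m k + M) = (\prod_k poch (a * z k) r * poch b r) *
    \prod_k poch (a * q ^+ r * zsh z x k) (1 + msub m x k + (M - r)).
  rewrite /b -(prodx (fun k => a * z k * q ^+ r)) -!big_split /=.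
  apply: eq_bigr => k _; have xmk := mleP _ _ xm k.
  have -> : (1 + m k + M = r + x k + (1 + msub m x k + (M - r)))%N.
    by rewrite [msub m x k]ffunE; move: xmk rM; clear; lia.
  set N := (1 + _ + _)%N; rewrite 2!pochD; congr (_ * poch _ _).
  by rewrite /zsh exprD; ring.
have SB : \prod_k poch (a * q * z k / (b * c)) (m k) = (-1) ^+ r * poch c r *
    \prod_k poch (a * q ^+ r * q * zsh z x k / (b * (c * q ^+ r))) (msub m x k).
  rewrite -(@poch_rev (a * q * z k0 / (b * c)) c r); last first.
    by rewrite /b; field; rewrite a0 c0 qn z0.
  rewrite -(prodx (fun k => a * q * z k / (b * c))) -!big_split /=.
  apply: eq_bigr => k _; rewrite -{1}(subnKC (mleP _ _ xm k)) pochD [msub m x k]ffunE.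
  by congr (_ * poch _ _); rewrite /zsh; field; rewrite b0 c0 qn.
have SC : poch (a * q / (b * d)) M = (-1) ^+ r * poch (d * z k0) r *
    poch (a * q ^+ r * q / (b * d)) (M - r).
  rewrite -(@poch_rev (a * q / (b * d)) (d * z k0) r); last first.
    by rewrite /b; field; rewrite a0 d0 qn z0.
  by rewrite -{1}(subnKC rM) pochD; congr (_ * poch _ _); ring.
have SD : poch (a * q / (c * d)) M = poch (e * z k0) r *
    poch (a * q ^+ r * q / (c * q ^+ r * d)) (M - r).
  rewrite -{1}(subnK rM) pochD mulrC; congr (poch _ _ * poch _ _).
    rewrite /e /h /b -{2}(subnK rM) exprD; field.
    by rewrite a0 c0 d0 qn z0.
  by field; rewrite c0 d0 qn.
(* The two reversals, in SB and SC, each contribute (-1)^r. *)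
have s2 : (-1) ^+ r * (-1) ^+ r = 1 :> K by rewrite -exprMn mulrNN mulr1 expr1n.
rewrite SA SB SC SD /C.
set P1 := \prod_k _; set P2 := \prod_k _; set P3 := \prod_k _.
move: s2; set E := (-1) ^+ r => s2; rewrite -[RHS]mul1r -s2; ring.
Qed.
Lemma nodes_sep_shift m z x : mle x m -> nodes_sep m z ->
  nodes_sep (msub m x) (zsh z x).
Proof.
move=> /mleP xm sep j k i l; rewrite !ffunE => im lm neq.
rewrite /zsh -(mulrA (z k)) -(mulrA (z j)) -!exprD; apply: sep.
- by move: im (xm k); lia.
- by move: lm (xm j); lia.
apply: contraNneq neq => -[kj]; subst j => /addnI ->; exact: eqxx.
Qed.

Lemma poch_pair (x u : K) n : u != 0 ->
  poch (x * u) n * poch (x / u) n =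
  \prod_(t <- [seq x * q ^+ i | i <- iota 0 n]) sg2 t u.
Proof.
move=> u0; rewrite big_map /poch -big_split /=.
have -> : iota 0 n = index_iota 0 n by rewrite /index_iota subn0.
rewrite big_mkord; apply: eq_bigr => i _; rewrite /sg2.
by congr (sg _ * sg _); ring.
Qed.

(** With b = kap u and c = kap / u, the factors of [jterm] that contain b or c separately combine
    into sg2 x u, x running through this list; h and e contain only b c = kap^2. *)
Definition pairs a kap m z y : seq K :=
  [seq kap * q ^+ i | i <- iota 0 (wt y)] ++
  flatten [seq [seq a * q ^+ (1 + y k) * z k / kap * q ^+ i | i <- iota 0 (m k - y k)]
    | k <- enum I].

Lemma size_pairs a kap m z y : mle y m -> size (pairs a kap m z y) = wt m.
Proof.
move=> ym; rewrite size_cat size_map size_iota size_flatten /shape -map_comp.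
rewrite (eq_map (g := msub m y)) => [|k]; last by rewrite /= size_map size_iota ffunE.
rewrite sumnE big_map big_enum /= -/(wt (msub m y)) wt_sub // subnKC //.
exact: wt_le.
Qed.

Lemma pairs_neq0 a kap m z y : a != 0 -> kap != 0 -> (forall k, z k != 0) ->
  forall x : K, x \in pairs a kap m z y -> x != 0.
Proof.
move=> a0 k0 z0 x; rewrite mem_cat => /orP[/mapP[i _ ->]|].
  by rewrite mulf_neq0 ?expf_neq0.
case/flattenP => l /mapP[k _ ->] /mapP[i _ ->].
by rewrite !mulf_neq0 ?invr_eq0 ?expf_neq0.
Qed.

(** Brings the difference of the two sides into the form of [sg2_interpolation]; the extra index
    [None] carries the closed form. *)
Lemma jackson_sub_pairs a kap d m z u : a != 0 -> kap != 0 -> d != 0 -> u != 0 ->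
  \sum_(y <- box m) jterm a (kap * u) (kap / u) d m z y -
    jsum a (kap * u) (kap / u) d m z =
  \sum_(i <- None :: map some (box m))
    (if i is Some y then
       let M := wt m in let s := wt y in
       let h := a * q / (kap ^+ 2 * d) in let e := a * h * q ^+ M in
       Uf m z y *
       (\prod_k (sg (a * z k * q ^+ (y k + s)) * poch (a * z k) s *
                 poch (a * z k * q ^+ (1 + m k + s)) (M - s))) *
       (poch h (M - s) * poch (a * q ^+ (1 + s) / d) (M - s)) *
       (\prod_k poch (d * z k) (y k) * \prod_k poch (e * z k) (y k))
     else - (\prod_k poch (a * z k) (1 + m k + wt m) *
             \prod_k poch (a * q * z k / kap ^+ 2) (m k))) *
    \prod_(x <- if i is Some y then pairs a kap m z y else
                [seq a * q / (kap * d) * q ^+ i | i <- iota 0 (wt m)]) sg2 x u.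
Proof.
move=> a0 k0 d0 u0; have bc : kap * u * (kap / u) = kap ^+ 2 by field.
rewrite big_cons addrC big_map /=; congr (_ + _).
  rewrite mulNr; congr (- _); rewrite /jsum bc -poch_pair //.
  have -> : a * q / (kap * u * d) = a * q / (kap * d) / u.
    by field; rewrite k0 u0 d0.
  have -> : a * q / (kap / u * d) = a * q / (kap * d) * u.
    by field; rewrite k0 u0 d0.
  by ring.
apply: eq_bigr => y _; rewrite /jterm bc /pairs big_cat /= -poch_pair //.
rewrite big_flatten big_map big_enum /=.
under [X in _ = _ * (_ * X)]eq_bigr => k _ do rewrite -poch_pair //.
rewrite [X in _ = _ * (_ * X)]big_split /=.
have -> : \prod_k poch (a * q ^+ (1 + y k) * z k / (kap * u)) (m k - y k) =
    \prod_k poch (a * q ^+ (1 + y k) * z k / kap / u) (m k - y k).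
  by apply: eq_bigr => k _; congr poch; field; rewrite k0 u0.
have -> : \prod_k poch (a * q ^+ (1 + y k) * z k / (kap / u)) (m k - y k) =
    \prod_k poch (a * q ^+ (1 + y k) * z k / kap * u) (m k - y k).
  by apply: eq_bigr => k _; congr poch; field; rewrite k0 u0.
set A := \prod_k poch (_ * u) _; set B := \prod_k poch (_ / u) _.
set C := \prod_k (_ * _ * _); set D := _ * \prod_k poch _ (y k).
set U := Uf m z y; ring.
Qed.

(* The product b c = kap^2 is kept fixed: both sides are then combinations of products
   of |m| factors sg2 x u in u = b / kap, and they agree at the |m| + 1 points
   b = 1 and b = a z_k q^r, 0 < r <= m_k. *)
Lemma jackson_generic a kap d u m z :
  a != 0 -> kap != 0 -> d != 0 -> u != 0 -> (forall k, z k != 0) ->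
  nodes_sep m z ->
  (forall k j i l, (i < m k)%N -> (l < m j)%N ->
    sg (a * z k * q ^+ i.+1 * (a * z j * q ^+ l.+1) / kap ^+ 2) != 0) ->
  (forall k i, (i < m k)%N -> sg (a * z k * q ^+ i.+1) != 0) ->
  (forall k i, (i < m k)%N -> sg (a * z k * q ^+ i.+1 / kap ^+ 2) != 0) ->
  (forall a b c d m' z', a != 0 -> b != 0 -> c != 0 -> d != 0 ->
    (forall k, z' k != 0) -> nodes_sep m' z' -> (wt m' < wt m)%N ->
    jackson_at a b c d m' z') ->
  jackson_at a (kap * u) (kap / u) d m z.
Proof.
move=> a0 k0 d0 u0 z0 sep g1 g2 g3 IH.
pose T := option {k : I & 'I_(m k)}.
pose bpt (t : T) : K := if t is Some v then a * z (tag v) * q ^+ (tagged v).+1 else 1.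
have b0 t : bpt t != 0.
  by case: t => [v|]; rewrite /bpt ?oner_eq0 // !mulf_neq0 ?expf_neq0.
have at_pt t : jackson_at a (bpt t) (kap ^+ 2 / bpt t) d m z.
  have c0 : kap ^+ 2 / bpt t != 0 by rewrite mulf_neq0 ?invr_eq0 ?expf_neq0.
  case: t c0 => [[k i]|] c0; last exact: jackson_b1.
  apply: (jackson_reduce (k0 := k) (r := i.+1)) => //.
  pose x : {ffun I -> nat} := [ffun k' => (k' == k) * i.+1]%N.
  have xm : mle x m.
    by apply/mleP => k'; rewrite ffunE; case: eqP => [->|_]; rewrite ?mul1n ?ltn_ord.
  apply: IH; rewrite ?(mulf_neq0, invr_eq0, expf_neq0, b0) //.
  - by move=> k'; rewrite mulf_neq0 ?expf_neq0.
  - exact: nodes_sep_shift.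
  rewrite (wt_sub xm).
  have : (0 < wt x)%N.
    rewrite lt0n wt_eq0; apply/forallPn; exists k.
    by rewrite ffunE eqxx mul1n.
  by have := wt_le xm; clear; lia.
(* For two values b, b' this is sg (b b' / kap^2) * sg (b / b'). The first factor needs g1 or g3;
   the second follows from the separation of the nodes, or from g2 if one of the values is 1. *)
have sep' t t' : t != t' -> sg2 (bpt t / kap) (bpt t' / kap) != 0.
  have kk (x y : K) : x / kap * (y / kap) = x * y / kap ^+ 2 by field.
  have kq (x y : K) : y != 0 -> x / kap / (y / kap) = x / y.
    by move=> y0; field; rewrite k0 y0.
  have V (x y : K) : sg (x / y) != 0 -> sg (y / x) != 0.
    by rewrite -[x / y]invf_div sgV oppr_eq0.
  move=> tt; rewrite /sg2 kk kq ?b0 //; case: t t' tt => [[k i]|] [[k' i']|] //= tt.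
  - rewrite mulf_neq0 ?g1 ?ltn_ord //.
    have -> : a * z k * q ^+ i.+1 / (a * z k' * q ^+ i'.+1) =
      z k * q ^+ i.+1 / (z k' * q ^+ i'.+1).
      by field; rewrite a0 z0 !expf_neq0.
    apply: sep; rewrite ?ltn_ord //; apply: contraNneq tt => -[e]; subst k' => ii.
    by apply/eqP; congr (Some (existT _ _ _)); apply: val_inj.
  - by rewrite mulr1 divr1 mulf_neq0 ?g2 ?g3 ?ltn_ord.
  - rewrite mul1r mulf_neq0 ?g3 ?ltn_ord //.
    by apply: V; rewrite divr1 g2 ?ltn_ord.
apply/eqP; rewrite -subr_eq0 jackson_sub_pairs //; apply/eqP.
apply: (@sg2_interpolation _ _ (wt m) _ _ T (fun t => bpt t / kap)) => //.
- move=> i; rewrite inE => /orP[/eqP-> | /mapP[y ym ->]].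
    by rewrite size_map size_iota.
  by apply: size_pairs; rewrite -mem_box.
- move=> i x; rewrite inE => /orP[/eqP-> /mapP[j _ ->]| /mapP[y ym ->]].
    by rewrite !mulf_neq0 ?invr_eq0 ?mulf_neq0 ?expf_neq0.
  exact: pairs_neq0.
- by move=> t; rewrite mulf_neq0 ?invr_eq0.
- rewrite card_option card_tagged sumnE big_map big_enum /= ltnS /wt.
  by apply: eq_leq; apply: eq_bigr => k _; rewrite card_ord.
move=> t; rewrite -jackson_sub_pairs ?mulf_neq0 ?invr_eq0 //.
have -> : kap * (bpt t / kap) = bpt t by field.
have -> : kap / (bpt t / kap) = kap ^+ 2 / bpt t by field; rewrite k0 b0.
by rewrite at_pt subrr.
Qed.

(** * The Bailey transformation, given the Jackson sum *)

Lemma poch_sub (x : K) k n : (k <= n)%N -> poch x n != 0 ->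
  poch (x * q ^+ k) (n - k) = poch x n / poch x k.
Proof.
move=> kn; rewrite -{1 3}(subnKC kn) pochD mulf_eq0 negb_or => /andP[h _].
by rewrite mulrAC mulfV // mul1r.
Qed.

Lemma poch_le (x : K) k n : (k <= n)%N -> poch x n != 0 -> poch x k != 0.
Proof. by move=> kn /poch_neq0P h; apply/poch_neq0P => i ik; apply: h; lia. Qed.

(** The summand of the theorem in terms of sigma: no power of q is left, and the Vandermonde
    quotient is absorbed into (-1)^s and [Uf]. *)
Definition bterm a b c d e f g m z y :=
  let s := wt y in
  (-1) ^+ s * Uf m z y *
  (poch b s * poch c s * poch d s /
    (poch (a * q / e) s * poch (a * q / f) s * poch (a * q / g) s)) *
  \prod_k (sg (a * z k * q ^+ (y k + s)) / sg (a * z k) *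
    (poch (a * z k) s / poch (a * q ^+ (1 + m k) * z k) s) *
    (poch (e * z k) (y k) * poch (f * z k) (y k) * poch (g * z k) (y k) /
     (poch (a * q * z k / b) (y k) * poch (a * q * z k / c) (y k) *
      poch (a * q * z k / d) (y k)))).

(** Assumed at this level, because the genericity conditions of [jackson_generic] are removed by
    continuity, which is available only for the concrete sigma ([jackson_sigma]). *)
Hypothesis jackson : forall a b c d m z, a != 0 -> b != 0 -> c != 0 -> d != 0 ->
  (forall k, z k != 0) -> nodes_sep m z -> jackson_at a b c d m z.

Lemma nodes_sep_le m y z : mle y m -> nodes_sep m z -> nodes_sep y z.
Proof.
move=> /mleP ym sep j k i l iy ly; apply: sep.
  exact: leq_trans iy (ym k).
exact: leq_trans ly (ym j).
Qed.

(** The summand of the Jackson sum over the box of y with base lam and parameters lam b / a, lam c /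
    a, lam e / a, with its denominators restored. *)
Definition inner a b c e lam z y x :=
  let s := wt y in let X := wt x in
  Uf y z x *
  (poch (lam * b / a) X * poch (lam * c / a) X * poch (a / lam) (s - X) /
    poch (a * q / e) X) *
  \prod_k (sg (lam * z k * q ^+ (x k + X)) * poch (lam * z k) X /
    poch (lam * z k) (1 + y k + X) *
    (poch (lam * e * z k / a) (x k) * poch (a * q ^+ s * z k) (x k) /
     (poch (a * q * z k / b) (x k) * poch (a * q * z k / c) (x k)))).

(** The value of lam is chosen so that the closed form of this Jackson sum consists of Pochhammer
    symbols of b, c and e z_k, while h becomes a / lam and the dependent parameter a q^s. D is the
    factor by which the denominators had been cleared. *)
Lemma inner_sum a b c e lam m z y :
  a != 0 -> b != 0 -> c != 0 -> e != 0 -> (forall k, z k != 0) ->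
  nodes_sep m z -> mle y m -> lam = a ^+ 2 * q / (b * c * e) ->
  poch (a * q / e) (wt m) != 0 ->
  (forall k, poch (a * q * z k / b) (m k) != 0) ->
  (forall k, poch (a * q * z k / c) (m k) != 0) ->
  (forall k, poch (lam * z k) (1 + m k + wt m) != 0) ->
  poch b (wt y) * poch c (wt y) / poch (a * q / e) (wt y) *
  \prod_k (poch (e * z k) (y k) /
    (poch (a * q * z k / b) (y k) * poch (a * q * z k / c) (y k))) =
  \sum_(x <- box y) inner a b c e lam z y x.
Proof.
move=> a0 b0 c0 e0 z0 sep ym lamE n1 n2 n3 n4.
have l0 : lam != 0 by rewrite lamE !(mulf_neq0, invr_eq0, expf_neq0).
have yk := mleP _ _ ym; have sM := wt_le ym.
have qn n : q ^+ n != 0 by exact: expf_neq0.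
set s := wt y.
have {}n1 : poch (a * q / e) s != 0 by exact: poch_le n1.
have {}n2 k : poch (a * q * z k / b) (y k) != 0 by exact: poch_le (n2 k).
have {}n3 k : poch (a * q * z k / c) (y k) != 0 by exact: poch_le (n3 k).
have {}n4 k : poch (lam * z k) (1 + y k + s) != 0.
  by apply: poch_le (n4 k); move: (yk k) sM; rewrite -/s; clear; lia.
have : jackson_at lam (lam * b / a) (lam * c / a) (lam * e / a) y z.
  by apply: jackson; rewrite ?(mulf_neq0, invr_eq0) //; exact: nodes_sep_le sep.
rewrite /jackson_at.
pose D := poch (a * q / e) s * \prod_k (poch (lam * z k) (1 + y k + s) *
  (poch (a * q * z k / b) (y k) * poch (a * q * z k / c) (y k))).
move=> /(congr1 (fun t => t / D)) J.
transitivity (jsum lam (lam * b / a) (lam * c / a) (lam * e / a) y z / D).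
  rewrite /jsum /D -/s.
  have -> : lam * q / (lam * b / a * (lam * e / a)) = c.
    by rewrite lamE; field; rewrite ?(a0, b0, c0, e0, q0).
  have -> : lam * q / (lam * c / a * (lam * e / a)) = b.
    by rewrite lamE; field; rewrite ?(a0, b0, c0, e0, q0).
  set P1 := \prod_k _; set P2 := \prod_k _; set P3 := \prod_k _; set P4 := \prod_k _.
  suff -> : P1 = P2 * P3 / P4 by rewrite invfM; ring.
  rewrite /P1 /P2 /P3 /P4 -prodfV -!big_split /=.
  apply: eq_bigr => k _.
  have -> : lam * q * z k / (lam * b / a * (lam * c / a)) = e * z k.
    by rewrite lamE; field; rewrite ?(a0, b0, c0, e0, q0).
  by field; rewrite n2 n3 n4.
rewrite -J big_distrl /= big_seq [RHS]big_seq; apply: eq_bigr => x.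
rewrite mem_box => xy; have xk := mleP _ _ xy; have Xs : (wt x <= s)%N by exact: wt_le.
rewrite /jterm /inner -/s; set X := wt x.
have -> : lam * q / (lam * b / a * (lam * c / a) * (lam * e / a)) = a / lam.
  by rewrite lamE; field; rewrite ?(a0, b0, c0, e0, q0).
have -> : lam * q ^+ (1 + X) / (lam * e / a) = a * q / e * q ^+ X.
  by rewrite exprD expr1; field; rewrite l0 a0 e0.
rewrite (poch_sub Xs n1).
have -> : lam * (a / lam) * q ^+ s = a * q ^+ s by field.
under [\prod_k poch (_ / (lam * b / a)) _]eq_bigr => k _.
  have -> : lam * q ^+ (1 + x k) * z k / (lam * b / a) = a * q * z k / b * q ^+ x k.
    by rewrite exprD expr1; field; rewrite l0 a0 b0.
  rewrite (poch_sub (xk k) (n2 k)); over.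
under [\prod_k poch (_ / (lam * c / a)) _]eq_bigr => k _.
  have -> : lam * q ^+ (1 + x k) * z k / (lam * c / a) = a * q * z k / c * q ^+ x k.
    by rewrite exprD expr1; field; rewrite l0 a0 c0.
  rewrite (poch_sub (xk k) (n3 k)); over.
set P1 := \prod_k _; set P2 := \prod_k _; set P3 := \prod_k _.
set P4 := \prod_k _; set P5 := \prod_k _; set P6 := \prod_k _.
suff e6 : P1 * P2 * P3 * P4 * P5 / \prod_k (poch (lam * z k) (1 + y k + s) *
  (poch (a * q * z k / b) (y k) * poch (a * q * z k / c) (y k))) = P6.
  rewrite -e6 /D; set E := \prod_k (poch _ (_ + s) * _).
  have h1 := poch_le Xs n1.
  have E0 : E != 0 by apply/prodf_neq0 => k _; rewrite !mulf_neq0.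
  by field; rewrite ?(h1, n1, E0).
rewrite /P1 /P2 /P3 /P4 /P5 /P6 -prodfV -!big_split /=; apply: eq_bigr => k _.
have n5 : poch (lam * z k) (1 + y k + X) != 0.
  by apply: poch_le (n4 k); move: Xs; rewrite -/X; clear; lia.
have -> : (s - X = 1 + y k + s - (1 + y k + X))%N.
  by move: Xs; rewrite -/X; clear; lia.
rewrite poch_sub //; last by move: Xs; rewrite -/X; clear; lia.
have m2 := poch_le (xk k) (n2 k); have m3 := poch_le (xk k) (n3 k).
have -> : lam * e / a * z k = lam * e * z k / a by ring.
by field; rewrite ?(n2, n3, n4, n5, m2, m3).
Qed.

Definition outer a d f g m z y :=
  let s := wt y in
  (-1) ^+ s * Uf m z y *
  (poch d s / (poch (a * q / f) s * poch (a * q / g) s)) *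
  \prod_k (sg (a * z k * q ^+ (y k + s)) / sg (a * z k) *
    (poch (a * z k) s / poch (a * q ^+ (1 + m k) * z k) s) *
    (poch (f * z k) (y k) * poch (g * z k) (y k) / poch (a * q * z k / d) (y k))).

Lemma btermE a b c d e f g m z y :
  bterm a b c d e f g m z y =
  outer a d f g m z y *
  (poch b (wt y) * poch c (wt y) / poch (a * q / e) (wt y) *
   \prod_k (poch (e * z k) (y k) /
    (poch (a * q * z k / b) (y k) * poch (a * q * z k / c) (y k)))).
Proof.
rewrite /bterm /outer; set P := \prod_k _; set P1 := \prod_k _; set P2 := \prod_k _.
have -> : P = P1 * P2.
  by rewrite /P1 /P2 -big_split /=; apply: eq_bigr => k _; rewrite !invfM; ring.
by rewrite !invfM; ring.
Qed.

Lemma jtermE a b c d m z y :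
  jterm a b c d m z y =
  let M := wt m in let s := wt y in
  let h := a * q / (b * c * d) in let e := a * h * q ^+ M in
  Uf m z y *
  (poch b s * poch c s * poch h (M - s) * poch (a * q ^+ (1 + s) / d) (M - s)) *
  \prod_k (sg (a * z k * q ^+ (y k + s)) * poch (a * z k) s *
    poch (a * z k * q ^+ (1 + m k + s)) (M - s) *
    (poch (d * z k) (y k) * poch (e * z k) (y k) *
     poch (a * q ^+ (1 + y k) * z k / b) (m k - y k) *
     poch (a * q ^+ (1 + y k) * z k / c) (m k - y k))).
Proof. by rewrite /jterm /= !big_split /=; ring. Qed.

Lemma bailey a b c d e f g lam m z :
  a != 0 -> b != 0 -> c != 0 -> d != 0 -> e != 0 -> f != 0 -> g != 0 ->
  (forall k, z k != 0) -> nodes_sep m z ->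
  a ^+ 3 * q ^+ (2 + wt m) = b * c * d * e * f * g ->
  lam = a ^+ 2 * q / (b * c * e) ->
  (forall k, sg (a * z k) != 0) ->
  poch (a * q / e) (wt m) != 0 -> poch (a * q / f) (wt m) != 0 ->
  poch (a * q / g) (wt m) != 0 ->
  (forall k, poch (a * q ^+ (1 + m k) * z k) (wt m) != 0) ->
  (forall k, poch (a * q * z k / b) (m k) != 0) ->
  (forall k, poch (a * q * z k / c) (m k) != 0) ->
  (forall k, poch (a * q * z k / d) (m k) != 0) ->
  (forall k, poch (lam * z k) (1 + m k + wt m) != 0) ->
  poch (lam * q / f) (wt m) != 0 -> poch (lam * q / g) (wt m) != 0 ->
  (forall k, poch (lam * q * z k / d) (m k) != 0) ->
  \sum_(y <- box m) bterm a b c d e f g m z y =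
  poch (lam * q / f) (wt m) * poch (lam * q / g) (wt m) /
    (poch (a * q / f) (wt m) * poch (a * q / g) (wt m)) *
  \prod_k (poch (a * q * z k) (m k) * poch (lam * q * z k / d) (m k) /
    (poch (lam * q * z k) (m k) * poch (a * q * z k / d) (m k))) *
  \sum_(x <- box m)
    bterm lam (lam * b / a) (lam * c / a) d (lam * e / a) f g m z x.
Proof.
move=> a0 b0 c0 d0 e0 f0 g0 z0 sep bal lamE na ne nf ng nam nb nc nd nl nlf nlg nld.
have l0 : lam != 0 by rewrite lamE !(mulf_neq0, invr_eq0, expf_neq0).
have qn n : q ^+ n != 0 by exact: expf_neq0.
set M := wt m.
transitivity (\sum_(y <- box m) \sum_(x <- box y)
    outer a d f g m z y * inner a b c e lam z y x).
  rewrite big_seq [RHS]big_seq; apply: eq_bigr => y; rewrite mem_box => ym.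
  by rewrite -big_distrr /= -(inner_sum (m := m)) // btermE.
rewrite (box_exchange m (fun x y => outer a d f g m z y * inner a b c e lam z y x)).
rewrite big_distrr /= big_seq [RHS]big_seq; apply: eq_bigr => x; rewrite mem_box => xm.
have xk := mleP _ _ xm; set X := wt x; have XM : (X <= M)%N by exact: wt_le.
set m' := msub m x; set z' := zsh z x.
have wm' : wt m' = (M - X)%N by rewrite wt_sub.
have mE k : m' k = (m k - x k)%N by rewrite ffunE.
have lE : lam * b * c * e = a ^+ 2 * q.
  by rewrite lamE; field; rewrite b0 c0 e0.
(* Eliminating b c e from the balancing condition leaves the balancing condition of the sum over w
   below. *)
have gE : lam * a * q ^+ (1 + M) = d * f * g.
  have bce : b * c * e != 0 by rewrite !mulf_neq0.
  apply: (mulIf bce); transitivity (a ^+ 3 * q ^+ (2 + M)); last by rewrite bal; ring.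
  rewrite (exprD _ 1) (exprD _ 2) /M.
  by transitivity (lam * b * c * e * (a * q ^+ 1 * q ^+ wt m)); [|rewrite lE]; ring.
pose h := lam * q / (d * f).
(* E is the part of the term (x, x + w) that does not depend on w. *)
pose E := (-1) ^+ M * Uf m z x *
  (poch d X * poch (lam * b / a) X * poch (lam * c / a) X /
   (poch (a * q / g) M * poch (a * q / f) M * poch (a * q / e) X)) *
  \prod_k (poch (a * z k) (X + x k) /
      (sg (a * z k) * poch (a * q ^+ (1 + m k) * z k) M) *
    (sg (lam * z k * q ^+ (x k + X)) * poch (lam * z k) X /
      poch (lam * z k) (1 + m k + X)) *
    (poch (f * z k) (x k) * poch (g * z k) (x k) * poch (lam * e * z k / a) (x k) /
      (poch (a * q * z k / d) (m k) * poch (a * q * z k / b) (x k) *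
       poch (a * q * z k / c) (x k)))).
have sgn2 i : (-1) ^+ i * (-1) ^+ i = 1 :> K by rewrite -exprMn mulrNN mulr1 expr1n.
(* As a function of w the term is a Jackson summand with base a q^X and parameters a / lam, d q^X,
   f; its dependent parameter is g, by [gE]. *)
have step w : w \in box m' ->
    outer a d f g m z (madd x w) * inner a b c e lam z (madd x w) x =
    E * jterm (a * q ^+ X) (a / lam) (d * q ^+ X) f m' z' w.
  rewrite mem_box => /mleP wm.
  have ym : mle (madd x w) m.
    by apply/mleP => k; move: (wm k) (xk k); rewrite !ffunE; clear; lia.
  rewrite jtermE /outer /inner wm' wt_add -/X; set s := wt w.
  have sM : (X + s <= M)%N by have := wt_le ym; rewrite wt_add.
  have U := Uf_split sep z0 ym; rewrite -/m' -/z' in U.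
  rewrite (_ : X + s - X = s)%N ?addKn //.
  have -> : a * q ^+ X * q / (a / lam * (d * q ^+ X) * f) = h.
    by rewrite /h; field; rewrite ?(a0, d0, f0, l0, qn).
  have -> : a * q ^+ X * h * q ^+ (M - X) = g.
    rewrite /h -[LHS](mulrAC _ _) -mulrA.
    transitivity (lam * a * q ^+ (1 + M) / (d * f)).
      by rewrite -{2}(subnKC XM) !exprD expr1; ring.
    by rewrite gE; field; rewrite d0 f0.
  have -> : a * q ^+ X * q ^+ (1 + s) / f = a * q / f * q ^+ (X + s).
    by rewrite !exprD expr1; ring.
  have Mxs : (M - X - s = M - (X + s))%N by rewrite subnDA.
  rewrite Mxs (poch_sub sM nf).
  have hg : h * (a * q / g * q ^+ (X + s)) * q ^+ (M - (X + s)) = q.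
    rewrite /h -!mulrA -(exprD q (X + s)) subnKC //.
    transitivity (lam * a * q ^+ (1 + M) / (d * f * g) * q).
      by rewrite exprD expr1; field; rewrite d0 f0 g0.
    by rewrite gE; field; rewrite d0 f0 g0.
  rewrite (poch_rev hg) (poch_sub sM ng) (pochD d X s).
  have nf' := poch_le sM nf; have ng' := poch_le sM ng; have ne' := poch_le XM ne.
  rewrite /E; set P := \prod_k _; set Q := \prod_k _; set Ek := \prod_k _.
  set J := \prod_k _.
  suff PQ : P * Q = Ek * J.
    have sE : (-1) ^+ (X + s) = (-1) ^+ M * (-1) ^+ (M - (X + s)) :> K.
      by rewrite -{1}(subnKC sM) (exprD _ (X + s)) -mulrA sgn2 mulr1.
    rewrite sE; move: ((-1) ^+ M) ((-1) ^+ (M - (X + s))) => s1 s2.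
    set T := poch (a / lam) s; set T1 := poch (d * _) s.
    transitivity ((Uf m z (madd x w) * Uf (madd x w) z x) * (P * Q) *
      (s1 * s2 * (poch d X * T1 / (poch (a * q / f) (X + s) * poch (a * q / g) (X + s))) *
       (poch (lam * b / a) X * poch (lam * c / a) X * T / poch (a * q / e) X))).
      by rewrite !invfM; ring.
    by rewrite U PQ; field; rewrite nf ng nf' ng' ne'.
  rewrite -[LHS]big_split -[RHS]big_split /=; apply: eq_bigr => k _; rewrite !ffunE.
  have wk : (w k <= m k - x k)%N by have := wm k; rewrite mE.
  have xwm : (x k + w k <= m k)%N by rewrite -leq_subRL.
  have -> : a * q ^+ X * z' k * q ^+ (w k + s) = a * z k * q ^+ (x k + w k + (X + s)).
    by rewrite /z' /zsh !exprD; ring.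
  have -> : a * q ^+ X * z' k * q ^+ (1 + (m k - x k) + s) =
      a * q ^+ (1 + m k) * z k * q ^+ (X + s).
    by rewrite /z' /zsh -{2}(subnKC (xk k)) !exprD; ring.
  rewrite (poch_sub sM (nam k)).
  have -> : a * q ^+ X * q ^+ (1 + w k) * z' k / (a / lam) =
      lam * z k * q ^+ (1 + (x k + w k) + X).
    by rewrite /z' /zsh !exprD; field; rewrite a0 l0.
  have -> : a * q ^+ X * q ^+ (1 + w k) * z' k / (d * q ^+ X) =
      a * q * z k / d * q ^+ (x k + w k).
    by rewrite /z' /zsh !exprD expr1; field; rewrite d0 qn.
  have nlX : poch (lam * z k) (1 + m k + X) != 0.
    by apply: poch_le (nl k); rewrite leq_add2l.
  have e1 : (m k - x k - w k = 1 + m k + X - (1 + (x k + w k) + X))%N.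
    by move: (xk k) wk; clear; lia.
  have le1 : (1 + (x k + w k) + X <= 1 + m k + X)%N by move: xwm; clear; lia.
  rewrite {1}e1 (poch_sub le1 nlX) -subnDA (poch_sub xwm (nd k)).
  rewrite (pochD (f * z k)) (pochD (g * z k)).
  have -> : f * z' k = f * z k * q ^+ x k by rewrite /z' /zsh mulrA.
  have -> : g * z' k = g * z k * q ^+ x k by rewrite /z' /zsh mulrA.
  (* Both sides are [poch (a * z k) (X + s + x k)]. This trades the numerator a q^|y| z_k of the
     inner sum for the shifted base of the sum over w. *)
  have K2 : poch (a * z k) (X + s) * poch (a * q ^+ (X + s) * z k) (x k) =
      poch (a * z k) (X + x k) * poch (a * q ^+ X * z' k) s.
    have -> : a * q ^+ (X + s) * z k = a * z k * q ^+ (X + s) by ring.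
    rewrite -pochD addnAC pochD; congr (_ * poch _ _).
    by rewrite /z' /zsh exprD; ring.
  have n1 := poch_le le1 nlX; have n2 := poch_le xwm (nd k).
  have n3 := poch_le sM (nam k); have n4 := poch_le (xk k) (nb k).
  have n5 := poch_le (xk k) (nc k).
  set A1 := poch (a * z k) (X + s) in K2 *; set A2 := poch (a * q ^+ (X + s) * z k) (x k) in K2 *.
  set B1 := poch (a * z k) (X + x k) in K2 *; set B2 := poch (a * q ^+ X * z' k) s in K2 *.
  set F1 := poch (f * z k) _; set F2 := poch (f * z k * _) _.
  set G1 := poch (g * z k) _; set G2 := poch (g * z k * _) _.
  set D1 := poch _ (x k + w k) in n2 *; set D2 := poch (_ / d) (m k).
  set L1 := sg (lam * _ * _); set L2 := poch (lam * z k) X.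
  set L3 := poch (lam * z k) (_ + X) in n1 *; set L4 := poch (lam * z k) (_ + X) in nlX *.
  set C1 := poch _ M; set C2 := poch _ (X + s) in n3 *.
  have nd' := nd k; rewrite -/D2 in nd'; have nam' := nam k; rewrite -/C1 in nam'.
  transitivity (A1 * A2 * (sg (a * z k * q ^+ (x k + w k + (X + s))) / sg (a * z k) / C2 *
    (F1 * F2 * (G1 * G2) / D1) * (L1 * L2 / L3 * (poch (lam * e * z k / a) (x k) /
      (poch (a * q * z k / b) (x k) * poch (a * q * z k / c) (x k)))))).
    by field; rewrite ?(n1, n2, n3, n4, n5, na k).
  rewrite K2; field.
  by rewrite ?(n1, n2, n3, n4, n5, na k, nlX, nd', nam').
have xin : jackson_at (a * q ^+ X) (a / lam) (d * q ^+ X) f m' z'.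
  apply: jackson; rewrite ?(mulf_neq0, invr_eq0, expf_neq0) //.
    by move=> k; rewrite mulf_neq0 ?expf_neq0.
  exact: nodes_sep_shift.
rewrite big_seq (eq_bigr _ step) -big_seq -big_distrr /= xin /jsum wm'.
have -> : a * q ^+ X * q / (a / lam * f) = lam * q / f * q ^+ X.
  by field; rewrite a0 f0 l0.
have hg : a * q ^+ X * q / (d * q ^+ X * f) * (lam * q / g * q ^+ X) * q ^+ (M - X) = q.
  rewrite -!mulrA -(exprD q X) subnKC //.
  transitivity (lam * a * q ^+ (1 + M) / (d * f * g) * q).
    by rewrite exprD expr1; field; rewrite d0 f0 g0 qn.
  by rewrite gE; field; rewrite d0 f0 g0.
rewrite (poch_rev hg) (poch_sub XM nlf) (poch_sub XM nlg).
have nlf' := poch_le XM nlf; have nlg' := poch_le XM nlg; have ne' := poch_le XM ne.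
rewrite /bterm /E -/X.
have -> : lam * q / (lam * e / a) = a * q / e by field; rewrite l0 a0 e0.
set P1 := \prod_k _; set P2 := \prod_k _; set P3 := \prod_k _.
set P4 := \prod_k _; set P5 := \prod_k _.
suff PQ : P1 * (P2 * P3) = P4 * P5.
  (* The sign (-1)^M of E and the (-1)^(M - X) of the reversal leave the (-1)^X required by
     [bterm]. *)
  have sE : (-1) ^+ M = (-1) ^+ X * (-1) ^+ (M - X) :> K.
    by rewrite -exprD subnKC.
  have := sgn2 (M - X)%N; rewrite sE; move: ((-1) ^+ X) ((-1) ^+ (M - X)) => s1 s2 s22.
  transitivity (s2 * s2 * s1 * Uf m z x * (P1 * (P2 * P3)) *
    (poch d X * poch (lam * b / a) X * poch (lam * c / a) X /
      (poch (a * q / g) M * poch (a * q / f) M * poch (a * q / e) X) *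
     (poch (lam * q / f) M / poch (lam * q / f) X) *
     (poch (lam * q / g) M / poch (lam * q / g) X))).
    by rewrite !invfM; ring.
  by rewrite s22 PQ; field; rewrite nf ng nlf' nlg' ne'.
rewrite -[P2 * P3]big_split -[LHS]big_split -[RHS]big_split /=.
apply: eq_bigr => k _; rewrite [msub m x k]ffunE.
have splitD (t : K) i j : poch (t * z k) (1 + i + j) =
    sg (t * z k) * poch (t * q * z k) i * poch (t * q ^+ (1 + i) * z k) j.
  by rewrite pochD (pochD _ 1) poch1 expr1 !(mulrAC t (z k)).
have -> : a * q ^+ X * q * z' k / (a / lam * (d * q ^+ X)) = lam * q * z k / d * q ^+ x k.
  by rewrite /z' /zsh; field; rewrite a0 l0 d0 qn.
rewrite (poch_sub (xk k) (nld k)).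
have -> : lam * e / a * z k = lam * e * z k / a by ring.
have -> : lam * q * z k / (lam * b / a) = a * q * z k / b by field; rewrite l0 a0 b0.
have -> : lam * q * z k / (lam * c / a) = a * q * z k / c by field; rewrite l0 a0 c0.
(* Both sides are [poch (a * z k) (1 + m k + M)], cut at different places. *)
have K2 : poch (a * z k) (X + x k) * poch (a * q ^+ X * z' k) (1 + (m k - x k) + (M - X)) =
    sg (a * z k) * poch (a * q * z k) (m k) * poch (a * q ^+ (1 + m k) * z k) M.
  rewrite -splitD; have -> : a * q ^+ X * z' k = a * z k * q ^+ (X + x k).
    by rewrite /z' /zsh exprD; ring.
  have len (i j n N : nat) : (i <= n -> j <= N ->
      j + i + (1 + (n - i) + (N - j)) = 1 + n + N)%N by clear; lia.
  by rewrite -pochD len.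
have nlX : poch (lam * z k) (1 + m k + X) != 0.
  by apply: poch_le (nl k); rewrite leq_add2l.
rewrite splitD in nlX *; move: nlX; rewrite !mulf_eq0 !negb_or.
case/andP => /andP[h1 h2] h3.
have n4 := poch_le (xk k) (nb k); have n5 := poch_le (xk k) (nc k).
have n6 := poch_le (xk k) (nld k); have n7 := nd k; have n8 := nam k; have n9 := na k.
set A1 := poch (a * z k) _ in K2 *; set A2 := poch (a * q ^+ X * z' k) _ in K2 *.
set F := poch (f * z k) _; set G := poch (g * z k) _; set D := poch (a * q * z k / d) _ in n7 *.
set L1 := sg (lam * _ * _); set L2 := poch (lam * z k) X.
set L3 := sg (lam * z k) in h1 *; set L4 := poch (lam * q * z k) _ in h2 *.
set L5 := poch (lam * _ * _) X in h3 *; set L6 := poch (_ / d) (m k).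
set L7 := poch (_ / d) (x k) in n6 *; set Q := poch (lam * e * _ / a) _.
set Q1 := poch (_ / b) _ in n4 *; set Q2 := poch (_ / c) _ in n5 *.
set C := poch _ M in K2 n8 *; set S := sg (a * z k) in K2 n9 *.
transitivity (A1 * A2 * (1 / (S * C) * (L1 * L2 / (L3 * L4 * L5)) *
  (F * G * Q / (D * Q1 * Q2)) * (L6 / L7))).
  by field; rewrite ?(h1, h2, h3, n4, n5, n6, n7, n8, n9).
by rewrite K2; field; rewrite ?(h1, h2, h3, n4, n5, n6, n7, n8, n9).
Qed.

End OddFunction.

(** * Limits of complex sequences *)

Section Limits.
Variable R : realType.
Local Notation C := R[i].
Local Notation nm := (@Normc.normc R).
Implicit Types (u v : nat -> C) (x y l : C).

Lemma nmE x : `|x| = (nm x)%:C.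
Proof. by case: x. Qed.

Lemma nmM x y : nm (x * y) = nm x * nm y.
Proof. exact: Normc.normcM. Qed.

Lemma nmV x : nm x^-1 = (nm x)^-1.
Proof. exact: Normc.normcV. Qed.

Lemma nm0 : nm 0 = 0.
Proof. exact: Normc.normc0. Qed.

Lemma nm1 : nm 1 = 1.
Proof. exact: Normc.normc1. Qed.

Lemma nmN x : nm (- x) = nm x.
Proof. exact: normcN. Qed.

Lemma nmD x y : nm (x + y) <= nm x + nm y.
Proof. exact: le_normcD. Qed.

Lemma nm_ge0 x : 0 <= nm x.
Proof. by case: x => a b; apply: sqrtr_ge0. Qed.

Lemma nm_eq0 x : (nm x == 0) = (x == 0).
Proof.
by apply/eqP/eqP => [/(@Normc.eq0_normc R)//|->]; exact: nm0.
Qed.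

Lemma nm_gt0 x : (0 < nm x) = (x != 0).
Proof. by rewrite lt_def nm_eq0 nm_ge0 andbT. Qed.

Lemma nmX x n : nm (x ^+ n) = nm x ^+ n.
Proof. by elim: n => [|n IH]; rewrite ?expr0 ?nm1 // !exprS nmM IH. Qed.

Lemma nmB x y : nm (x - y) <= nm x + nm y.
Proof. by rewrite -(nmN y) nmD. Qed.

Lemma nm_dist x y : nm (x - y) = nm (y - x).
Proof. by rewrite -nmN opprB. Qed.

Lemma nm_real (a : R) : nm a%:C = `|a|.
Proof. by rewrite /Normc.normc /= expr0n addr0 sqrtr_sqr. Qed.

Lemma nm_sum (I : Type) (s : seq I) (P : pred I) (F : I -> C) :
  nm (\sum_(i <- s | P i) F i) <= \sum_(i <- s | P i) nm (F i).
Proof.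
elim/big_rec2: _ => [|i a b _ h]; first by rewrite nm0.
by apply: le_trans (nmD _ _) _; rewrite lerD2l.
Qed.

(** Convergence with a real tolerance; [tendsto_limn] connects it with the topological limit that
    defines [theta]. *)
Definition tendsto u l :=
  forall e : R, 0 < e -> exists N, forall n, (N <= n)%N -> nm (u n - l) < e.

Lemma tendsto_limn u l : tendsto u l -> limn (fun n => u n : C^o) = l.
Proof.
move=> ul; apply: cvg_lim; first exact: norm_hausdorff.
apply/cvgrPdist_lt => e; case: e => a b; rewrite ltcE /= => /andP[/eqP b0 a0].
have [N hN] := ul _ a0; exists N => // n /= Nn.
rewrite nmE ltcE /= b0 eqxx /=.
by rewrite nm_dist; apply: hN.
Qed.

Lemma tendsto_cst l : tendsto (fun=> l) l.
Proof. by move=> e e0; exists 0%N => n _; rewrite subrr nm0. Qed.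

Lemma tendsto_unique u l l' : tendsto u l -> tendsto u l' -> l = l'.
Proof.
move=> h h'; apply/eqP; rewrite -subr_eq0 -nm_eq0; apply: contraT => n0.
have e0 : 0 < nm (l - l') / 2%:R by rewrite divr_gt0 ?ltr0n // nm_gt0 -nm_eq0.
have [N hN] := h _ e0; have [N' hN'] := h' _ e0.
have := hN _ (leq_maxl N N'); have := hN' _ (leq_maxr N N').
set n := maxn N N' => h1 h2.
have := nmB (u n - l') (u n - l).
have -> : u n - l' - (u n - l) = l - l' by ring.
by move: h1 h2; set t := nm (l - l'); lra.
Qed.

Lemma tendsto_eq u v l N : (forall n, (N <= n)%N -> u n = v n) ->
  tendsto u l -> tendsto v l.
Proof.
move=> uv h e /h[N' hN']; exists (maxn N N') => n; rewrite geq_max => /andP[a b].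
by rewrite -uv // hN'.
Qed.

Lemma tendstoD u v l l' : tendsto u l -> tendsto v l' ->
  tendsto (fun n => u n + v n) (l + l').
Proof.
move=> h h' e e0; have e2 : 0 < e / 2%:R by rewrite divr_gt0 ?ltr0n.
have [N hN] := h _ e2; have [N' hN'] := h' _ e2; exists (maxn N N') => n.
rewrite geq_max => /andP[/hN a /hN' b].
have -> : u n + v n - (l + l') = (u n - l) + (v n - l') by ring.
by apply: le_lt_trans (nmD _ _) _; move: a b; lra.
Qed.

Lemma tendsto_bounded u l : tendsto u l ->
  exists2 B : R, 0 < B & exists N, forall n, (N <= n)%N -> nm (u n) <= B.
Proof.
move=> h; exists (nm l + 1); first by rewrite ltr_wpDl ?nm_ge0.
have [N hN] := h _ ltr01; exists N => n /hN a.
have := nmD (u n - l) l; rewrite subrK; lra.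
Qed.

Lemma tendstoM u v l l' : tendsto u l -> tendsto v l' ->
  tendsto (fun n => u n * v n) (l * l').
Proof.
move=> h h' e e0; have [B B0 [N0 hB]] := tendsto_bounded h'.
pose T := nm l + 1; have T0 : 0 < T by rewrite ltr_wpDl ?nm_ge0.
have eB : 0 < e / 2%:R / B by rewrite !divr_gt0 ?ltr0n.
have eT : 0 < e / 2%:R / T by rewrite !divr_gt0 ?ltr0n.
have [N hN] := h _ eB; have [N' hN'] := h' _ eT.
exists (maxn N0 (maxn N N')) => n; rewrite !geq_max => /and3P[/hB b /hN a /hN' a'].
have -> : u n * v n - l * l' = (u n - l) * v n + l * (v n - l') by ring.
apply: le_lt_trans (nmD _ _) _; rewrite !nmM.
have h1 : nm (u n - l) * nm (v n) <= e / 2%:R / B * B.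
  by apply: ler_pM; rewrite ?nm_ge0 // ltW.
have h2 : nm l * nm (v n - l') <= (nm l) * (e / 2%:R / T).
  by apply: ler_wpM2l; rewrite ?nm_ge0 // ltW.
have h3 : nm l * (e / 2%:R / T) < T * (e / 2%:R / T).
  by rewrite ltr_pM2r // ltrDl ltr01.
move: h1 h2 h3; rewrite divfK ?gt_eqF // (mulrC T) divfK ?gt_eqF //; lra.
Qed.

Lemma tendstoZ u l x : tendsto u l -> tendsto (fun n => x * u n) (x * l).
Proof. exact/tendstoM/tendsto_cst. Qed.

Lemma tendstoN u l : tendsto u l -> tendsto (fun n => - u n) (- l).
Proof.
by move=> h e /h[N hN]; exists N => n /hN; rewrite -opprD nmN.
Qed.

Lemma tendstoB u v l l' : tendsto u l -> tendsto v l' ->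
  tendsto (fun n => u n - v n) (l - l').
Proof. by move=> h /tendstoN; apply: tendstoD. Qed.

Lemma tendsto_sum (I : Type) (s : seq I) (F : I -> nat -> C) (L : I -> C) :
  (forall i, tendsto (F i) (L i)) ->
  tendsto (fun n => \sum_(i <- s) F i n) (\sum_(i <- s) L i).
Proof.
move=> h; elim: s => [|i s IH].
  by rewrite big_nil; apply: (@tendsto_eq (fun=> 0) _ _ 0) (tendsto_cst 0) => n _; rewrite big_nil.
rewrite big_cons; apply: (@tendsto_eq _ _ _ 0) (tendstoD (h i) IH) => n _.
by rewrite big_cons.
Qed.

Lemma tendsto_prod (I : Type) (s : seq I) (F : I -> nat -> C) (L : I -> C) :
  (forall i, tendsto (F i) (L i)) ->
  tendsto (fun n => \prod_(i <- s) F i n) (\prod_(i <- s) L i).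
Proof.
move=> h; elim: s => [|i s IH].
  by rewrite big_nil; apply: (@tendsto_eq (fun=> 1) _ _ 0) (tendsto_cst 1) => n _; rewrite big_nil.
rewrite big_cons; apply: (@tendsto_eq _ _ _ 0) (tendstoM (h i) IH) => n _.
by rewrite big_cons.
Qed.

Lemma tendstoV u l : l != 0 -> tendsto u l -> tendsto (fun n => (u n)^-1) l^-1.
Proof.
move=> l0 h e e0; have T0 : 0 < nm l by rewrite nm_gt0.
have d0 : 0 < nm l / 2%:R by rewrite divr_gt0 ?ltr0n.
have e1 : 0 < e * (nm l * (nm l / 2%:R)) by rewrite !mulr_gt0.
have [N hN] := h _ d0; have [N' hN'] := h _ e1.
exists (maxn N N') => n; rewrite geq_max => /andP[/hN a /hN' b].
have un : nm l / 2%:R < nm (u n).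
  have := nmB (u n) (u n - l); have -> : u n - (u n - l) = l by ring.
  by move: a; lra.
have un0 : u n != 0 by rewrite -nm_gt0; apply: lt_trans un.
have -> : (u n)^-1 - l^-1 = (l - u n) / (l * u n) by field; rewrite un0 l0.
rewrite nmM nmV nmM nm_dist ltr_pdivrMr ?mulr_gt0 ?nm_gt0 //.
apply: lt_le_trans b _; rewrite ler_pM2l // ler_pM2l //.
exact: ltW.
Qed.

Lemma geometric_lt (A r e : R) : 0 <= r < 1 -> 0 < e ->
  exists N, forall n, (N <= n)%N -> A * r ^+ n < e.
Proof.
move=> /andP[r0 r1] e0; have rr : `|r| < 1 by rewrite ger0_norm.
have /cvgrPdist_lt/(_ e e0)[N _ hN] := @cvg_geometric R A r rr.
exists N => n Nn; have := hN n Nn; rewrite /= /geometric /= sub0r normrN.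
by apply: le_lt_trans; exact: ler_norm.
Qed.

Lemma tendsto_geometric u l (A r : R) : 0 <= r < 1 ->
  (forall n, nm (u n - l) <= A * r ^+ n) -> tendsto u l.
Proof.
move=> r01 h e e0; have [N hN] := geometric_lt A r01 e0.
by exists N => n /hN; apply: le_lt_trans.
Qed.

(** The telescoping series of a is dominated by a geometric series. *)
Lemma real_complete (a : nat -> R) (A r : R) : 0 <= r < 1 ->
  (forall n, `|a n.+1 - a n| <= A * r ^+ n) ->
  exists l : R, forall e : R, 0 < e -> exists N, forall n, (N <= n)%N -> `|a n - l| < e.
Proof.
move=> /andP[r0 r1] h; have rr : `|r| < 1 by rewrite ger0_norm.
have A0 : 0 <= A.
  by have := h 0%N; rewrite expr0 mulr1; apply: le_trans; apply: normr_ge0.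
have cs : cvgn (series (telescope a)).
  apply: (@normed_cvg R R^o).
  apply: (@series_le_cvg R (fun n => `|telescope a n|) (geometric A r)) => //.
    by move=> n; rewrite /geometric /= mulr_ge0 // exprn_ge0.
  exact: is_cvg_geometric_series.
exists (a 0%N + limn (series (telescope a))) => e e0.
have /cvgrPdist_lt/(_ e e0)[N _ hN] := cs.
exists N => n /hN /=; rewrite distrC [a n](eq_sum_telescope a).
by congr (`| _ | < _); ring.
Qed.

Lemma geometric_tail u (A r : R) n k : 0 <= A -> 0 <= r < 1 ->
  (forall n, nm (u n.+1 - u n) <= A * r ^+ n) ->
  nm (u (n + k)%N - u n) <= A / (1 - r) * r ^+ n.
Proof.
move=> A0 /andP[r0 r1] h; have r2 : 0 < 1 - r by rewrite subr_gt0.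
(* The exact partial geometric sum, which passes through the induction on k. *)
suff H : nm (u (n + k)%N - u n) <= A / (1 - r) * (r ^+ n - r ^+ (n + k)).
  apply: le_trans H _; rewrite ler_wpM2l ?divr_ge0 ?(ltW r2) //.
  by rewrite gerBl exprn_ge0.
elim: k => [|k IH]; first by rewrite addn0 !subrr nm0 mulr0.
have -> : u (n + k.+1)%N - u n = (u (n + k).+1 - u (n + k)%N) + (u (n + k)%N - u n).
  by rewrite addnS; ring.
apply: le_trans (nmD _ _) _; apply: le_trans (lerD (h _) IH) _.
rewrite addnS exprS le_eqVlt; apply/orP; left; apply/eqP; field.
by rewrite gt_eqF.
Qed.

Lemma tendsto_complete u (A r : R) : 0 <= r < 1 ->
  (forall n, nm (u n.+1 - u n) <= A * r ^+ n) ->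
  exists l, forall n, nm (l - u n) <= A / (1 - r) * r ^+ n.
Proof.
move=> r01 h.
have A0 : 0 <= A.
  by have := h 0%N; rewrite expr0 mulr1; apply: le_trans; apply: nm_ge0.
have hRe x : `|complex.Re x| <= nm x.
  by rewrite -lecR -nmE; exact: normc_ge_Re.
have hIm x : `|complex.Im x| <= nm x.
  by case: x => y z /=; rewrite -sqrtr_sqr ler_wsqrtr // lerDr sqr_ge0.
have [l1 h1] : exists l : R, forall e : R, 0 < e -> exists N, forall n, (N <= n)%N ->
    `|complex.Re (u n) - l| < e.
  apply: (real_complete r01 (A := A)) => n; apply: le_trans (h n).
  by apply: le_trans (hRe _); rewrite raddfB.
have [l2 h2] : exists l : R, forall e : R, 0 < e -> exists N, forall n, (N <= n)%N ->
    `|complex.Im (u n) - l| < e.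
  apply: (real_complete r01 (A := A)) => n; apply: le_trans (h n).
  by apply: le_trans (hIm _); rewrite raddfB.
exists (l1 +i* l2) => n; apply/ler_addgt0Pr => e e0.
have e2 : 0 < e / 2%:R by rewrite divr_gt0 ?ltr0n.
have [N1 g1] := h1 _ e2; have [N2 g2] := h2 _ e2.
pose k := maxn N1 N2.
have {}g1 := g1 (n + k)%N (leq_trans (leq_maxl _ _) (leq_addl _ _)).
have {}g2 := g2 (n + k)%N (leq_trans (leq_maxr _ _) (leq_addl _ _)).
(* The limits of the real and imaginary parts come without a rate; the rate is that of the tail up
   to a far index n + k, with an arbitrarily small error e. *)
have := geometric_tail n k A0 r01 h.
have -> : l1 +i* l2 - u n = (u (n + k)%N - u n) - (u (n + k)%N - l1 +i* l2) by ring.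
move=> t; apply: le_trans (nmB _ _) _; apply: lerD => //.
have split : u (n + k)%N - l1 +i* l2 =
    (complex.Re (u (n + k)%N) - l1)%:C + 'i * (complex.Im (u (n + k)%N) - l2)%:C.
  by case: (u (n + k)%N) => a b; simpc.
rewrite split; apply: le_trans (nmD _ _) _; rewrite nmM !nm_real.
have -> : nm 'i = 1 by rewrite /Normc.normc /= expr0n expr1n add0r sqrtr1.
by move: g1 g2; lra.
Qed.

Section Products.
Variables (v : nat -> C) (A r : R).
Hypotheses (A0 : 0 <= A) (r01 : 0 <= r < 1).
Hypothesis hv : forall n, nm (v n - 1) <= A * r ^+ n.

(** The n-th factor has modulus at most 1 + A r^n <= exp (A r^n), and the exponents sum to a
    geometric series. *)
Lemma prod_bounded n : nm (\prod_(i < n) v i) <= expR (A / (1 - r)).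
Proof.
have /andP[r0 r1] := r01; have r2 : 0 < 1 - r by rewrite subr_gt0.
suff H : nm (\prod_(i < n) v i) <= expR (A / (1 - r) * (1 - r ^+ n)).
  apply: le_trans H _; rewrite ler_expR ler_piMr ?divr_ge0 ?(ltW r2) //.
  by rewrite gerBl exprn_ge0.
elim: n => [|n IH]; first by rewrite big_ord0 nm1 subrr mulr0 expR0.
rewrite big_ord_recr /= nmM.
have -> : A / (1 - r) * (1 - r ^+ n.+1) = A / (1 - r) * (1 - r ^+ n) + A * r ^+ n.
  by rewrite exprS; field; rewrite gt_eqF.
rewrite expRD; apply: ler_pM; rewrite ?nm_ge0 //.
apply: le_trans (expR_ge1Dx _); have := nmD (v n - 1) 1.
by rewrite subrK nm1 addrC => /le_trans; apply; rewrite lerD2l.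
Qed.

Lemma prod_cvg : exists l, forall n,
  nm (l - \prod_(i < n) v i) <= expR (A / (1 - r)) * A / (1 - r) * r ^+ n.
Proof.
apply: tendsto_complete => // n; rewrite big_ord_recr /=.
have -> : \prod_(i < n) v i * v n - \prod_(i < n) v i =
  \prod_(i < n) v i * (v n - 1) by ring.
by rewrite nmM -mulrA ler_pM ?nm_ge0 ?prod_bounded.
Qed.

End Products.

(** From some N on, the inverses of the factors are again geometrically close to 1, so their
    products are bounded by some K; hence the partial products beyond N stay above |P| / K, where P
    is the product of the first N factors. *)
Lemma prod_neq0 (v : nat -> C) (A r : R) l : 0 <= A -> 0 <= r < 1 ->
  (forall n, nm (v n - 1) <= A * r ^+ n) -> (forall n, v n != 0) ->
  tendsto (fun n => \prod_(i < n) v i) l -> l != 0.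
Proof.
move=> A0 r01 hv v0 hl; have /andP[r0 r1] := r01.
have h2 : 0 < (2%:R : R)^-1 by rewrite invr_gt0 ltr0n.
have [N hN] := geometric_lt A r01 h2.
pose w i := (v (N + i)%N)^-1.
have hw n : nm (w n - 1) <= 2%:R * A * r ^+ n.
  have small : nm (v (N + n)%N - 1) < 2%:R^-1.
    by apply: le_lt_trans (hv _) _; apply: hN; apply: leq_addr.
  have big : 2%:R^-1 <= nm (v (N + n)%N).
    have := nmB (v (N + n)%N) (v (N + n)%N - 1); rewrite subKr nm1.
    by move: small; lra.
  have -> : w n - 1 = (1 - v (N + n)%N) / v (N + n)%N by rewrite /w; field.
  rewrite nmM nmV nm_dist ler_pdivrMr ?nm_gt0 //.
  have h3 : nm (v (N + n)%N - 1) <= A * r ^+ n.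
    apply: le_trans (hv _) _; apply: ler_wpM2l => //.
    by rewrite exprD ler_piMl ?exprn_ge0 // exprn_ile1 // ltW.
  apply: le_trans h3 _; rewrite [leRHS](_ : _ = A * r ^+ n * (2%:R * nm (v (N + n)%N))).
    rewrite ler_peMr ?mulr_ge0 ?exprn_ge0 //; move: big; lra.
  by ring.
have A2 : 0 <= 2%:R * A by rewrite mulr_ge0.
have [K K0 hK] : exists2 K : R, 0 < K & forall n, nm (\prod_(i < n) w i) <= K.
  by exists (expR (2%:R * A / (1 - r))); [exact: expR_gt0 | move=> n; apply: prod_bounded].
pose P := \prod_(i < N) v i.
have P0 : P != 0 by apply/prodf_neq0.
have low n : nm P <= K * nm (\prod_(i < N + n) v i).
  have -> : P = \prod_(i < n) w i * \prod_(i < N + n) v i.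
    rewrite big_split_ord /= mulrCA -big_split /=.
    by rewrite [X in _ * X]big1 ?mulr1 // => i _; rewrite /w mulVf.
  by rewrite nmM ler_wpM2r ?nm_ge0.
apply/negP => /eqP l0; rewrite l0 in hl.
have e0 : 0 < nm P / K by rewrite divr_gt0 ?nm_gt0.
have [N' hN'] := hl _ e0; have := hN' (N + N')%N (leq_addl _ _).
rewrite subr0 ltr_pdivlMr // mulrC => h.
by have := low N'; rewrite leNgt h.
Qed.

End Limits.

(** * The theta function *)

Section Theta.
Variable R : realType.
Local Notation C := R[i].
Local Notation nm := (@Normc.normc R).
Variable p : C.
Hypothesis hp : `|p| < 1.
Local Notation r := (nm p).
Implicit Types x y : C.

Lemma nmp01 : 0 <= r < 1.
Proof. by rewrite nm_ge0 /= -ltcR -nmE. Qed.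

Definition thetaP N x := \prod_(j < N) ((1 - p ^+ j * x) * (1 - p ^+ j.+1 / x)).

(** A is any upper bound, so that the rate of convergence becomes uniform along a convergent
    sequence of arguments. *)
Lemma theta_factor (A : R) x j : nm x + nm x^-1 + 1 <= A ->
  nm ((1 - p ^+ j * x) * (1 - p ^+ j.+1 / x) - 1) <= A * r ^+ j.
Proof.
move=> hA; have /andP[r0 r1] := nmp01.
have rj : 0 <= r ^+ j by rewrite exprn_ge0.
apply: le_trans (_ : (nm x + nm x^-1 + 1) * r ^+ j <= _); last by rewrite ler_wpM2r.
have -> : (1 - p ^+ j * x) * (1 - p ^+ j.+1 / x) - 1 =
    p ^+ j * (- x - p * x^-1 + x / x * (p * p ^+ j)).
  by rewrite exprS; ring.
rewrite nmM nmX mulrC ler_wpM2r //.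
apply: le_trans (nmD _ _) _; apply: lerD.
  apply: le_trans (nmB _ _) _; rewrite nmN lerD2l nmM.
  by rewrite ler_piMl ?nm_ge0 // ltW.
(* At x = 0 the quotient x / x is 0 by convention, and the bound still holds. *)
have [->|x0] := eqVneq x 0; first by rewrite !mul0r nm0.
by rewrite divff // mul1r -exprS nmX exprn_ile1 // ltW.
Qed.

Lemma theta_rate (A : R) x N : nm x + nm x^-1 + 1 <= A ->
  nm (theta p x - thetaP N x) <= expR (A / (1 - r)) * A / (1 - r) * r ^+ N.
Proof.
move=> hA; have A0 : 0 <= A by apply: le_trans hA; rewrite !addr_ge0 ?nm_ge0.
have fac j := theta_factor j hA.
have [l hl] := prod_cvg A0 nmp01 fac.
suff -> : theta p x = l by exact: hl.
apply: tendsto_limn; apply: (tendsto_geometric nmp01) => n.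
by rewrite nm_dist; exact: hl.
Qed.

Lemma theta_tendsto x : tendsto (thetaP^~ x) (theta p x).
Proof.
apply: (tendsto_geometric nmp01) => n; rewrite nm_dist; apply: theta_rate.
exact: lexx.
Qed.

(** One bound A serves x and almost all u n, so a single truncation of the product approximates all
    these values, and truncations are continuous. *)
Lemma theta_cont (u : nat -> C) x : x != 0 -> tendsto u x ->
  tendsto (fun n => theta p (u n)) (theta p x).
Proof.
move=> x0 ux; have uV := tendstoV x0 ux.
have [B1 B10 [N1 hB1]] := tendsto_bounded ux.
have [B2 B20 [N2 hB2]] := tendsto_bounded uV.
pose A := Num.max (B1 + B2 + 1) (nm x + nm x^-1 + 1).
have hA : nm x + nm x^-1 + 1 <= A by rewrite le_max lexx orbT.
move=> e e0; have e3 : 0 < e / 3%:R by rewrite divr_gt0 ?ltr0n.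
have [N hN] := geometric_lt (expR (A / (1 - r)) * A / (1 - r)) nmp01 e3.
have PN : tendsto (fun n => thetaP N (u n)) (thetaP N x).
  apply: tendsto_prod => j; apply: tendstoM.
    by apply: tendstoB (tendsto_cst _) _; apply: tendstoZ.
  by apply: tendstoB (tendsto_cst _) _; apply: tendstoZ.
have [N3 hN3] := PN _ e3.
exists (maxn N1 (maxn N2 N3)) => n; rewrite !geq_max => /and3P[/hB1 b1 /hB2 b2 /hN3 b3].
have hAn : nm (u n) + nm (u n)^-1 + 1 <= A.
  by rewrite le_max; apply/orP; left; rewrite lerD2r lerD.
have h1 := le_lt_trans (theta_rate N hAn) (hN _ (leqnn N)).
have h2 := le_lt_trans (theta_rate N hA) (hN _ (leqnn N)).
have -> : theta p (u n) - theta p x = (theta p (u n) - thetaP N (u n)) +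
  ((thetaP N (u n) - thetaP N x) - (theta p x - thetaP N x)) by ring.
apply: le_lt_trans (nmD _ _) _; have := nmB (thetaP N (u n) - thetaP N x) (theta p x - thetaP N x).
by move: h1 h2 b3; lra.
Qed.

Lemma theta1 : theta p 1 = 0.
Proof.
apply: tendsto_unique (theta_tendsto 1) _.
apply: (@tendsto_eq _ (fun=> 0) _ _ 1) (tendsto_cst 0) => -[//|n] _.
by rewrite /thetaP big_ord_recl expr0 mul1r subrr !mul0r.
Qed.

(** The partial products at x and 1 / x differ only in their end factors ([key]). Passing to the
    limit leaves a factor 1 - x to cancel, hence the separate case x = 1. *)
Lemma theta_inv x : x != 0 -> theta p x^-1 = - x^-1 * theta p x.
Proof.
move=> x0; have [->|x1] := eqVneq x 1; first by rewrite invr1 theta1 mulr0.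
have r01 := nmp01.
have pN y : tendsto (fun N => 1 - p ^+ N * y) 1.
  apply: (tendsto_geometric r01 (A := nm y)) => n.
  by rewrite addrAC subrr add0r nmN nmM nmX mulrC.
have key N : thetaP N x^-1 * ((1 - x) * (1 - p ^+ N * x^-1)) =
    thetaP N x * ((1 - x^-1) * (1 - p ^+ N * x)).
  elim: N => [|N IH]; first by rewrite /thetaP !big_ord0 expr0; ring.
  rewrite /thetaP !big_ord_recr /= -!/(thetaP _ _) invrK.
  rewrite [LHS](_ : _ = (thetaP N x^-1 * ((1 - x) * (1 - p ^+ N * x^-1))) *
    ((1 - p ^+ N.+1 * x) * (1 - p ^+ N.+1 * x^-1))); last by ring.
  by rewrite IH; ring.
have : theta p x^-1 * ((1 - x) * 1) = theta p x * ((1 - x^-1) * 1).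
  apply: tendsto_unique (tendstoM (theta_tendsto _) (tendstoZ (1 - x) (pN x^-1))) _.
  apply: (@tendsto_eq _ (fun N => thetaP N x * ((1 - x^-1) * (1 - p ^+ N * x))) _ _ 0).
    by move=> n _; rewrite key.
  exact: tendstoM (theta_tendsto _) (tendstoZ _ (pN x)).
have nx : 1 - x != 0 by rewrite subr_eq0 eq_sym.
rewrite !mulr1 => /(canRL (mulfK nx)) ->.
by field; rewrite x0 nx.
Qed.

(** A convergent product vanishes only through one of its factors, and such a factor determines the
    modulus of x. *)
Lemma theta_eq0 x : x != 0 -> theta p x = 0 ->
  exists j, nm x * r ^+ j = 1 \/ nm x = r ^+ j.+1.
Proof.
move=> x0 t0; pose A := nm x + nm x^-1 + 1.
have A0 : 0 <= A by rewrite !addr_ge0 ?nm_ge0.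
pose v j := (1 - p ^+ j * x) * (1 - p ^+ j.+1 / x).
have [[j]|] := pselect (exists j, v j = 0).
  move/eqP; rewrite mulf_eq0 => /orP[]; rewrite subr_eq0 => /eqP e; exists j.
    by left; rewrite -nmX -nmM mulrC -e nm1.
  by right; rewrite -nmX; congr nm; rewrite -[LHS]mul1r e divfK.
move=> nv; have v0 n : v n != 0 by apply/eqP => vn; apply: nv; exists n.
have := prod_neq0 A0 nmp01 (fun n => theta_factor n (lexx A)) v0 (theta_tendsto x).
by rewrite t0 eqxx.
Qed.

(** The moduli of zeros are integral powers of r, so two different ones differ at least by a factor
    r. *)
Lemma theta_eq0_gap x y : x != 0 -> y != 0 -> theta p x = 0 -> theta p y = 0 ->
  nm y < nm x -> nm y <= nm x * r.
Proof.
move=> x0 y0 /(theta_eq0 x0)[j hx] /(theta_eq0 y0)[k hy] yx.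
have /andP[r0 r1] := nmp01.
have ri n : r ^+ n <= 1 by rewrite exprn_ile1 // ltW.
rewrite leNgt; apply/negP => xy.
have ny : 0 < nm y by rewrite nm_gt0.
have nx : 0 < nm x by rewrite nm_gt0.
case: hx hy => [hx|hx] [hy|hy].
- have kj : (k < j)%N.
    rewrite ltnNge; apply/negP => jk.
    have : nm y * r ^+ k < nm x * r ^+ j.
      apply: le_lt_trans (_ : nm y * r ^+ j < _).
        by rewrite ler_wpM2l ?(ltW ny) // ler_wiXn2l // ltW.
      rewrite ltr_pM2r // lt_def exprn_ge0 // andbT.
      by apply/eqP => e; move: hx; rewrite e mulr0 => /esym/eqP; rewrite oner_eq0.
    by rewrite hx hy ltxx.
  case: j hx kj => // j hx kj.
  have : nm x * r ^+ j.+1 < nm y * r ^+ k.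
    rewrite exprS mulrA; apply: le_lt_trans (_ : nm x * r * r ^+ k < _).
      by rewrite ler_wpM2l ?mulr_ge0 ?(ltW nx) // ler_wiXn2l // ltW.
    rewrite ltr_pM2r // lt_def exprn_ge0 // andbT.
    by apply/eqP => e; move: hy; rewrite e mulr0 => /esym/eqP; rewrite oner_eq0.
  by rewrite hx hy ltxx.
- have x1 : 1 <= nm x by rewrite -hx ler_piMr // ltW.
  have : nm y <= r by rewrite hy exprS ler_piMr.
  have : r <= nm x * r by rewrite ler_peMl.
  by move: xy; lra.
- have y1 : 1 <= nm y by rewrite -hy ler_piMr // ltW.
  have : nm x <= r by rewrite hx exprS ler_piMr.
  by move: yx y1 r1; lra.
- have jk : (j < k)%N.
    rewrite ltnNge; apply/negP => kj; move: yx; rewrite hx hy ltNge => /negP; apply.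
    by rewrite ler_wiXn2l // ltW.
  move: xy; rewrite hx hy -exprSr ltNge => /negP; apply.
  by rewrite ler_wiXn2l // ltW.
Qed.

Definition step1 (n : nat) : C := (1 + n.+1%:R^-1 : R)%:C.

Lemma nm_step1 n : nm (step1 n) = 1 + n.+1%:R^-1.
Proof. by rewrite nm_real ger0_norm // addr_ge0 // invr_ge0 ler0n. Qed.

Lemma step1_neq0 n : step1 n != 0.
Proof. by rewrite -nm_gt0 nm_step1 ltr_wpDr // invr_ge0 ler0n. Qed.

Lemma step1_tendsto : tendsto step1 1.
Proof.
move=> e e0; have [N _ hN] := near_infty_natSinv_lt (PosNum e0).
exists N => n /hN h.
have -> : step1 n - 1 = (n.+1%:R^-1 : R)%:C.
  by apply/eqP; rewrite eq_complex /= subr0 addrAC subrr add0r !eqxx.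
rewrite nm_real.
by rewrite ger0_norm ?invr_ge0 ?ler0n.
Qed.

(** The moduli of x * step1 n ^ j decrease strictly to that of x. Once step1 n ^ j * r < 1 they lie
    too close together for two of them to belong to zeros ([theta_eq0_gap]), so at most one
    exception remains. *)
Lemma theta_step1_neq0 x j : x != 0 -> (0 < j)%N ->
  exists N, forall n, (N <= n)%N -> theta p (x * step1 n ^+ j) != 0.
Proof.
move=> x0 j0; have /andP[r0 r1] := nmp01.
have xs n : x * step1 n ^+ j != 0 by rewrite mulf_neq0 ?expf_neq0 ?step1_neq0.
have s1 n : 1 <= nm (step1 n) ^+ j.
  by rewrite exprn_ege1 // nm_step1 lerDl invr_ge0 ler0n.
have [N hN] : exists N, forall n, (N <= n)%N -> nm (step1 n) ^+ j * r < 1.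
  have : tendsto (fun n => step1 n ^+ j * p) (1 * p).
    apply: tendstoM (tendsto_cst p).
    have -> : (1 : C) = \prod_(i < j) 1 by rewrite big1.
    apply: (@tendsto_eq _ (fun n => \prod_(i < j) step1 n) _ _ 0).
      by move=> n _; rewrite prodr_const card_ord.
    by apply: tendsto_prod => i; exact: step1_tendsto.
  have e0 : 0 < 1 - r by rewrite subr_gt0.
  move=> /(_ _ e0)[N hN]; exists N => n /hN; rewrite mul1r -nmX -nmM => h.
  by have := nmD (step1 n ^+ j * p - p) p; rewrite subrK; move: h; lra.
have [[n0 [h0 z0]]|no] := pselect (exists n, (N <= n)%N /\ theta p (x * step1 n ^+ j) = 0).
  exists n0.+1 => n hn; apply/eqP => zn.
  have nx : 0 < nm x by rewrite nm_gt0.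
  have lt : nm (x * step1 n ^+ j) < nm (x * step1 n0 ^+ j).
    rewrite !nmM !nmX ltr_pM2l // ltrXn2r -?lt0n // ?nnegrE ?nm_ge0 // !nm_step1 ltrD2l.
    by rewrite ltf_pV2 ?posrE ?ltr0n // ltr_nat.
  have := theta_eq0_gap (xs n0) (xs n) z0 zn lt.
  rewrite !nmM !nmX -mulrA ler_pM2l // leNgt => /negP; apply.
  by apply: lt_le_trans (hN _ h0) (s1 n).
by exists N => n hn; apply/eqP => zn; apply: no; exists n.
Qed.

End Theta.

(** * The addition formula for theta *)

Section IntegerBoxes.
Implicit Types m k : int.

Definition zr N : seq int := [seq i%:Z - N%:Z | i <- iota 0 N.*2.+1].

Lemma mem_zr N m : (m \in zr N) = (`|m|%N <= N)%N.
Proof.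
apply/mapP/idP => [ [t]|mN]; first by rewrite mem_iota => ? ->; lia.
by exists (absz (m + N%:Z)); rewrite ?mem_iota; lia.
Qed.

Lemma subz_absz N m : (`|m|%N <= N)%N ->
  exists2 a : nat, N%:Z - m = a%:Z & (N - `|m| <= a)%N.
Proof. by move=> mN; exists (absz (N%:Z - m)); lia. Qed.

Lemma zr_uniq N : uniq (zr N).
Proof. by rewrite map_inj_uniq ?iota_uniq // => i j; lia. Qed.

Lemma size_zr N : size (zr N) = N.*2.+1.
Proof. by rewrite size_map size_iota. Qed.

Definition square N : seq (int * int) := [seq (m, k) | m <- zr N, k <- zr N].
(* In the coordinates ((m + k) / 2, (m - k) / 2), split according to parity, the
   diamond is a product; this is what makes diamond_sum factor. *)
Definition diamond N : seq (int * int) :=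
  [seq (i + 1 + j, i + 1 - j) | i <- zr N, j <- zr N] ++
  [seq (i + j + 1, i - j) | i <- zr N, j <- zr N].

Lemma mem_square N v : (v \in square N) = (`|v.1| <= N)%N && (`|v.2| <= N)%N.
Proof.
case: v => m k /=; rewrite -!mem_zr; apply/allpairsP/andP => [ [ [a b] /= [ha hb [-> ->]]]|[hm hk]] //.
by exists (m, k).
Qed.

Lemma square_uniq N : uniq (square N).
Proof. by apply: allpairs_uniq => //; rewrite ?zr_uniq // => -[a b] [c d]. Qed.

Lemma diamond_uniq N : uniq (diamond N).
Proof.
rewrite cat_uniq; apply/and3P; split.
- apply: allpairs_uniq; rewrite ?zr_uniq // => -[a b] [c d] _ _ /= [e1 e2].
  by congr pair; lia.
- apply/hasPn => v hv; apply/negP => hw.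
  have /allpairsP[[a b] /= [_ _ e]] := hv.
  have /allpairsP[[c d] /= [_ _]] := hw.
  by rewrite e => -[]; lia.
- apply: allpairs_uniq; rewrite ?zr_uniq // => -[a b] [c d] _ _ /= [e1 e2].
  by congr pair; lia.
Qed.

Lemma square_diamond N v : v \in square N -> v \in diamond N.+1.
Proof.
case: v => m k; rewrite mem_square mem_cat => /andP[hm hk].
rewrite /= in hm hk.
have [e|o] : (exists i, m + k = 2 * i) \/ (exists i, m + k = 2 * i + 1).
  have := divz_eq (m + k) 2; have : ((m + k) %% 2)%Z = 0 \/ ((m + k) %% 2)%Z = 1 by lia.
  by case=> -> ->; [left|right]; exists ((m + k) %/ 2)%Z; lia.
- case: e => i e; apply/orP; left; apply/allpairsP; exists (i - 1, m - i).
  by split; rewrite /fst /snd ?mem_zr; [lia|lia|congr pair; lia].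
- case: o => i e; apply/orP; right; apply/allpairsP; exists (i, m - i - 1).
  by split; rewrite /fst /snd ?mem_zr; [lia|lia|congr pair; lia].
Qed.

End IntegerBoxes.

Section IntegerSums.
Variable V : zmodType.
Implicit Types F : int -> V.

Definition zsum K F := \sum_(0 <= i < K.*2.+1) F (i%:Z - K%:Z).

Lemma zsum_rec K F : zsum K.+1 F = F (- K.+1%:Z) + zsum K F + F K.+1%:Z.
Proof.
rewrite /zsum doubleS big_nat_recl // big_nat_recr //= addrA; congr (_ + _ + _).
- by rewrite sub0r.
- by apply: eq_big_nat => i _; congr F; lia.
- by congr F; lia.
Qed.

Lemma zsum_shift K F (d : int) : `|d|%N = 1%N ->
  (forall m : int, (K < `|m|)%N -> F m = 0) ->
  zsum K.+1 (fun m => F (m + d)) = zsum K F.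
Proof.
move=> d1 F0; rewrite /zsum doubleS.
have [->|->] : d = 1 \/ d = -1 by lia.
- rewrite big_nat_recr // big_nat_recr //= !F0 ?addr0; [|lia|lia].
  by apply: eq_big_nat => i _; congr F; lia.
- rewrite big_nat_recl // big_nat_recl //= !F0 ?add0r; [|lia|lia].
  by apply: eq_big_nat => i _; congr F; lia.
Qed.

Lemma zsum_widen K F : (forall m : int, (K < `|m|)%N -> F m = 0) ->
  zsum K.+1 F = zsum K F.
Proof. by move=> F0; rewrite zsum_rec !F0 ?addr0 ?add0r //; lia. Qed.

Lemma zsumE N F : zsum N F = \sum_(m <- zr N) F m.
Proof. by rewrite big_map /zsum /index_iota subn0. Qed.

End IntegerSums.

(** * The finite Jacobi triple product, and the two truncations of the double series *)

Section FiniteTripleProduct.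
Variables (K : fieldType) (p h : K).
Hypotheses (h0 : h != 0) (hh : h ^+ 2 = p).
Hypothesis pfac_neq0 : forall n, 1 - p ^+ n.+1 != 0.
Implicit Types (x y : K) (m k : int).

Let p0 : p != 0. Proof. by rewrite -hh expf_neq0. Qed.

(** This is (-1)^m p^(m (m - 1) / 2); the square root h of p avoids halving exponents. *)
Definition coef m : K := (-1) ^ m * h ^ (m * m - m).

Lemma nomeE m : p ^ m = h ^ (2 * m).
Proof. by rewrite -exprz_exp -hh. Qed.

Lemma coefS m : coef (m + 1) = - p ^ m * coef m.
Proof.
rewrite /coef nomeE expfzDr ?oppr_eq0 ?oner_eq0 // expr1z mulrN1 !mulNr; congr (- _).
by rewrite mulrCA -expfzDr //; congr (_ * _ ^ _); lia.
Qed.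

Lemma coefP m : coef (m - 1) = - p ^ (1 - m) * coef m.
Proof.
have e := coefS (m - 1); rewrite subrK in e.
rewrite e mulrA mulrNN -expfzDr // (_ : 1 - m + (m - 1) = 0) ?expr0z ?mul1r //.
by ring.
Qed.

Definition qfac n : K := \prod_(i < n) (1 - p ^+ i.+1).
Definition qfacV k : K :=
  if k is Posz n then \prod_(i < n) (1 - p ^+ i.+1)^-1 else 0.

(** At k = -1 the factor 1 - p^0 vanishes, so the recursion holds for all integers and [jacobi_rec]
    has no boundary cases. *)
Lemma qfacVS k : qfacV k = (1 - p ^ (k + 1)) * qfacV (k + 1).
Proof.
case: k => [n|[|n]].
- have -> : Posz n + 1 = Posz n.+1 by lia.
  by rewrite /= big_ord_recr /= mulrCA mulfV ?mulr1 // pfac_neq0.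
- by rewrite (_ : Negz 0 + 1 = 0) // expr0z subrr mul0r.
- by rewrite (_ : Negz n.+1 + 1 = Negz n) ?mulr0 //; lia.
Qed.

(* The finite Jacobi triple product: (p)_{2N} / ((p)_{N-m} (p)_{N+m}) is the
   q-binomial coefficient, and qfacV vanishes at negative arguments. *)
Definition jacobi N x m :=
  qfac N.*2 * qfacV (N%:Z - m) * qfacV (N%:Z + m) * coef m * x ^ m.

Lemma jacobi_eq0 N x m : (N < `|m|)%N -> jacobi N x m = 0.
Proof.
move=> Nm; rewrite /jacobi.
have [->|->] : qfacV (N%:Z - m) = 0 \/ qfacV (N%:Z + m) = 0.
- case: m Nm => n Nn; [left|right].
    by rewrite (_ : N%:Z - n%:Z = Negz (n - N).-1) //; lia.
  by rewrite (_ : N%:Z + Negz n = Negz (n - N)) //; lia.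
- by rewrite mulr0 !mul0r.
by rewrite mulr0 !mul0r.
Qed.

(** The terms of degree m after multiplication by the next factor of the product, (1 - p^N x) (1 -
    p^(N+1) / x) = 1 + p^(2N+1) - p^N x - p^(N+1) / x. *)
Lemma jacobi_rec N x m : x != 0 ->
  jacobi N.+1 x m = (1 + p ^+ N.*2.+1) * jacobi N x m -
    p ^+ N * x * jacobi N x (m - 1) - p ^+ N.+1 / x * jacobi N x (m + 1).
Proof.
move=> x0; rewrite /jacobi coefS coefP; set u := p ^ (1 - m).
rewrite !(expfzDr _ _ x0) expr1z exprN1.
(* Every [qfacV] involved is a polynomial in a, b, p times A or B, which turns the recursion into a
   polynomial identity. *)
pose A := qfacV (N.+1%:Z - m); pose B := qfacV (N.+1%:Z + m).
pose a := p ^ (N%:Z - m); pose b := p ^ (N%:Z + m).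
have Np : N.+1%:Z = N%:Z + 1 by lia.
have ep k : p ^ (k + 1) = p ^ k * p by rewrite expfzDr // expr1z.
have A1 : qfacV (N%:Z - m) = (1 - a * p) * A.
  by rewrite qfacVS ep /A Np; congr (_ * qfacV _); ring.
have B1 : qfacV (N%:Z + m) = (1 - b * p) * B.
  by rewrite qfacVS ep /B Np; congr (_ * qfacV _); ring.
have A2 : qfacV (N%:Z - (m + 1)) = (1 - a) * ((1 - a * p) * A).
  rewrite qfacVS -A1; congr ((1 - p ^ _) * qfacV _); ring.
have B2 : qfacV (N%:Z + (m - 1)) = (1 - b) * ((1 - b * p) * B).
  rewrite qfacVS -B1; congr ((1 - p ^ _) * qfacV _); ring.
have A3 : qfacV (N%:Z - (m - 1)) = A by rewrite /A Np; congr qfacV; ring.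
have B3 : qfacV (N%:Z + (m + 1)) = B by rewrite /B Np; congr qfacV; ring.
rewrite A1 B1 A2 B2 A3 B3 -/A -/B.
have pm : p ^+ N * u = a * p.
  by rewrite /u exprnP -expfzDr // -ep; congr (_ ^ _); ring.
have pm' : p ^+ N.+1 * p ^ m = b * p.
  by rewrite exprnP -expfzDr // -ep Np; congr (_ ^ _); ring.
have ab : p ^+ N.*2 = a * b.
  by rewrite exprnP -expfzDr //; congr (_ ^ _); lia.
rewrite doubleS /qfac !big_ord_recr /= -/(qfac _) !exprS ab.
rewrite -exprS; set P := qfac _.
transitivity ((1 + p * (a * b)) *
    (P * ((1 - a * p) * A) * ((1 - b * p) * B) * coef m * x ^ m) +
  p ^+ N * u * (P * A * ((1 - b) * ((1 - b * p) * B)) * coef m * x ^ m) +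
  p ^+ N.+1 * p ^ m * (P * ((1 - a) * ((1 - a * p) * A)) * B * coef m * x ^ m)).
  by rewrite pm pm'; ring.
by field.
Qed.

Lemma thetaP_jacobi N x : x != 0 ->
  \prod_(j < N) ((1 - p ^+ j * x) * (1 - p ^+ j.+1 / x)) = zsum N (jacobi N x).
Proof.
move=> x0; elim: N => [|N IH].
  rewrite big_ord0 /zsum big_nat1 (_ : 0%:Z - 0%:Z = 0) // /jacobi /coef /qfac /qfacV.
  by rewrite /= !big_ord0 !mul1r.
rewrite big_ord_recr /= IH; set S := zsum N _.
have supp := @jacobi_eq0 N x.
have SE : S = zsum N.+1 (jacobi N x) by rewrite zsum_widen.
have SP : S = zsum N.+1 (fun m => jacobi N x (m + 1)) by rewrite zsum_shift.
have SM : S = zsum N.+1 (fun m => jacobi N x (m - 1)) by rewrite zsum_shift.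
transitivity ((1 + p ^+ N.*2.+1) * S - p ^+ N * x * S - p ^+ N.+1 / x * S).
  by rewrite -addnn -addSn exprD; field.
rewrite {1}SE {1}SM {1}SP /zsum !big_distrr /= -!sumrB.
by apply: eq_bigr => i _; rewrite jacobi_rec.
Qed.

Lemma qfacK n : qfac n * qfacV n%:Z = 1.
Proof.
rewrite /qfac /= -big_split /= big1 // => i _.
by rewrite divff.
Qed.

Definition lser N x : K := \sum_(m <- zr N) coef m * x ^ m.

Definition dterm x y (v : int * int) : K :=
  coef v.1 * (x * y) ^ v.1 * (coef v.2 * (x / y) ^ v.2).

Lemma square_sum N x y :
  \sum_(v <- square N) dterm x y v = lser N (x * y) * lser N (x / y).
Proof.
by rewrite /square big_allpairs_dep /lser big_distrl /=; apply: eq_bigr => i _; rewrite big_distrr.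
Qed.

(** Truncations of the functions A and B of the addition formula, with the odd and the even powers
    of x respectively. *)
Definition evenA N x : K := \sum_(i <- zr N) p ^ (i * i + i) * x ^ (2 * i + 1).
Definition evenB N x : K := \sum_(i <- zr N) p ^ (i * i) * x ^ (2 * i).

(** For (m, k) with m + k = 2 (i + 1) and m - k = 2 j the sign is + and the power of p is p^(i^2 +
    i) p^(j^2), which separates i from j. For m + k = 2 i + 1 and m - k = 2 j + 1 the sign is - and
    A and B change places. *)
Lemma diamond_sum N x y : x != 0 -> y != 0 ->
  \sum_(v <- diamond N) dterm x y v =
  x * (evenA N x * evenB N y - evenB N x * evenA N y).
Proof.
move=> x0 y0; rewrite /diamond big_cat !big_allpairs_dep mulrBr.
have sgn m : (-1) ^ (2 * m) = 1 :> K.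
  rewrite -exprz_exp (_ : (-1) ^ 2 = 1) ?exp1rz //.
  by rewrite -[2 : int]/(Posz 2) -exprnP sqrrN expr1n.
have coefM i j : coef i * coef j = (-1) ^ (i + j) * h ^ (i * i - i + (j * j - j)).
  by rewrite /coef !expfzDr ?oppr_eq0 ?oner_eq0 //; ring.
have powE i j : (x * y) ^ i * (x / y) ^ j = x ^ (i + j) * y ^ (i - j).
  by rewrite !expfzMl !expfzDr // exprz_inv; ring.
have dE i j : dterm x y (i, j) =
    (-1) ^ (i + j) * h ^ (i * i - i + (j * j - j)) * (x ^ (i + j) * y ^ (i - j)).
  by rewrite -coefM -powE /dterm /=; ring.
congr (_ + _).
  rewrite /evenA /evenB big_distrl big_distrr /=; apply: eq_bigr => i _.
  rewrite !big_distrr /=; apply: eq_bigr => j _; rewrite dE.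
  rewrite (_ : i + 1 + j + (i + 1 - j) = 2 * (i + 1)); last by lia.
  rewrite (_ : i + 1 + j - (i + 1 - j) = 2 * j); last by lia.
  rewrite sgn !nomeE (_ : _ + _ = 2 * (i * i + i) + 2 * (j * j)); last by lia.
  rewrite (_ : 2 * (i + 1) = 2 * i + 1 + 1); last by lia.
  by rewrite [h ^ _]expfzDr // [x ^ (_ + 1)]expfzDr // expr1z; ring.
rewrite -mulrN -mulNr /evenA /evenB -sumrN mulr_suml mulr_sumr /=; apply: eq_bigr => i _.
rewrite !mulr_sumr /=; apply: eq_bigr => j _; rewrite dE.
rewrite (_ : i + j + 1 + (i - j) = 2 * i + 1); last by lia.
rewrite (_ : i + j + 1 - (i - j) = 2 * j + 1); last by lia.
rewrite (expfzDr (2 * i) 1) ?oppr_eq0 ?oner_eq0 // sgn expr1z !nomeE.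
rewrite (_ : _ + _ = 2 * (i * i) + 2 * (j * j + j)); last by lia.
by rewrite [h ^ _]expfzDr // [x ^ (_ + 1)]expfzDr // expr1z; ring.
Qed.

End FiniteTripleProduct.

(** * Passage to the limit: the Plücker relation for theta *)

Section Addition.
Variable R : realType.
Local Notation C := R[i].
Local Notation nm := (@Normc.normc R).
Variables (p h : C).
Hypotheses (hp : `|p| < 1) (h0 : h != 0) (hh : h ^+ 2 = p).
Local Notation r := (nm p).
Local Notation w := (nm h).
Implicit Types (x y : C) (m : int).

Lemma pfac_neq0 n : 1 - p ^+ n.+1 != 0.
Proof.
have /andP[r0 r1] := nmp01 hp; rewrite subr_eq0; apply/eqP => e.
have := congr1 nm e; rewrite nm1 nmX => /eqP; rewrite eq_sym lt_eqF //.
by rewrite exprn_ilt1.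
Qed.

Lemma nome_w : r = w ^+ 2. Proof. by rewrite -hh nmX. Qed.

Lemma w_gt0 : 0 < w. Proof. by rewrite nm_gt0. Qed.

Lemma w_lt1 : w < 1.
Proof.
have /andP[_] := nmp01 hp; rewrite nome_w => r1.
by rewrite -(@expr_lt1 _ 2) ?nm_ge0.
Qed.

Lemma w01 : 0 <= w < 1. Proof. by rewrite nm_ge0 w_lt1. Qed.

(** L is the inverse of the infinite product of the 1 - p^(n+1); one constant B serves all the
    bounds. *)
Lemma qfacV_rate : exists L : C, exists B : R,
  [/\ L != 0, 0 <= B, forall n : nat, nm (qfacV p n - L) <= B * r ^+ n,
    forall n : nat, nm (qfacV p n) <= B & forall n, nm (qfac p n) <= B].
Proof.
have r01 := nmp01 hp; have /andP[r0 r1] := r01.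
have r2 : 0 < 1 - r by rewrite subr_gt0.
have h1 n : nm ((1 - p ^+ n.+1) - 1) <= 1 * r ^+ n.
  by rewrite addrAC subrr add0r nmN nmX mul1r exprS ler_piMl ?exprn_ge0 // ltW.
have h2 n : nm ((1 - p ^+ n.+1)^-1 - 1) <= (1 - r)^-1 * r ^+ n.
  have pf := pfac_neq0 n.
  have -> : (1 - p ^+ n.+1)^-1 - 1 = p ^+ n.+1 / (1 - p ^+ n.+1) by field.
  rewrite nmM nmV nmX mulrC; apply: ler_pM; rewrite ?invr_ge0 ?nm_ge0 ?exprn_ge0 //.
    rewrite lef_pV2 ?posrE ?nm_gt0 //.
    have := nmD (1 - p ^+ n.+1) (p ^+ n.+1); rewrite subrK nm1 nmX (exprS r) => t.
    have : r * r ^+ n <= r by rewrite ler_piMr // exprn_ile1 // ltW.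
    by move: t; lra.
  by rewrite exprS ler_piMl ?exprn_ge0 // ltW.
have i0 : 0 <= (1 - r)^-1 by rewrite invr_ge0 ltW.
have [L hL] := prod_cvg i0 r01 h2.
have b1 := prod_bounded ler01 r01 h1; have b2 := prod_bounded i0 r01 h2.
set B1 := expR _ in b1; set B2 := expR _ in b2 hL.
set B3 := _ / _ in hL; have B30 : 0 <= B3.
  by rewrite !mulr_ge0 ?invr_ge0 ?expR_ge0 // ltW.
exists L, (B1 + B2 + B3); split.
- apply: (prod_neq0 i0 r01 h2) => [n|]; first by rewrite invr_eq0 pfac_neq0.
  by apply: (tendsto_geometric r01) => n; rewrite nm_dist; apply: hL.
- by rewrite !addr_ge0 ?expR_ge0.
- move=> n; rewrite nm_dist; apply: le_trans (hL n) _.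
  by rewrite ler_wpM2r ?exprn_ge0 // lerDr addr_ge0 ?expR_ge0.
- move=> n; apply: le_trans (b2 n) _.
  by rewrite -addrA addrCA lerDl addr_ge0 ?expR_ge0.
- move=> n; apply: le_trans (b1 n) _.
  by rewrite -addrA lerDl addr_ge0 ?expR_ge0.
Qed.

(** The product is (D w^(k-1))^k, and D w^(k-1) is below 1 for large k. *)
Lemma quad_bound (D : R) : 1 <= D ->
  exists2 K : R, 0 <= K & forall k, w ^+ (k * k.-1) * D ^+ k <= K.
Proof.
move=> D1; have D0 : 0 <= D by apply: le_trans D1.
have [N hN] := geometric_lt D w01 ltr01.
have wk n : w ^+ n <= 1 by rewrite exprn_ile1 ?nm_ge0 // ltW // w_lt1.
exists (D ^+ N); first by rewrite exprn_ge0.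
move=> k; have [kN|Nk] := leqP k N.
  apply: le_trans (_ : D ^+ k <= _); last by rewrite ler_weXn2l.
  by rewrite ler_piMl ?exprn_ge0.
rewrite mulnC exprM -exprMn mulrC; apply: le_trans (_ : 1 <= _); last by rewrite exprn_ege1.
rewrite exprn_ile1 ?mulr_ge0 ?exprn_ge0 ?nm_ge0 //; apply/ltW/hN.
by case: k Nk.
Qed.

Lemma nmXz x m : nm (x ^ m) = nm x ^ m.
Proof. by case: m => n; [exact: nmX | rewrite /exprz nmV nmX]. Qed.

(** The quadratic exponent of [coef] beats every geometric rate; rho is left free because two
    different rates are needed below. *)
Lemma coef_bound x (rho : R) : x != 0 -> 0 < rho ->
  exists2 K : R, 0 <= K & forall m, nm (coef h m * x ^ m) <= K * rho ^+ `|m|%N.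
Proof.
move=> x0 rho0; pose X := nm x + nm x^-1 + 1.
have X0 : 0 < X by rewrite ltr_wpDl ?addr_ge0 ?nm_ge0.
pose D := X / rho + 1; have D1 : 1 <= D by rewrite lerDr divr_ge0 // ltW.
have [K K0 hK] := quad_bound D1; exists K => // m.
have hx : nm (x ^ m) <= X ^+ `|m|%N.
  rewrite nmXz /X; case: m => n /=.
    by rewrite lerXn2r ?nnegrE ?addr_ge0 ?nm_ge0 // -addrA lerDl addr_ge0 ?nm_ge0.
  rewrite /exprz -exprVn -nmV lerXn2r ?nnegrE ?addr_ge0 ?nm_ge0 //.
  by rewrite addrAC lerDr addr_ge0 ?nm_ge0.
have hc : nm (coef h m) <= w ^+ (absz m * (absz m).-1).
  rewrite /coef nmM !nmXz nmN nm1 exp1rz mul1r.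
  have -> : m * m - m = Posz (absz (m * m - m)%R) by clear; nia.
  rewrite -exprnP ler_wiXn2l ?nm_ge0 // ?(ltW w_lt1) //.
  by clear; nia.
set k := `|m|%N in hx hc *; rewrite nmM; apply: le_trans (ler_pM (nm_ge0 _) (nm_ge0 _) hc hx) _.
have hX : X ^+ k <= D ^+ k * rho ^+ k.
  rewrite -exprMn lerXn2r ?nnegrE ?(ltW X0) // ?mulr_ge0 ?(ltW rho0) ?(le_trans ler01) //.
  by rewrite mulrDl mul1r divfK ?gt_eqF // lerDl ltW.
apply: le_trans (ler_wpM2l _ hX) _; first by rewrite exprn_ge0 ?nm_ge0.
by rewrite mulrA ler_wpM2r // exprn_ge0 // ltW.
Qed.

(** Bernoulli's inequality for w^-1 = 1 + t. It absorbs the number of terms of a truncated sum into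
    the geometric decay. *)
Lemma linear_geometric : exists2 K : R, 0 <= K & forall n, n.*2.+1%:R * w ^+ n <= K.
Proof.
have w1 := w_lt1; have w0 := w_gt0; pose t := w^-1 - 1.
have t0 : 0 < t by rewrite subr_gt0 invf_gt1.
have bern n : w ^+ n * (1 + n%:R * t) <= 1.
  elim: n => [|n IH]; first by rewrite mul0r addr0 mulr1 expr0.
  apply: le_trans IH; rewrite exprSr -mulrA ler_wpM2l ?exprn_ge0 ?(ltW w0) //.
  have -> : w * (1 + n.+1%:R * t) = w * (1 + t) + n%:R * t * w.
    by rewrite -[n.+1]addn1 natrD; ring.
  have -> : w * (1 + t) = 1 by rewrite /t addrC subrK mulfV ?gt_eqF.
  by rewrite lerD2l ler_piMr ?mulr_ge0 ?ler0n // ltW.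
exists (2%:R / t + 1); first by rewrite addr_ge0 // divr_ge0 // ltW.
move=> n; rewrite -[n.*2.+1]addn1 natrD mulrDl mul1r; apply: lerD; last first.
  by rewrite exprn_ile1 // ltW.
rewrite -muln2 natrM ler_pdivlMr //; have := bern n.
have e1 : 0 <= w ^+ n by rewrite exprn_ge0 // ltW.
by move: e1; set W := w ^+ n; set nn : R := n%:R; lra.
Qed.

Lemma sum_le_size (I : eqType) (s : seq I) (F : I -> R) (c : R) :
  (forall i, i \in s -> F i <= c) -> \sum_(i <- s) F i <= (size s)%:R * c.
Proof.
elim: s => [|i s IH] H; first by rewrite big_nil mul0r.
rewrite big_cons /= -add1n natrD mulrDl mul1r; apply: lerD.
  by apply: H; rewrite inE eqxx.
by apply: IH => j js; apply: H; rewrite inE js orbT.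
Qed.

(** Jacobi's triple product: in its finite form, the two factors [qfacV] in each term are replaced
    by their limit L, at the cost of an error d N that tends to 0. *)
Lemma lser_tendsto : exists2 c : C, c != 0 & forall x, x != 0 ->
  tendsto (fun N => lser h N x) (theta p x * c).
Proof.
have [L [B [L0 B0 hL hB hP]]] := qfacV_rate.
exists L^-1; first by rewrite invr_eq0.
move=> x x0; have r0 : 0 < r by rewrite nm_gt0 -hh expf_neq0.
have /andP[_ r1] := nmp01 hp.
(* The rate rho = r offsets the loss in r^(N - |m|), the rate at which the [qfacV] factors approach
   L; each term of d N is then O(r^N). *)
have [K K0 hK] := coef_bound x0 r0.
have [K' K'0 hK'] := linear_geometric.
pose d N := thetaP p N x - qfac p N.*2 * L ^+ 2 * lser h N x.
have dE N : d N = \sum_(m <- zr N) qfac p N.*2 *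
    (qfacV p (N%:Z - m) * qfacV p (N%:Z + m) - L ^+ 2) * (coef h m * x ^ m).
  rewrite /d /thetaP (thetaP_jacobi h0 hh pfac_neq0) // zsumE /lser mulr_sumr -sumrB.
  by apply: eq_bigr => m _; rewrite /jacobi; ring.
have term N m : m \in zr N -> nm (qfac p N.*2 *
    (qfacV p (N%:Z - m) * qfacV p (N%:Z + m) - L ^+ 2) * (coef h m * x ^ m)) <=
    B * (B * (B + nm L)) * K * r ^+ N.
  rewrite mem_zr => mN.
  have [a ea aN] := subz_absz mN.
  have [b eb bN] : exists2 b : nat, N%:Z + m = b%:Z & (N - `|m| <= b)%N.
    by rewrite -abszN in mN *; rewrite -[m in N%:Z + m]opprK; exact: subz_absz.
  rewrite ea eb.
  have e : qfacV p a * qfacV p b - L ^+ 2 =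
      (qfacV p a - L) * qfacV p b + L * (qfacV p b - L) by ring.
  have rk j : (N - `|m| <= j)%N -> r ^+ j <= r ^+ (N - `|m|).
    by move=> ?; rewrite ler_wiXn2l ?nm_ge0 // ltW.
  have hh1 : nm (qfacV p a * qfacV p b - L ^+ 2) <= B * (B + nm L) * r ^+ (N - `|m|).
    rewrite e; apply: le_trans (nmD _ _) _; rewrite !nmM.
    have g1 : nm (qfacV p a - L) * nm (qfacV p b) <= B * r ^+ (N - `|m|) * B.
      apply: ler_pM; rewrite ?nm_ge0 //; apply: le_trans (hL a) _.
      by rewrite ler_wpM2l ?rk.
    have g2 : nm L * nm (qfacV p b - L) <= nm L * (B * r ^+ (N - `|m|)).
      rewrite ler_wpM2l ?nm_ge0 //; apply: le_trans (hL b) _.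
      by rewrite ler_wpM2l ?rk.
    by apply: le_trans (lerD g1 g2) _; rewrite le_eqVlt; apply/orP; left; apply/eqP; ring.
  rewrite nmM [nm (qfac p _ * _)]nmM.
  have g3 : nm (qfac p N.*2) * nm (qfacV p a * qfacV p b - L ^+ 2) <=
      B * (B * (B + nm L) * r ^+ (N - `|m|)) by rewrite ler_pM ?nm_ge0.
  apply: le_trans (ler_pM _ (nm_ge0 _) g3 (hK m)) _; first by rewrite mulr_ge0 ?nm_ge0.
  have -> : r ^+ N = r ^+ (N - `|m|) * r ^+ `|m|%N by rewrite -exprD subnK.
  by rewrite le_eqVlt; apply/orP; left; apply/eqP; ring.
set K2 := B * (B * (B + nm L)) * K in term.
have K20 : 0 <= K2 by rewrite !mulr_ge0 ?addr_ge0 ?nm_ge0.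
have d0 : tendsto d 0.
  apply: (tendsto_geometric w01 (A := K' * K2)) => N; rewrite subr0 dE.
  apply: le_trans (nm_sum _ _ _) _; apply: le_trans (sum_le_size (@term N)) _.
  have -> : r ^+ N = w ^+ N * w ^+ N by rewrite nome_w -exprM mul2n -addnn exprD.
  rewrite size_zr; set W := w ^+ N.
  have W0 : 0 <= W by rewrite exprn_ge0 ?nm_ge0.
  have := ler_wpM2r (mulr_ge0 K20 W0) (hK' N); rewrite -/W.
  by move=> H; apply: le_trans (le_trans _ H) _; rewrite le_eqVlt; apply/orP; left; apply/eqP; ring.
have qfacV_t : tendsto (fun N => qfacV p N.*2%N) L.
  apply: (tendsto_geometric (nmp01 hp) (A := B)) => N; apply: le_trans (hL _) _.
  by rewrite ler_wpM2l // ler_wiXn2l ?nm_ge0 // ?(ltW r1) // -addnn leq_addr.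
(* [thetaP] - d is the truncated series times qfac (2N) L^2, a factor removed by qfacV (2N) / L^2
   ([qfacK]). *)
have := tendstoM (tendstoB (theta_tendsto hp x) d0) (tendstoZ (L ^- 2) qfacV_t).
rewrite subr0 (_ : L ^- 2 * L = L^-1); last by field.
apply: (@tendsto_eq _ _ _ _ 0) => N _; have := qfacK pfac_neq0 N.*2.
rewrite /d; set P := qfac _ _; set Q := qfacV _ _ => PQ.
rewrite [LHS](_ : _ = P * Q * lser h N x); last by field.
by rewrite PQ mul1r.
Qed.


(** The Plücker relation for the minors of a 2 x 4 matrix. *)
Lemma rank2_plucker (K : comNzRingType) (a1 b1 a2 b2 a3 b3 a4 b4 : K) :
  (a1 * b2 - b1 * a2) * (a3 * b4 - b3 * a4) -
  (a1 * b3 - b1 * a3) * (a2 * b4 - b2 * a4) +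
  (a1 * b4 - b1 * a4) * (a2 * b3 - b2 * a3) = 0.
Proof. by ring. Qed.

(** Outside the square one of the two indices exceeds N, so a term is O(w^(3N)). Two of the three
    factors w^N absorb the quadratic number of terms, and the third tends to 0. *)
Lemma diamond_square_tendsto x y : x != 0 -> y != 0 ->
  tendsto (fun N => \sum_(v <- diamond N.+1) dterm h x y v -
    \sum_(v <- square N) dterm h x y v) 0.
Proof.
move=> x0 y0; have w0 := w_gt0; have w1 := w_lt1.
have w3 : 0 < w ^+ 3 by rewrite exprn_gt0.
have [K1 K10 hK1] := coef_bound (mulf_neq0 x0 y0) w3.
have xy0 : x / y != 0 by rewrite mulf_neq0 ?invr_eq0.
have [K2 K20 hK2] := coef_bound xy0 w3.
have [K K0 hK] := linear_geometric.
apply: (tendsto_geometric w01 (A := 2%:R * (K / w) ^+ 2 * (K1 * K2))) => N.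
have -> : \sum_(v <- square N) dterm h x y v =
    \sum_(v <- diamond N.+1 | v \in square N) dterm h x y v.
  rewrite -[RHS]big_filter; apply: perm_big; apply: uniq_perm.
  - exact: square_uniq.
  - by rewrite filter_uniq ?diamond_uniq.
  move=> v; rewrite mem_filter; case: (boolP (v \in square N)) => //= vs.
  by rewrite square_diamond.
rewrite subr0 (bigID (fun v => v \in square N)) /= addrAC subrr add0r.
rewrite -big_filter; apply: le_trans (nm_sum _ _ _) _.
have wk i j : (i <= j)%N -> (w ^+ 3) ^+ j <= (w ^+ 3) ^+ i.
  by move=> ij; rewrite ler_wiXn2l ?exprn_ge0 ?exprn_ile1 // ltW.
have wp i : 0 <= (w ^+ 3) ^+ i by rewrite !exprn_ge0 // ltW.
have term v : v \in [seq v <- diamond N.+1 | v \notin square N] ->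
    nm (dterm h x y v) <= K1 * K2 * (w ^+ 3) ^+ N.
  rewrite mem_filter mem_square negb_and -!ltnNge => /andP[hv _].
  rewrite /dterm nmM; apply: le_trans (ler_pM (nm_ge0 _) (nm_ge0 _) (hK1 v.1) (hK2 v.2)) _.
  rewrite mulrACA -exprD ler_wpM2l ?mulr_ge0 // wk //.
  by move: hv => /orP[]; case: v => a b /=; clear; lia.
apply: le_trans (sum_le_size term) _.
apply: le_trans (_ : (size (diamond N.+1))%:R * (K1 * K2 * (w ^+ 3) ^+ N) <= _).
  rewrite ler_wpM2r ?mulr_ge0 // ler_nat size_filter.
  exact: count_size.
rewrite size_cat !size_allpairs !size_zr addnn -mul2n !natrM.
set S := N.+1.*2.+1%:R; have SK : S * w ^+ N <= K / w.
  by rewrite ler_pdivlMr // -mulrA -exprSr; exact: hK.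
have W0 : 0 <= w ^+ N by rewrite exprn_ge0 // ltW.
have S0 : 0 <= S by rewrite ler0n.
have -> : (w ^+ 3) ^+ N = w ^+ N * w ^+ N * w ^+ N by rewrite exprAC !exprS expr0 mulr1 mulrA.
have SS : (S * w ^+ N) * (S * w ^+ N) <= K / w * (K / w).
  by apply: ler_pM => //; rewrite mulr_ge0.
have KK : 0 <= 2%:R * (K1 * K2) * w ^+ N by rewrite !mulr_ge0.
apply: le_trans (le_trans _ (ler_wpM2l KK SS)) _.
  by rewrite le_eqVlt; apply/orP; left; apply/eqP; ring.
by rewrite le_eqVlt; apply/orP; left; apply/eqP; ring.
Qed.

Lemma theta_rank2 : exists2 c : C, c != 0 & forall x y, x != 0 -> y != 0 ->
  tendsto (fun N => evenA p N.+1 x * evenB p N.+1 y - evenB p N.+1 x * evenA p N.+1 y)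
    (c * (x^-1 * theta p (x * y) * theta p (x / y))).
Proof.
have [c c0 hc] := lser_tendsto.
exists (c ^+ 2) => [|x y x0 y0]; first by rewrite expf_neq0.
have xy0 : x / y != 0 by rewrite mulf_neq0 ?invr_eq0.
have lim := tendstoD (tendstoM (hc _ (mulf_neq0 x0 y0)) (hc _ xy0))
  (diamond_square_tendsto x0 y0).
have := tendstoZ x^-1 lim.
rewrite [X in tendsto _ X -> _](_ : _ = c ^+ 2 * (x^-1 * theta p (x * y) * theta p (x / y))); last by ring.
apply: (@tendsto_eq _ _ _ _ 0) => N _.
by rewrite (diamond_sum h0 hh) // square_sum addrC subrK mulKf.
Qed.

Lemma theta_plucker_nome (x y u v : C) : x != 0 -> y != 0 -> u != 0 -> v != 0 ->
  let F := fun x y => x^-1 * theta p (x * y) * theta p (x / y) in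
  F x y * F u v - F x u * F y v + F x v * F y u = 0.
Proof.
move=> x0 y0 u0 v0 F; have [c c0 lim] := theta_rank2.
have t a b a' b' : a != 0 -> b != 0 -> a' != 0 -> b' != 0 ->
    tendsto (fun N =>
      (evenA p N.+1 a * evenB p N.+1 b - evenB p N.+1 a * evenA p N.+1 b) *
      (evenA p N.+1 a' * evenB p N.+1 b' - evenB p N.+1 a' * evenA p N.+1 b'))
      ((c * F a b) * (c * F a' b')).
  by move=> ? ? ? ?; apply: tendstoM; exact: lim.
have cc : c ^+ 2 != 0 by rewrite expf_neq0.
apply: (mulfI cc); rewrite mulr0.
apply: tendsto_unique (tendsto_cst 0).
have := tendstoD (tendstoB (t x y u v x0 y0 u0 v0) (t x u y v x0 u0 y0 v0))
  (t x v y u x0 v0 y0 u0).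
rewrite [X in tendsto _ X -> _](_ : _ = c ^+ 2 * (F x y * F u v - F x u * F y v + F x v * F y u)); last by ring.
by apply: (@tendsto_eq _ _ _ _ 0) => N _; exact: rank2_plucker.
Qed.

End Addition.

(** The case p = 0 is separate because the series contain negative powers of h; there theta is 1 - x
    and the relation is rational. *)
Lemma theta_plucker (R : realType) (p : R[i]) (hp : `|p| < 1) (x y u v : R[i]) :
  x != 0 -> y != 0 -> u != 0 -> v != 0 ->
  let F := fun x y => x^-1 * theta p (x * y) * theta p (x / y) in
  F x y * F u v - F x u * F y v + F x v * F y u = 0.
Proof.
have [p0|p0] := eqVneq p 0; last first.
  have hh : sqrtc p ^+ 2 = p by exact: sqr_sqrtc.
  have h0 : sqrtc p != 0 by apply: contraNneq p0 => h0; rewrite -hh h0 expr0n.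
  exact: (@theta_plucker_nome R p (sqrtc p)).
move=> x0 y0 u0 v0 F; have th z : theta p z = 1 - z.
  apply: tendsto_unique (theta_tendsto hp z) _.
  apply: (@tendsto_eq _ (fun=> 1 - z) _ _ 1) (tendsto_cst _) => -[//|n] _.
  rewrite /thetaP big_ord_recl big1 => [|j _].
    by rewrite p0 /= !expr0n /= mul1r mul0r subr0 !mulr1.
  by rewrite p0 /= !expr0n /= !mul0r !subr0 mulr1.
by rewrite /F !th; field; rewrite x0 y0 u0 v0.
Qed.

(** * From sigma to theta *)

Section Conversion.
Variables (K : fieldType) (th : K -> K) (n : nat).
Implicit Types (x : K) (m y : {ffun 'I_n -> nat}) (z : 'I_n -> K).

Definition sgm x := x^-1 * th (x ^+ 2).

Lemma th_sgm x : x != 0 -> th (x ^+ 2) = x * sgm x.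
Proof. by move=> x0; rewrite /sgm mulrA divff ?mul1r. Qed.

Hypothesis sgmV : forall x, sgm x^-1 = - sgm x.

Variable q : K.
Hypothesis q0 : q != 0.
Local Notation poch := (poch sgm q).

Definition ep x k := \prod_(i < k) th (x * (q ^+ 2) ^+ i).
Definition vdm z := \prod_(j < n) \prod_(k < n | (j < k)%N) (z j * th (z k / z j)).

Lemma sqq k : (q ^+ 2) ^+ k = (q ^+ k) ^+ 2.
Proof. exact: exprAC. Qed.

Lemma ep_poch x k : x != 0 ->
  ep (x ^+ 2) k = x ^+ k * (\prod_(i < k) q ^+ i) * poch x k.
Proof.
move=> x0; have -> : x ^+ k = \prod_(i < k) x by rewrite prodr_const card_ord.
rewrite -!big_split; apply: eq_bigr => i _; rewrite [RHS]/=.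
by rewrite sqq -exprMn th_sgm // mulf_neq0 ?expf_neq0.
Qed.

Lemma ep_ratio (x y : K) k : x != 0 -> y != 0 ->
  ep (x ^+ 2) k / ep (y ^+ 2) k = (x / y) ^+ k * (poch x k / poch y k).
Proof.
move=> x0 y0; rewrite !ep_poch //; set P := \prod_(i < k) _.
have P0 : P != 0 by apply/prodf_neq0 => i _; rewrite expf_neq0.
rewrite expr_div_n !invfM; transitivity (x ^+ k / y ^+ k * (P / P) * (poch x k / poch y k)).
  by ring.
by rewrite divff // mulr1.
Qed.

Lemma prod_pairs (G : 'I_n -> 'I_n -> K) :
  \prod_j \prod_k G j k =
  \prod_k G k k * \prod_(j < n) \prod_(k < n | (j < k)%N) (G j k * G k j).
Proof.
transitivity (\prod_(j < n) (G j j * (\prod_(k < n | (j < k)%N) G j k *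
    \prod_(k < n | (k < j)%N) G j k))).
  apply: eq_bigr => j _; rewrite (bigD1 j) //=; congr (_ * _).
  rewrite (bigID (fun k : 'I_n => (j < k)%N)) /=; congr (_ * _); apply: eq_bigl => k.
    by rewrite -val_eqE /=; lia.
  by rewrite -val_eqE /=; lia.
rewrite !big_split /=; congr (_ * _).
under [in RHS]eq_bigr do rewrite big_split /=.
rewrite big_split /=; congr (_ * _).
by rewrite (exchange_big_dep xpredT).
Qed.

(** After reversing the products of length i, both sides are (-1)^i [poch (u / q ^+ i) (k + 1 + i)],
    split differently. *)
Lemma pair_vandermonde (u : K) i k : u != 0 ->
  sgm (u * q ^+ k / q ^+ i) * poch (u / q ^+ i) k * poch (u^-1 / q ^+ k) i =
  sgm u * poch (q * u) k * poch (q / u) i.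
Proof.
move=> u0; have qn j : q ^+ j != 0 by rewrite expf_neq0.
pose v := u / q ^+ i.
rewrite (@poch_rev _ _ sgmV _ q0 (u^-1 / q ^+ k) (v * q ^+ (1 + k)) i); last first.
  by rewrite /v exprD expr1; field; rewrite u0 !qn.
rewrite (@poch_rev _ _ sgmV _ q0 (q / u) v i); last by rewrite /v; field; rewrite u0 !qn.
rewrite -/v; set S := (-1) ^+ i.
have e1 : sgm (u * q ^+ k / q ^+ i) * poch v k * poch (v * q ^+ (1 + k)) i =
    poch v (k + 1 + i).
  rewrite !pochD poch1 (_ : v * q ^+ k = u * q ^+ k / q ^+ i) ?(addnC k) //; last by rewrite /v; ring.
  by rewrite (mulrC (poch v k)).
have e2 : sgm u * poch (q * u) k * poch v i = poch v (i + 1 + k).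
  rewrite !pochD poch1 (_ : v * q ^+ i = u); last by rewrite /v; field; rewrite qn.
  rewrite (_ : v * q ^+ (i + 1) = q * u) ?[_ * sgm u]mulrC; first by ring.
  by rewrite /v exprD expr1; field; rewrite qn.
transitivity (S * poch v (k + 1 + i)); first by rewrite -e1; ring.
by rewrite (_ : k + 1 + i = i + 1 + k)%N; [rewrite -e2; ring|lia].
Qed.

(** The diagonal j = k gives the sign, by reversal; each pair j < k, taken together with (k, j), is
    an instance of [pair_vandermonde]. *)
Lemma vandermonde_poch z y : (forall k, z k != 0) ->
  (forall j k : 'I_n, (j < k)%N -> sgm (z k / z j) != 0) ->
  (\prod_(j < n) \prod_(k < n | (j < k)%N)
    (sgm (z k * q ^+ y k / (z j * q ^+ y j)) / sgm (z k / z j))) *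
  \prod_j \prod_k poch (z k / (z j * q ^+ y j)) (y k) =
  (-1) ^+ wt y * \prod_j \prod_k poch (q * z k / z j) (y k).
Proof.
move=> z0 sz; have qn j : q ^+ j != 0 by rewrite expf_neq0.
rewrite (prod_pairs (fun j k => poch (z k / (z j * q ^+ y j)) (y k))).
rewrite (prod_pairs (fun j k => poch (q * z k / z j) (y k))).
rewrite mulrCA [RHS]mulrA; congr (_ * _).
  rewrite /wt -prodrXr -big_split /=; apply: eq_bigr => k _.
  by apply: (poch_rev sgmV q0); field; rewrite z0 qn.
rewrite -big_split; apply: eq_bigr => j _; rewrite -big_split; apply: eq_bigr => k jk /=.
have u0 : z k / z j != 0 by rewrite mulf_neq0 ?invr_eq0.
have := pair_vandermonde (y j) (y k) u0.
have -> : z k / z j * q ^+ y k / q ^+ y j = z k * q ^+ y k / (z j * q ^+ y j).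
  by field; rewrite z0 qn.
have -> : z k / z j / q ^+ y j = z k / (z j * q ^+ y j) by field; rewrite z0 qn.
have -> : (z k / z j)^-1 / q ^+ y k = z j / (z k * q ^+ y k) by field; rewrite !z0 qn.
have -> : q * (z k / z j) = q * z k / z j by rewrite mulrA.
have -> : q / (z k / z j) = q * z j / z k by field; rewrite !z0.
move=> e; apply: (mulfI (sz _ _ jk)); rewrite [RHS]mulrA -e.
by field; exact: sz.
Qed.

Definition eterm a b c d e f g (m : 'I_n -> nat) z (y : 'I_n -> nat) (s : nat) :=
  vdm (fun k => z k * (q ^+ 2) ^+ y k) / vdm z
  * (\prod_k (th (a * z k * (q ^+ 2) ^+ (y k + s)) / th (a * z k)))
  * (ep b s * ep c s * ep d s /
     (ep (a * q ^+ 2 / e) s * ep (a * q ^+ 2 / f) s * ep (a * q ^+ 2 / g) s))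
  * (\prod_j (ep (a * z j) s / ep (a * (q ^+ 2) ^+ (1 + m j) * z j) s))
  * (q ^+ 2) ^+ s
  * (\prod_k (ep (e * z k) (y k) * ep (f * z k) (y k) * ep (g * z k) (y k) /
       (ep (a * q ^+ 2 * z k / b) (y k) * ep (a * q ^+ 2 * z k / c) (y k) *
        ep (a * q ^+ 2 * z k / d) (y k))))
  * (\prod_j \prod_k (ep ((q ^+ 2) ^- m j * z k / z j) (y k) /
       ep (q ^+ 2 * z k / z j) (y k))).

Lemma vdm_sq z : (forall k, z k != 0) ->
  vdm (fun k => z k ^+ 2) =
  \prod_(j < n) \prod_(k < n | (j < k)%N) (z j * z k * sgm (z k / z j)).
Proof.
move=> z0; apply: eq_bigr => j _; apply: eq_bigr => k _.
rewrite -expr_div_n th_sgm ?mulf_neq0 ?invr_eq0 //.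
by field.
Qed.

(* All the powers of q coming from theta (x ^+ 2) = x * sgm x cancel because of
   the balancing condition. *)
Lemma eterm_bterm a b c d e f g m z y :
  a != 0 -> b != 0 -> c != 0 -> d != 0 -> e != 0 -> f != 0 -> g != 0 ->
  (forall k, z k != 0) -> nodes_sep sgm q m z -> mle y m ->
  (forall j k, poch (q * z k / z j) (y k) != 0) ->
  a ^+ 3 * q ^+ (2 + wt m) = b * c * d * e * f * g ->
  eterm (a ^+ 2) (b ^+ 2) (c ^+ 2) (d ^+ 2) (e ^+ 2) (f ^+ 2) (g ^+ 2) m
    (fun k => z k ^+ 2) y (wt y) =
  bterm sgm q a b c d e f g m z y.
Proof.
move=> a0 b0 c0 d0 e0 f0 g0 z0 sep ym qz bal.
have qn j : q ^+ j != 0 by rewrite expf_neq0.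
(* The monomials split off in F1 to F7 are products of powers of S and T, and multiply to 1. *)
set s := wt y; set M := wt m; pose S := q ^+ s; pose T := (q ^+ M) ^+ s.
have S0 : S != 0 by exact: qn.
have T0 : T != 0 by rewrite expf_neq0.
have sz (j k : 'I_n) : (j < k)%N -> sgm (z k / z j) != 0.
  move=> jk; have := sep j k 0%N 0%N (leq0n _) (leq0n _).
  by rewrite !expr0 !mulr1; apply; apply/eqP => -[kj]; rewrite kj ltnn in jk.
have Sy : \prod_k q ^+ y k = S by rewrite prodrXr.
pose V := \prod_(j < n) \prod_(k < n | (j < k)%N)
    (sgm (z k * q ^+ y k / (z j * q ^+ y j)) / sgm (z k / z j)).
have F1 : vdm (fun k => z k ^+ 2 * (q ^+ 2) ^+ y k) / vdm (fun k => z k ^+ 2) =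
    S ^+ n / S * V.
  have -> : vdm (fun k => z k ^+ 2 * (q ^+ 2) ^+ y k) = vdm (fun k => (z k * q ^+ y k) ^+ 2).
    apply: eq_bigr => j _; apply: eq_bigr => k _; cbv beta.
    by rewrite !sqq -!exprMn.
  rewrite !vdm_sq // => [|k]; last by rewrite mulf_neq0.
  have -> : S ^+ n / S = \prod_(j < n) \prod_(k < n | (j < k)%N) (q ^+ y k * q ^+ y j).
    have := prod_pairs (fun j k => q ^+ y k); rewrite Sy prodr_const card_ord => ->.
    by rewrite mulrC mulKf.
  rewrite /V -big_split -prodf_div; apply: eq_bigr => j _; rewrite -big_split -prodf_div.
  apply: eq_bigr => k jk /=; field.
  by rewrite !z0 sz.
have F2 : \prod_k (th (a ^+ 2 * z k ^+ 2 * (q ^+ 2) ^+ (y k + s)) / th (a ^+ 2 * z k ^+ 2)) =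
    S * S ^+ n * \prod_k (sgm (a * z k * q ^+ (y k + s)) / sgm (a * z k)).
  have -> : S * S ^+ n = \prod_k q ^+ (y k + s).
    by under eq_bigr do rewrite exprD; rewrite big_split /= Sy prodr_const card_ord.
  rewrite -big_split; apply: eq_bigr => k _ /=.
  have -> : a ^+ 2 * z k ^+ 2 * (q ^+ 2) ^+ (y k + s) = (a * z k * q ^+ (y k + s)) ^+ 2.
    by rewrite sqq -!exprMn.
  rewrite -exprMn !th_sgm ?mulf_neq0 //.
  rewrite invfM; transitivity (q ^+ (y k + s) *
      (sgm (a * z k * q ^+ (y k + s)) / sgm (a * z k)) * ((a * z k) / (a * z k))).
    by rewrite invfM; ring.
  by rewrite divff ?mulf_neq0 ?mulr1.
(* This ratio governs the monomials of both F3 and F6; its value is where the balancing condition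
   enters. *)
pose N3 := b * c * d / (a * q / e * (a * q / f) * (a * q / g)).
have N3E : N3 = q ^+ M / q.
  rewrite /N3; have -> : b * c * d = a ^+ 3 * q ^+ (2 + M) / (e * f * g).
    by rewrite bal; field; rewrite e0 f0 g0.
  by rewrite exprD; field; rewrite a0 q0 e0 f0 g0.
have ep3 (x1 x2 x3 y1 y2 y3 : K) k : x1 != 0 -> x2 != 0 -> x3 != 0 ->
    y1 != 0 -> y2 != 0 -> y3 != 0 ->
    ep (x1 ^+ 2) k * ep (x2 ^+ 2) k * ep (x3 ^+ 2) k /
      (ep (y1 ^+ 2) k * ep (y2 ^+ 2) k * ep (y3 ^+ 2) k) =
    (x1 * x2 * x3 / (y1 * y2 * y3)) ^+ k *
    (poch x1 k * poch x2 k * poch x3 k / (poch y1 k * poch y2 k * poch y3 k)).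
  move=> h1 h2 h3 h4 h5 h6.
  transitivity (ep (x1 ^+ 2) k / ep (y1 ^+ 2) k * (ep (x2 ^+ 2) k / ep (y2 ^+ 2) k) *
    (ep (x3 ^+ 2) k / ep (y3 ^+ 2) k)); first by rewrite !invfM; ring.
  rewrite !ep_ratio //.
  have -> : x1 * x2 * x3 / (y1 * y2 * y3) = x1 / y1 * (x2 / y2) * (x3 / y3).
    by rewrite !invfM; ring.
  by rewrite !exprMn !invfM; ring.
have F3 : ep (b ^+ 2) s * ep (c ^+ 2) s * ep (d ^+ 2) s /
     (ep (a ^+ 2 * q ^+ 2 / e ^+ 2) s * ep (a ^+ 2 * q ^+ 2 / f ^+ 2) s *
      ep (a ^+ 2 * q ^+ 2 / g ^+ 2) s) = T / S *
   (poch b s * poch c s * poch d s /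
    (poch (a * q / e) s * poch (a * q / f) s * poch (a * q / g) s)).
  rewrite -!exprMn -!expr_div_n ep3 ?mulf_neq0 ?invr_eq0 ?mulf_neq0 //.
  by rewrite -/N3 N3E expr_div_n.
have nE : \prod_(j < n) q ^+ (1 + m j) = q ^+ n * q ^+ M.
  by under eq_bigr do rewrite exprD expr1; rewrite big_split /= prodr_const card_ord prodrXr.
have F4 : \prod_j (ep (a ^+ 2 * z j ^+ 2) s / ep (a ^+ 2 * (q ^+ 2) ^+ (1 + m j) * z j ^+ 2) s) =
    (S ^+ n * T)^-1 * \prod_j (poch (a * z j) s / poch (a * q ^+ (1 + m j) * z j) s).
  have -> : (S ^+ n * T)^-1 = \prod_(j < n) ((q ^+ (1 + m j))^-1) ^+ s.
    by rewrite prodrXl prodfV nE exprVn exprMn /S (exprAC q s n).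
  rewrite -big_split; apply: eq_bigr => j _ /=.
  have -> : a ^+ 2 * (q ^+ 2) ^+ (1 + m j) * z j ^+ 2 = (a * q ^+ (1 + m j) * z j) ^+ 2.
    by rewrite sqq -!exprMn.
  rewrite -exprMn ep_ratio ?mulf_neq0 //; congr (_ ^+ _ * _).
  by field; rewrite a0 z0 qn.
have F5 : (q ^+ 2) ^+ s = S * S by rewrite sqq expr2.
have F6 : \prod_k (ep (e ^+ 2 * z k ^+ 2) (y k) * ep (f ^+ 2 * z k ^+ 2) (y k) *
       ep (g ^+ 2 * z k ^+ 2) (y k) /
       (ep (a ^+ 2 * q ^+ 2 * z k ^+ 2 / b ^+ 2) (y k) *
        ep (a ^+ 2 * q ^+ 2 * z k ^+ 2 / c ^+ 2) (y k) *
        ep (a ^+ 2 * q ^+ 2 * z k ^+ 2 / d ^+ 2) (y k))) = T / S *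
    \prod_k (poch (e * z k) (y k) * poch (f * z k) (y k) * poch (g * z k) (y k) /
     (poch (a * q * z k / b) (y k) * poch (a * q * z k / c) (y k) *
      poch (a * q * z k / d) (y k))).
  have -> : T / S = \prod_k N3 ^+ y k.
    by rewrite prodrXr -/s N3E expr_div_n.
  rewrite -big_split; apply: eq_bigr => k _ /=.
  rewrite -!exprMn -!expr_div_n ep3 ?mulf_neq0 ?invr_eq0 ?mulf_neq0 //.
  congr (_ ^+ _ * _); rewrite /N3; field.
  by rewrite a0 b0 c0 d0 e0 f0 g0 q0 z0.
have F7 : \prod_j \prod_k (ep ((q ^+ 2) ^- m j * z k ^+ 2 / z j ^+ 2) (y k) /
       ep (q ^+ 2 * z k ^+ 2 / z j ^+ 2) (y k)) = (S ^+ n * T)^-1 *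
    \prod_j \prod_k (poch (z k / (z j * q ^+ m j)) (y k) / poch (q * z k / z j) (y k)).
  have -> : (S ^+ n * T)^-1 = \prod_(j < n) \prod_k ((q ^+ (1 + m j))^-1) ^+ y k.
    under eq_bigr do rewrite prodrXr -/s.
    by rewrite prodrXl prodfV nE exprVn exprMn /S (exprAC q s n).
  rewrite -big_split; apply: eq_bigr => j _ /=; rewrite -big_split; apply: eq_bigr => k _ /=.
  have -> : (q ^+ 2) ^- m j * z k ^+ 2 / z j ^+ 2 = (z k / (z j * q ^+ m j)) ^+ 2.
    by rewrite sqq; field; rewrite z0 qn.
  rewrite -exprMn -expr_div_n ep_ratio ?mulf_neq0 ?invr_eq0 ?mulf_neq0 //.
  by congr (_ ^+ _ * _); rewrite exprD expr1; field; rewrite q0 !z0 qn.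
have Vd := vandermonde_poch y z0 sz; rewrite -/V in Vd.
rewrite /eterm F1 F2 F3 F4 F5 F6 F7 /bterm -/s.
have pd (F G : 'I_n -> 'I_n -> K) : \prod_j \prod_k (F j k / G j k) =
    (\prod_j \prod_k F j k) / (\prod_j \prod_k G j k).
  by under eq_bigr do rewrite prodf_div; rewrite prodf_div.
have VW : V * \prod_j \prod_k (poch (z k / (z j * q ^+ m j)) (y k) /
    poch (q * z k / z j) (y k)) = (-1) ^+ s * Uf sgm q m z y.
  have Q0 : \prod_j \prod_k poch (q * z k / z j) (y k) != 0.
    by apply/prodf_neq0 => j _; apply/prodf_neq0 => k _.
  have P0 : \prod_j \prod_k poch (z k / (z j * q ^+ y j)) (y k) != 0.
    apply/prodf_neq0 => j _; apply/prodf_neq0 => k _.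
    by apply: (nodes_sep_poch q0 sep); rewrite ?(mleP _ _ ym) // => ->.
  rewrite /Uf !pd -/s in Vd *; move: Vd Q0 P0.
  set Y := \prod_j _; set Q := \prod_j _; set P := \prod_j _ => eq Q0 P0.
  have -> : (-1) ^+ s = V * Y / Q by rewrite eq mulfK.
  by field; rewrite Q0 P0.
move: VW; set W := \prod_j _ => VW.
rewrite -VW [X in _ = _ * X]big_split [X in _ = _ * (X * _)]big_split /=.
have Sn : S ^+ n != 0 by rewrite expf_neq0.
move: Sn; set Z := S ^+ n => Sn.
set P1 := \prod_k _; set P2 := \prod_k _; set P3 := \prod_k _; set D := _ / (_ * _).
by field; rewrite ?(S0, T0, Sn).
Qed.
End Conversion.

(** * The transformation for theta with squared parameters *)

Section Transformation.
Variables (K : fieldType) (th : K -> K) (n : nat).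
Local Notation sigma := (sgm th).
Hypothesis sigmaV : forall x, sigma x^-1 = - sigma x.
Variable q : K.
Hypothesis q0 : q != 0.
Local Notation poch := (poch sigma q).
Local Notation ep := (ep th q).
Implicit Types (x X : K) (m : {ffun 'I_n -> nat}) (z : 'I_n -> K).

Lemma th_neq0 x X : x != 0 -> X = x ^+ 2 -> th X != 0 -> sigma x != 0.
Proof.
by move=> x0 ->; rewrite th_sgm // mulf_eq0 negb_or => /andP[].
Qed.

Lemma ep_neq0 x X k : x != 0 -> X = x ^+ 2 -> ep X k != 0 -> poch x k != 0.
Proof.
by move=> x0 ->; rewrite ep_poch // mulf_eq0 negb_or => /andP[].
Qed.

(** For equal exponents the separation comes from the Vandermonde determinant, for different ones
    from the denominators (q z_k / z_j). *)
Lemma nodes_sep_theta m z : (forall k, z k != 0) ->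
  vdm th (fun k => z k ^+ 2) != 0 ->
  (forall j k, poch (q * z k / z j) (m k) != 0) -> nodes_sep sigma q m z.
Proof.
move=> z0; rewrite vdm_sq // => /prodf_neq0 hV hzz.
have qn j : q ^+ j != 0 by rewrite expf_neq0.
have odd x : (sigma x^-1 != 0) = (sigma x != 0) by rewrite sigmaV oppr_eq0.
have sz (j k : 'I_n) : (j < k)%N -> sigma (z k / z j) != 0.
  by move=> jk; have /prodf_neq0 /(_ k jk) := hV j isT; rewrite mulf_eq0 negb_or => /andP[].
have lt (j k : 'I_n) i l : (i <= m k)%N -> (l < i)%N ->
    sigma (z k * q ^+ i / (z j * q ^+ l)) != 0.
  move=> im li; have /poch_neq0P /(_ (i - l.+1)%N) := hzz j k.
  have -> : q * z k / z j * q ^+ (i - l.+1) = z k * q ^+ i / (z j * q ^+ l).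
    have -> : q ^+ i = q ^+ (i - l.+1) * q ^+ l.+1 by rewrite -exprD subnK.
    by rewrite exprS; field; rewrite z0 qn.
  by apply; clear -im li; lia.
move=> j k i l im lm; case: (ltngtP i l) => [il|il|->] ne.
- by rewrite -odd invf_div; apply: lt.
- exact: lt.
rewrite -mulf_div divff // mulr1.
case: (ltngtP j k) => [jk|jk|/val_inj jk]; first exact: sz.
  by rewrite -odd invf_div; apply: sz.
by rewrite jk eqxx in ne.
Qed.

Hypothesis jackson : forall (a b c d : K) m z, a != 0 -> b != 0 -> c != 0 ->
  d != 0 -> (forall k, z k != 0) -> nodes_sep sigma q m z ->
  jackson_at sigma q a b c d m z.

Lemma bailey_theta (a b c d e f g lam : K) m z :
  a != 0 -> b != 0 -> c != 0 -> d != 0 -> e != 0 -> f != 0 -> g != 0 ->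
  (forall k, z k != 0) ->
  a ^+ 3 * q ^+ (2 + wt m) = b * c * d * e * f * g ->
  lam = a ^+ 2 * q / (b * c * e) ->
  vdm th (fun k => z k ^+ 2) != 0 ->
  (forall j k, ep (q ^+ 2 * z k ^+ 2 / z j ^+ 2) (m k) != 0) ->
  (forall k, th (a ^+ 2 * z k ^+ 2) != 0) ->
  ep (a ^+ 2 * q ^+ 2 / e ^+ 2) (wt m) != 0 ->
  ep (a ^+ 2 * q ^+ 2 / f ^+ 2) (wt m) != 0 ->
  ep (a ^+ 2 * q ^+ 2 / g ^+ 2) (wt m) != 0 ->
  (forall k, ep (a ^+ 2 * (q ^+ 2) ^+ (1 + m k) * z k ^+ 2) (wt m) != 0) ->
  (forall k, ep (a ^+ 2 * q ^+ 2 * z k ^+ 2 / b ^+ 2) (m k) != 0) ->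
  (forall k, ep (a ^+ 2 * q ^+ 2 * z k ^+ 2 / c ^+ 2) (m k) != 0) ->
  (forall k, ep (a ^+ 2 * q ^+ 2 * z k ^+ 2 / d ^+ 2) (m k) != 0) ->
  (forall k, ep (lam ^+ 2 * q ^+ 2 * z k ^+ 2) (m k) != 0) ->
  (forall k, th (lam ^+ 2 * z k ^+ 2) != 0) ->
  ep (lam ^+ 2 * q ^+ 2 / f ^+ 2) (wt m) != 0 ->
  ep (lam ^+ 2 * q ^+ 2 / g ^+ 2) (wt m) != 0 ->
  (forall k, ep (lam ^+ 2 * (q ^+ 2) ^+ (1 + m k) * z k ^+ 2) (wt m) != 0) ->
  (forall k, ep (lam ^+ 2 * q ^+ 2 * z k ^+ 2 / d ^+ 2) (m k) != 0) ->
  \sum_(y <- box m) eterm th q (a ^+ 2) (b ^+ 2) (c ^+ 2) (d ^+ 2) (e ^+ 2)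
    (f ^+ 2) (g ^+ 2) m (fun k => z k ^+ 2) y (wt y) =
  (a ^+ 2 / lam ^+ 2) ^+ wt m *
  (ep (lam ^+ 2 * q ^+ 2 / f ^+ 2) (wt m) * ep (lam ^+ 2 * q ^+ 2 / g ^+ 2) (wt m) /
   (ep (a ^+ 2 * q ^+ 2 / f ^+ 2) (wt m) * ep (a ^+ 2 * q ^+ 2 / g ^+ 2) (wt m))) *
  \prod_k (ep (a ^+ 2 * q ^+ 2 * z k ^+ 2) (m k) *
      ep (lam ^+ 2 * q ^+ 2 * z k ^+ 2 / d ^+ 2) (m k) /
    (ep (lam ^+ 2 * q ^+ 2 * z k ^+ 2) (m k) *
      ep (a ^+ 2 * q ^+ 2 * z k ^+ 2 / d ^+ 2) (m k))) *
  \sum_(y <- box m) eterm th q (lam ^+ 2) (lam ^+ 2 * b ^+ 2 / a ^+ 2)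
    (lam ^+ 2 * c ^+ 2 / a ^+ 2) (d ^+ 2) (lam ^+ 2 * e ^+ 2 / a ^+ 2)
    (f ^+ 2) (g ^+ 2) m (fun k => z k ^+ 2) y (wt y).
Proof.
move=> a0 b0 c0 d0 e0 f0 g0 z0 bal lamE hV hzz haz he hf hg ham hb hc hd hlq hlz.
move=> hlf hlg hlm hld.
have l0 : lam != 0 by rewrite lamE !(mulf_neq0, invr_eq0, expf_neq0).
have qn j : q ^+ j != 0 by rewrite expf_neq0.
have nz : forall j k, poch (q * z k / z j) (m k) != 0.
  move=> j k; apply: ep_neq0 (hzz j k); first by rewrite !(mulf_neq0, invr_eq0).
  by rewrite -exprMn -expr_div_n.
have sep := nodes_sep_theta z0 hV nz.
have pw x (x0 : x != 0) : ep (x ^+ 2) (wt m) != 0 -> poch x (wt m) != 0 by exact: ep_neq0.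
have pk x k (x0 : x != 0) : ep (x ^+ 2) (m k) != 0 -> poch x (m k) != 0 by exact: ep_neq0.
have sqM x j : (x ^+ 2) ^+ j = (x ^+ j) ^+ 2 by rewrite exprAC.
have nzy y j k : mle y m -> poch (q * z k / z j) (y k) != 0.
  by move=> ym; apply: (poch_le q0) (nz j k); exact: (mleP _ _ ym).
transitivity (\sum_(y <- box m) bterm sigma q a b c d e f g m z y).
  rewrite big_seq [RHS]big_seq; apply: eq_bigr => y; rewrite mem_box => ym.
  by apply: eterm_bterm => // j k; apply: nzy.
have lbal : lam ^+ 3 * q ^+ (2 + wt m) =
    lam * b / a * (lam * c / a) * d * (lam * e / a) * f * g.
  transitivity (lam ^+ 3 / a ^+ 3 * (a ^+ 3 * q ^+ (2 + wt m))).
    by field; rewrite a0.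
  by rewrite bal; field; rewrite a0.
rewrite -!exprMn -!expr_div_n in he hf hg hlf hlg.
transitivity ((a ^+ 2 / lam ^+ 2) ^+ wt m *
  (ep (lam ^+ 2 * q ^+ 2 / f ^+ 2) (wt m) * ep (lam ^+ 2 * q ^+ 2 / g ^+ 2) (wt m) /
   (ep (a ^+ 2 * q ^+ 2 / f ^+ 2) (wt m) * ep (a ^+ 2 * q ^+ 2 / g ^+ 2) (wt m))) *
  \prod_k (ep (a ^+ 2 * q ^+ 2 * z k ^+ 2) (m k) *
      ep (lam ^+ 2 * q ^+ 2 * z k ^+ 2 / d ^+ 2) (m k) /
    (ep (lam ^+ 2 * q ^+ 2 * z k ^+ 2) (m k) *
      ep (a ^+ 2 * q ^+ 2 * z k ^+ 2 / d ^+ 2) (m k))) *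
  \sum_(x <- box m) bterm sigma q lam (lam * b / a) (lam * c / a) d (lam * e / a) f g m z x).
  rewrite (@bailey _ _ sigmaV q q0 _ jackson a b c d e f g lam m z) => //; first congr (_ * _ * _).
  - rewrite -!exprMn -!expr_div_n.
    have ratio x y : x != 0 -> y != 0 ->
        ep (x ^+ 2) (wt m) / ep (y ^+ 2) (wt m) = (x / y) ^+ wt m * (poch x (wt m) / poch y (wt m)).
      exact: ep_ratio.
    have sw (x1 x2 y1 y2 : K) : x1 * x2 / (y1 * y2) = x1 / y1 * (x2 / y2).
      by rewrite invfM; ring.
    rewrite (sw (poch _ _)) (sw (ep _ _)) !ratio ?mulf_neq0 ?invr_eq0 //.
    have -> : lam * q / f / (a * q / f) = lam / a by field; rewrite a0 f0 q0.
    have -> : lam * q / g / (a * q / g) = lam / a by field; rewrite a0 g0 q0.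
    (* The power of a / lam in the theorem is what cancels the monomials of the two Pochhammer
       quotients. *)
    have e1 : (a / lam) ^+ 2 ^+ wt m * ((lam / a) ^+ wt m * (lam / a) ^+ wt m) = 1.
      rewrite -!exprMn -[RHS](expr1n _ (wt m)); congr (_ ^+ _); field.
      by rewrite a0 l0.
    rewrite -[LHS]mul1r -e1.
    set X := poch _ _ / _; set Y := poch _ _ / _.
    by ring.
  - apply: eq_bigr => k _; rewrite -!exprMn -!expr_div_n.
    have sw (x1 x2 y1 y2 : K) : x1 * x2 / (y1 * y2) = x1 / y1 * (x2 / y2).
      by rewrite invfM; ring.
    rewrite (sw (poch _ _)) (sw (ep _ _)) !ep_ratio ?mulf_neq0 ?invr_eq0 //.
    have e1 : (a * q * z k / (lam * q * z k)) ^+ m k *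
        (lam * q * z k / d / (a * q * z k / d)) ^+ m k = 1.
      rewrite -exprMn -[RHS](expr1n _ (m k)); congr (_ ^+ _); field.
      by rewrite a0 l0 d0 q0 z0.
    rewrite -[LHS]mul1r -e1.
    set X := poch _ _ / _; set Y := poch _ _ / _.
    by ring.
  - by move=> k; apply: th_neq0 (haz k); rewrite ?mulf_neq0 // -exprMn.
  - by apply: pw he; rewrite !mulf_neq0 ?invr_eq0.
  - by apply: pw hf; rewrite !mulf_neq0 ?invr_eq0.
  - by apply: pw hg; rewrite !mulf_neq0 ?invr_eq0.
  - move=> k; apply: ep_neq0 (ham k); first by rewrite !mulf_neq0.
    by rewrite sqM -!exprMn.
  - move=> k; apply: ep_neq0 (hb k); first by rewrite !mulf_neq0 ?invr_eq0.
    by rewrite -!exprMn -expr_div_n.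
  - move=> k; apply: ep_neq0 (hc k); first by rewrite !mulf_neq0 ?invr_eq0.
    by rewrite -!exprMn -expr_div_n.
  - move=> k; apply: ep_neq0 (hd k); first by rewrite !mulf_neq0 ?invr_eq0.
    by rewrite -!exprMn -expr_div_n.
  (* Three denominators of the right-hand side, with bases lam z_k, lam q z_k and lam q^(1 + m_k)
     z_k, are consecutive pieces of this product. *)
  - move=> k; rewrite !pochD !mulf_neq0 //.
    + by rewrite poch1; apply: th_neq0 (hlz k); rewrite ?mulf_neq0 // -exprMn.
    + apply: ep_neq0 (hlq k); first by rewrite !mulf_neq0.
      by rewrite -!exprMn; congr (_ ^+ _); rewrite expr1; ring.
    + apply: ep_neq0 (hlm k); first by rewrite !mulf_neq0.
      by rewrite sqM -!exprMn; congr (_ ^+ _); ring.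
  - by apply: pw hlf; rewrite !mulf_neq0 ?invr_eq0.
  - by apply: pw hlg; rewrite !mulf_neq0 ?invr_eq0.
  - move=> k; apply: ep_neq0 (hld k); first by rewrite !mulf_neq0 ?invr_eq0.
    by rewrite -!exprMn -expr_div_n.
congr (_ * _); rewrite big_seq [RHS]big_seq; apply: eq_bigr => y; rewrite mem_box => ym.
rewrite -!exprMn -!expr_div_n; symmetry; apply: eterm_bterm => //; rewrite ?mulf_neq0 ?invr_eq0 //.
by move=> j k; apply: nzy.
Qed.
End Transformation.

(** * The Jackson sum for sigma, without genericity conditions *)

Section ThetaJackson.
Variable R : realType.
Local Notation C := R[i].
Variable p : C.
Hypothesis hp : `|p| < 1.
Local Notation sigma := (sgm (theta p)).
Implicit Types x y u v : C.

Lemma sigmaV x : sigma x^-1 = - sigma x.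
Proof.
rewrite /sgm; have [->|x0] := eqVneq x 0; first by rewrite invr0 invr0 !mul0r oppr0.
by rewrite exprVn theta_inv ?expf_neq0 // invrK; field.
Qed.

Lemma sigma1 : sigma 1 = 0.
Proof. by rewrite /sgm expr1n theta1 // mulr0. Qed.

Lemma sigma_plucker x y u v : x != 0 -> y != 0 -> u != 0 -> v != 0 ->
  sg2 sigma x y * sg2 sigma u v - sg2 sigma x u * sg2 sigma y v +
  sg2 sigma x v * sg2 sigma y u = 0.
Proof.
move=> x0 y0 u0 v0.
have E a b : a != 0 -> b != 0 -> sg2 sigma a b =
    (a ^+ 2)^-1 * theta p (a ^+ 2 * b ^+ 2) * theta p (a ^+ 2 / b ^+ 2).
  by move=> a0 b0; rewrite /sg2 /sgm exprMn expr_div_n; field; rewrite a0.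
rewrite !E //; apply: (theta_plucker hp); exact: expf_neq0.
Qed.

Lemma sigma_step1 x j : x != 0 -> (0 < j)%N ->
  exists N, forall n, (N <= n)%N -> sigma (x * step1 R n ^+ j) != 0.
Proof.
move=> x0 j0; have x2 : x ^+ 2 != 0 by rewrite expf_neq0.
have j2 : (0 < j * 2)%N by rewrite muln_gt0 j0.
have [N hN] := theta_step1_neq0 hp x2 j2; exists N => n /hN h.
have s0 := step1_neq0 R n.
rewrite /sgm mulf_neq0 ?invr_eq0 ?mulf_neq0 ?expf_neq0 //.
by rewrite exprMn -exprM.
Qed.

Lemma eventually_all (T : finType) (P : T -> nat -> Prop) :
  (forall t, exists N, forall n, (N <= n)%N -> P t n) ->
  exists N, forall n, (N <= n)%N -> forall t, P t n.
Proof.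
move=> h; pose N t := projT1 (cid (h t)).
exists (\max_t N t) => n hn t; apply: (projT2 (cid (h t))).
by apply: leq_trans hn; exact: (leq_bigmax t).
Qed.

Lemma sigma_generic (s : seq C) : all (fun c => c != 0) s ->
  exists2 u : C, u != 0 & all (fun c => sigma (c * u) != 0) s.
Proof.
move=> /allP s0.
have [N hN] : exists N, forall n, (N <= n)%N -> forall i : 'I_(size s),
    sigma (s`_i * step1 R n ^+ 1) != 0.
  by apply: eventually_all => i; apply: sigma_step1 => //; apply/s0/mem_nth.
exists (step1 R N); first exact: step1_neq0.
apply/(all_nthP 0) => i hi.
by have := hN N (leqnn N) (Ordinal hi); rewrite expr1.
Qed.

Lemma sigma_cont (f : nat -> C) x : x != 0 -> tendsto f x ->
  tendsto (fun n => sigma (f n)) (sigma x).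
Proof.
move=> x0 fx; apply: tendstoM; first exact: tendstoV.
apply: theta_cont => //; first by rewrite expf_neq0.
by rewrite expr2; apply: (@tendsto_eq _ _ _ _ 0) (tendstoM fx fx) => n _; rewrite expr2.
Qed.

Variable q : C.
Hypothesis q0 : q != 0.
Local Notation poch := (poch sigma q).

(** [sigma_cont] holds at nonzero points, so the limit is kept nonzero through products and
    inverses. *)
Definition tendsto_nz (f : nat -> C) x := x != 0 /\ tendsto f x.

Lemma nz_cst x : x != 0 -> tendsto_nz (fun=> x) x.
Proof. by move=> x0; split=> //; apply: tendsto_cst. Qed.

Lemma nz_mul f g x y : tendsto_nz f x -> tendsto_nz g y ->
  tendsto_nz (fun n => f n * g n) (x * y).
Proof. by move=> [x0 fx] [y0 gy]; split; [rewrite mulf_neq0|apply: tendstoM]. Qed.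

Lemma nz_inv f x : tendsto_nz f x -> tendsto_nz (fun n => (f n)^-1) x^-1.
Proof. by move=> [x0 fx]; split; [rewrite invr_eq0|apply: tendstoV]. Qed.

Lemma sigma_tendsto f x : tendsto_nz f x ->
  tendsto (fun n => sigma (f n)) (sigma x).
Proof. by case; apply: sigma_cont. Qed.

Lemma poch_tendsto f x k : tendsto_nz f x ->
  tendsto (fun n => poch (f n) k) (poch x k).
Proof.
move=> fx; apply: tendsto_prod => i; apply: sigma_tendsto.
by apply: nz_mul fx _; apply: nz_cst; rewrite expf_neq0.
Qed.

Variable I : finType.
Implicit Types (m w : {ffun I -> nat}) (z : I -> C).

Ltac nz := repeat first
  [ assumption | apply: nz_cst; rewrite ?expf_neq0 //; assumption
  | apply: nz_mul | apply: nz_inv ].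

Ltac limits := lazymatch goal with
  | |- tendsto (fun n => @GRing.mul _ (@?f n) (@?g n)) _ => apply: tendstoM; limits
  | |- tendsto (fun n => @poch _ _ _ (@?f n) _) _ => apply: poch_tendsto; nz
  | |- tendsto (fun n => @sgm _ _ (@?f n)) _ => apply: sigma_tendsto; nz
  | |- tendsto (fun n => @Uf _ _ _ _ _ _ _) _ => exact: tendsto_cst
  | |- _ => apply: tendsto_prod => ?; limits
  end.

Lemma jterm_tendsto (a c : nat -> C) (a1 c1 b d : C) m z w :
  tendsto_nz a a1 -> tendsto_nz c c1 -> b != 0 -> d != 0 -> (forall k, z k != 0) ->
  tendsto (fun n => jterm sigma q (a n) b (c n) d m z w) (jterm sigma q a1 b c1 d m z w).
Proof.
move=> ha hc b0 d0 z0; rewrite /jterm.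
have zk k : tendsto_nz (fun=> z k) (z k) by exact: nz_cst.
limits.
Qed.

Lemma jsum_tendsto (a c : nat -> C) (a1 c1 b d : C) m z :
  tendsto_nz a a1 -> tendsto_nz c c1 -> b != 0 -> d != 0 -> (forall k, z k != 0) ->
  tendsto (fun n => jsum sigma q (a n) b (c n) d m z) (jsum sigma q a1 b c1 d m z).
Proof.
move=> ha hc b0 d0 z0; rewrite /jsum.
have zk k : tendsto_nz (fun=> z k) (z k) by exact: nz_cst.
limits.
Qed.

(* The genericity conditions of jackson_generic hold along a -> a u, c -> c / u
   for all u > 1 close to 1, and both sides are continuous in u. *)
Lemma jackson_sigma a b c d m z : a != 0 -> b != 0 -> c != 0 -> d != 0 ->
  (forall k, z k != 0) -> nodes_sep sigma q m z -> jackson_at sigma q a b c d m z.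
Proof.
have [M] := ubnP (wt m); elim: M m z a b c d => // M IH m z a b c d /ltnSE mM.
move=> a0 b0 c0 d0 z0 sep.
have s0 n : step1 R n != 0 by exact: step1_neq0.
have qn j : q ^+ j != 0 by rewrite expf_neq0.
have az k j : a * z k * q ^+ j != 0 by rewrite !mulf_neq0.
(* A common bound for all exponents makes the genericity conditions a finite family, as
   [eventually_all] requires. *)
pose L := (wt m).+1.
have mL k i : (i < m k)%N -> (i < L)%N.
  by move=> /leq_trans; apply; apply: leqW; rewrite /wt (bigD1 k) //= leq_addr.
(* Under a -> a u, c -> c / u the arguments of the three conditions are multiplied by u^3, u and
   u^2. These are positive powers, so [sigma_step1] applies. *)
have [N1 h1] : exists N, forall n, (N <= n)%N -> forall t : I * I * 'I_L * 'I_L,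
    sigma (a * z t.1.1.1 * q ^+ t.1.2.+1 * (a * z t.1.1.2 * q ^+ t.2.+1) / (b * c) *
      step1 R n ^+ 3) != 0.
  by apply: eventually_all => t; apply: sigma_step1; rewrite // !mulf_neq0 ?invr_eq0 ?mulf_neq0.
have [N2 h2] : exists N, forall n, (N <= n)%N -> forall t : I * 'I_L,
    sigma (a * z t.1 * q ^+ t.2.+1 * step1 R n ^+ 1) != 0.
  by apply: eventually_all => t; apply: sigma_step1.
have [N3 h3] : exists N, forall n, (N <= n)%N -> forall t : I * 'I_L,
    sigma (a * z t.1 * q ^+ t.2.+1 / (b * c) * step1 R n ^+ 2) != 0.
  by apply: eventually_all => t; apply: sigma_step1; rewrite // !mulf_neq0 ?invr_eq0 ?mulf_neq0.
have gen n : (maxn N1 (maxn N2 N3) <= n)%N ->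
    jackson_at sigma q (a * step1 R n) b (c / step1 R n) d m z.
  rewrite !geq_max => /and3P[/h1 + /h2 + /h3].
  move: (step1 R n) (s0 n) => u u0 g1 g2 g3.
  pose kap := sqrtc (b * (c / u)).
  have k2 : kap ^+ 2 = b * (c / u) by exact: sqr_sqrtc.
  have kap0 : kap != 0.
    have : kap ^+ 2 != 0 by rewrite k2 !mulf_neq0 ?invr_eq0.
    by rewrite expf_eq0.
  have -> : b = kap * (b / kap) by rewrite mulrCA divff ?mulr1.
  have -> : c / u = kap / (b / kap).
    by rewrite invf_div mulrA -expr2 k2 mulrAC divff // mul1r.
  apply: (jackson_generic sigmaV sigma1 sigma_plucker sigma_generic q0) => //.
  - by rewrite mulf_neq0.
  - by rewrite mulf_neq0 ?invr_eq0.
  - move=> k j i l /mL iL /mL lL; rewrite k2.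
    have := g1 (k, j, Ordinal iL, Ordinal lL); rewrite /=.
    by congr (sigma _ != 0); field; rewrite ?(b0, c0, u0).
  - move=> k i /mL iL; have := g2 (k, Ordinal iL); rewrite /=.
    by congr (sigma _ != 0); ring.
  - move=> k i /mL iL; rewrite k2; have := g3 (k, Ordinal iL); rewrite /=.
    by congr (sigma _ != 0); field; rewrite ?(b0, c0, u0).
  - move=> a' b' c' d' m' z' ? ? ? ? ? ? mm; apply: IH => //.
    exact: leq_trans mm mM.
have ta : tendsto_nz (fun n => a * step1 R n) a.
  split=> //; have := tendstoZ a (@step1_tendsto R); rewrite mulr1; exact.
have tc : tendsto_nz (fun n => c / step1 R n) c.
  split=> //; have := tendstoZ c (tendstoV (oner_neq0 _) (@step1_tendsto R)).
  by rewrite invr1 mulr1; exact.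
have lim : tendsto (fun n => \sum_(y <- box m) jterm sigma q (a * step1 R n) b
    (c / step1 R n) d m z y) (\sum_(y <- box m) jterm sigma q a b c d m z y).
  by apply: tendsto_sum => y; exact: jterm_tendsto.
apply: tendsto_unique lim _.
apply: (@tendsto_eq _ _ _ _ (maxn N1 (maxn N2 N3))) (jsum_tendsto m ta tc b0 d0 z0).
by move=> n /gen ->.
Qed.

End ThetaJackson.

(** * Matching the notation of the theorem *)

Lemma big_multi (I : finType) (V : nmodType) (m : I -> nat) (F : {ffun I -> nat} -> V) :
  \sum_(y : multi m) F [ffun k => y k : nat] = \sum_(y <- box (finfun m)) F y.
Proof.
rewrite -(big_map (fun y : multi m => [ffun k => y k : nat]) xpredT F).
apply: perm_big; apply: uniq_perm.
- rewrite map_inj_uniq ?index_enum_uniq // => y y' /ffunP e.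
  by apply/ffunP => k; apply/val_inj; have := e k; rewrite !ffunE.
- exact: box_uniq.
move=> y; rewrite mem_box; apply/mapP/mleP => [[u _ ->] k|h].
  by rewrite !ffunE -ltnS ltn_ord.
exists [ffun k => inord (y k) : 'I_(m k).+1]; first by rewrite mem_index_enum.
by apply/ffunP => k; rewrite !ffunE inordK // ltnS; have := h k; rewrite ffunE.
Qed.

Section Summand.
Variables (R : realType) (p Q : R[i]).
Local Notation q := (Q ^+ 2).
Local Notation ep := (ep (theta p) Q).

Lemma epoch_1 x k : epoch p q [:: x] k = ep x k.
Proof. exact: big_seq1. Qed.

Lemma epoch_2 x y k : epoch p q [:: x; y] k = ep x k * ep y k.
Proof. by rewrite /epoch big_cons big_seq1. Qed.

Lemma epoch_3 x y z k : epoch p q [:: x; y; z] k = ep x k * ep y k * ep z k.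
Proof. by rewrite /epoch !big_cons big_nil mulr1 mulrA. Qed.

Lemma eterm_epoch n (a b c d e f g : R[i]) (m : 'I_n -> nat) (z : 'I_n -> R[i])
    (y : 'I_n -> nat) s a1 a2 a3 (ez u1 u2 u3 : 'I_n -> R[i]) :
  a1 = a * q / e -> a2 = a * q / f -> a3 = a * q / g ->
  (forall k, ez k = e * z k) -> (forall k, u1 k = a * q * z k / b) ->
  (forall k, u2 k = a * q * z k / c) -> (forall k, u3 k = a * q * z k / d) ->
    (vandermonde p (fun k => z k * q ^+ y k) / vandermonde p z
     * (\prod_(k < n)
         (theta p (a * z k * q ^+ (y k + s)) / theta p (a * z k)))
     * (epoch p q [:: b; c; d] s / epoch p q [:: a1; a2; a3] s)
     * (\prod_(j < n)
         (epoch p q [:: a * z j] s / epoch p q [:: a * q ^+ (1 + m j) * z j] s))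
     * q ^+ s
     * (\prod_(k < n)
         (epoch p q [:: ez k; f * z k; g * z k] (y k)
          / epoch p q [:: u1 k; u2 k; u3 k] (y k)))
     * (\prod_(j < n) \prod_(k < n)
         (epoch p q [:: q ^- m j * z k / z j] (y k)
          / epoch p q [:: q * z k / z j] (y k)))) =
  eterm (theta p) Q a b c d e f g m z y s.
Proof.
move=> -> -> -> ezE u1E u2E u3E; rewrite /eterm !epoch_3.
congr (_ * _ * _ * _ * _ * _ * _).
- by apply: eq_bigr => j _; rewrite !epoch_1.
- by apply: eq_bigr => k _; rewrite !epoch_3 ezE u1E u2E u3E.
- by apply: eq_bigr => j _; apply: eq_bigr => k _; rewrite !epoch_1.
Qed.
End Summand.

Lemma weight_wt n (m : 'I_n -> nat) (y : multi m) :
  weight y = wt [ffun k => y k : nat].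
Proof. by apply: eq_bigr => k _; rewrite ffunE. Qed.

(** Provides a root of g for which the balancing condition of the roots holds exactly, whatever
    roots were chosen for the others. *)
Lemma balance_sqrt (K : fieldType) (a b c d e f g q : K) M :
  b != 0 -> c != 0 -> d != 0 -> e != 0 -> f != 0 ->
  (a ^+ 2) ^+ 3 * (q ^+ 2) ^+ (2 + M) =
    b ^+ 2 * c ^+ 2 * d ^+ 2 * e ^+ 2 * f ^+ 2 * g ->
  g = (a ^+ 3 * q ^+ (2 + M) / (b * c * d * e * f)) ^+ 2.
Proof.
move=> b0 c0 d0 e0 f0 bal.
rewrite expr_div_n exprMn (exprAC _ 3) (exprAC _ (2 + M)) bal; field.
by rewrite b0 c0 d0 e0 f0.
Qed.

(** Recognizes denominators such as a q / e on the right-hand side as those belonging to base lam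
    and parameter lam e / a. *)
Lemma sub_den (K : fieldType) (a b lam x : K) : a != 0 -> b != 0 -> lam != 0 ->
  a * x / b = lam * x / (lam * b / a).
Proof. by move=> a0 b0 l0; field; rewrite a0 b0 l0. Qed.
Theorem corollary8p1 (R : realType) (p q : R[i]) (hp : `|p| < 1) (hq : q != 0)
  (n : nat) (hn : (0 < n)%N) (m : 'I_n -> nat)
  (M : nat) (hM : M = (\sum_(k < n) m k)%N)
  (a b c d e f g : R[i]) (z : 'I_n -> R[i])
  (ha : a != 0) (hb : b != 0) (hc : c != 0) (hd : d != 0)
  (he : e != 0) (hf : f != 0) (hg : g != 0) (hz : forall k, z k != 0)
  (hbal : a ^+ 3 * q ^+ (2 + M) = b * c * d * e * f * g)
  (lam : R[i]) (hlam : lam = a ^+ 2 * q / (b * c * e))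
  (* no denominator common to both sums vanishes *)
  (hV : vandermonde p z != 0)
  (hzz : forall (y : multi m) (j k : 'I_n),
    epoch p q [:: q * z k / z j] (y k) != 0)
  (* no denominator on the left-hand side vanishes *)
  (haz : forall k, theta p (a * z k) != 0)
  (hL1 : forall y : multi m,
    epoch p q [:: a * q / e; a * q / f; a * q / g] (weight y) != 0)
  (hL2 : forall (y : multi m) (j : 'I_n),
    epoch p q [:: a * q ^+ (1 + m j) * z j] (weight y) != 0)
  (hL3 : forall (y : multi m) (k : 'I_n),
    epoch p q [:: a * q * z k / b; a * q * z k / c; a * q * z k / d] (y k) != 0)
  (* no denominator in the prefactor on the right-hand side vanishes *)
  (hP1 : epoch p q [:: a * q / f; a * q / g] M != 0)
  (hP2 : forall k : 'I_n,
    epoch p q [:: lam * q * z k; a * q * z k / d] (m k) != 0)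
  (* no denominator in the sum on the right-hand side vanishes *)
  (hlz : forall k, theta p (lam * z k) != 0)
  (hR1 : forall y : multi m,
    epoch p q [:: a * q / e; lam * q / f; lam * q / g] (weight y) != 0)
  (hR2 : forall (y : multi m) (j : 'I_n),
    epoch p q [:: lam * q ^+ (1 + m j) * z j] (weight y) != 0)
  (hR3 : forall (y : multi m) (k : 'I_n),
    epoch p q [:: a * q * z k / b; a * q * z k / c; lam * q * z k / d] (y k)
      != 0) :
  \sum_(y : multi m)
    (vandermonde p (fun k => z k * q ^+ y k) / vandermonde p z
     * (\prod_(k < n)
         (theta p (a * z k * q ^+ (y k + weight y)) / theta p (a * z k)))
     * (epoch p q [:: b; c; d] (weight y)
        / epoch p q [:: a * q / e; a * q / f; a * q / g] (weight y))
     * (\prod_(j < n)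
         (epoch p q [:: a * z j] (weight y)
          / epoch p q [:: a * q ^+ (1 + m j) * z j] (weight y)))
     * q ^+ weight y
     * (\prod_(k < n)
         (epoch p q [:: e * z k; f * z k; g * z k] (y k)
          / epoch p q [:: a * q * z k / b; a * q * z k / c; a * q * z k / d]
              (y k)))
     * (\prod_(j < n) \prod_(k < n)
         (epoch p q [:: q ^- m j * z k / z j] (y k)
          / epoch p q [:: q * z k / z j] (y k))))
  =
  (a / lam) ^+ M
  * (epoch p q [:: lam * q / f; lam * q / g] M
     / epoch p q [:: a * q / f; a * q / g] M)
  * (\prod_(k < n)
      (epoch p q [:: a * q * z k; lam * q * z k / d] (m k)
       / epoch p q [:: lam * q * z k; a * q * z k / d] (m k)))
  * \sum_(y : multi m)
    (vandermonde p (fun k => z k * q ^+ y k) / vandermonde p z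
     * (\prod_(k < n)
         (theta p (lam * z k * q ^+ (y k + weight y)) / theta p (lam * z k)))
     * (epoch p q [:: lam * b / a; lam * c / a; d] (weight y)
        / epoch p q [:: a * q / e; lam * q / f; lam * q / g] (weight y))
     * (\prod_(j < n)
         (epoch p q [:: lam * z j] (weight y)
          / epoch p q [:: lam * q ^+ (1 + m j) * z j] (weight y)))
     * q ^+ weight y
     * (\prod_(k < n)
         (epoch p q [:: lam * e * z k / a; f * z k; g * z k] (y k)
          / epoch p q [:: a * q * z k / b; a * q * z k / c; lam * q * z k / d]
              (y k)))
     * (\prod_(j < n) \prod_(k < n)
         (epoch p q [:: q ^- m j * z k / z j] (y k)
          / epoch p q [:: q * z k / z j] (y k)))).
Proof.
have root x : exists y : R[i], x = y ^+ 2 by exists (sqrtc x); rewrite sqr_sqrtc.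
have nz2 (x : R[i]) : x ^+ 2 != 0 -> x != 0 by rewrite expf_eq0.
have [Z zE] : exists Z : 'I_n -> R[i], z = fun k => Z k ^+ 2.
  by exists (fun k => sqrtc (z k)); apply/funext => k; rewrite sqr_sqrtc.
have [[Q qE] [A aE]] := (root q, root a).
have [[B bE] [C cE] [D dE]] := And3 (root b) (root c) (root d).
have [[E eE] [F fE]] := (root e, root f).
subst z q a b c d e f.
have Z0 k : Z k != 0 by exact: nz2.
move: hq ha hb hc hd he hf => /nz2 Q0 /nz2 A0 /nz2 B0 /nz2 C0 /nz2 D0 /nz2 E0 /nz2 F0.
have := balance_sqrt B0 C0 D0 E0 F0 hbal.
set G := A ^+ 3 * _ / _ => gE.
pose L := A ^+ 2 * Q / (B * C * E).
have lamE : lam = L ^+ 2 by rewrite hlam -!exprMn -expr_div_n.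
clear hlam; subst g lam.
have G0 := nz2 _ hg.
have L0 : L != 0 by rewrite !(mulf_neq0, invr_eq0, expf_neq0).
have bal : A ^+ 3 * Q ^+ (2 + M) = B * C * D * E * F * G.
  by rewrite [RHS]mulrC /G divfK // !mulf_neq0.
pose mf := finfun m.
have wM : wt mf = M by rewrite hM; apply: eq_bigr => k _; rewrite ffunE.
(* At y = m the Pochhammer symbols in the denominators have maximal length and contain the factors
   of all shorter ones. *)
pose ymax : multi m := [ffun k => ord_max].
have ymaxE k : ymax k = m k :> nat by rewrite ffunE.
have wmax : weight ymax = M by rewrite hM; apply: eq_bigr => k _; rewrite ymaxE.
have yE (y : multi m) : fun_of_fin [ffun k => y k : nat] = (fun k => y k : nat).
  by apply/funext => k; rewrite ffunE.
have mE : fun_of_fin mf = m by apply/funext => k; rewrite ffunE.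
have e1 (x : R[i]) k : epoch p (Q ^+ 2) [:: x] k = ep (theta p) Q x k by exact: epoch_1.
have split3 (u v w : R[i]) k : epoch p (Q ^+ 2) [:: u; v; w] k != 0 ->
    [/\ ep (theta p) Q u k != 0, ep (theta p) Q v k != 0 & ep (theta p) Q w k != 0].
  by rewrite epoch_3 !mulf_eq0 !negb_or => /andP[/andP[]].
have split2 (u v : R[i]) k : epoch p (Q ^+ 2) [:: u; v] k != 0 ->
    ep (theta p) Q u k != 0 /\ ep (theta p) Q v k != 0.
  by rewrite epoch_2 mulf_eq0 negb_or => /andP.
have := hL1 ymax; rewrite wmax => /split3[ne nf ng].
have := hR1 ymax; rewrite wmax => /split3[_ nlf nlg].
have main := @bailey_theta _ _ n (sigmaV hp) Q Q0 (@jackson_sigma R p hp Q Q0 _)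
  A B C D E F G L mf Z A0 B0 C0 D0 E0 F0 G0 Z0.
rewrite wM mE in main.
have hz0 : forall j k, ep (theta p) Q (Q ^+ 2 * Z k ^+ 2 / Z j ^+ 2) (m k) != 0.
  by move=> j k; have := hzz ymax j k; rewrite ymaxE e1.
have h1 k : ep (theta p) Q (A ^+ 2 * (Q ^+ 2) ^+ (1 + m k) * Z k ^+ 2) M != 0.
  by have := hL2 ymax k; rewrite wmax e1.
have nL3 k := split3 _ _ _ _ (hL3 ymax k).
have nP2 k := split2 _ _ _ (hP2 k).
have h4 k : ep (theta p) Q (L ^+ 2 * (Q ^+ 2) ^+ (1 + m k) * Z k ^+ 2) M != 0.
  by have := hR2 ymax k; rewrite wmax e1.
have nR3 k := split3 _ _ _ _ (hR3 ymax k).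
have {}main := main bal erefl hV hz0 haz ne nf ng h1.
have {}main := main _ _ _ _ hlz nlf nlg h4 _.
transitivity (\sum_(y <- box mf) eterm (theta p) Q (A ^+ 2) (B ^+ 2) (C ^+ 2) (D ^+ 2)
  (E ^+ 2) (F ^+ 2) (G ^+ 2) m (fun k => Z k ^+ 2) y (wt y)).
  rewrite -big_multi; apply: eq_bigr => y _; rewrite yE -weight_wt.
  exact: eterm_epoch.
rewrite main => [|k|k|k|k|k]; first last.
- by have [_ _ +] := nR3 k; rewrite ymaxE.
- by have [+ _] := nP2 k.
- by have [_ _ +] := nL3 k; rewrite ymaxE.
- by have [_ + _] := nL3 k; rewrite ymaxE.
- by have [+ _ _] := nL3 k; rewrite ymaxE.
congr (_ * _ * _ * _).
- by rewrite !epoch_2.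
- by apply: eq_bigr => k _; rewrite !epoch_2.
rewrite -big_multi; apply: eq_bigr => y _; rewrite yE -weight_wt; symmetry.
apply: eterm_epoch => // [|k|k|k].
- by apply: sub_den; rewrite expf_neq0.
- by rewrite mulrAC.
- by rewrite -(mulrA (A ^+ 2)) -(mulrA (L ^+ 2)); apply: sub_den; rewrite expf_neq0.
- by rewrite -(mulrA (A ^+ 2)) -(mulrA (L ^+ 2)); apply: sub_den; rewrite expf_neq0.
Qed.
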